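(* Suppose that Assumptions (A1) and (A3) of the context hold. Let $f\in Y_B$ and $g\in\mathcal H$ have compact support, and let $0<a<b<+\infty$. Then for any function $h$ holomorphic on the complex plane, $$(h(H)E(a,b)f,g)_{\mathcal H}=-\frac1\pi\int_{\mathcal R}\left(\int_{(a,b)}h(\lambda)\int_{\mathcal R_B}\Im K_B(x,x',\lambda)\,f(x')\,dx'\,d\lambda\right)\bar g(x)\,dx .$$
   Context: $E$ is the resolution of the identity (spectral measure) of $H$ and $E(a,b)$ the spectral projection on $(a,b)$. Graph and operator. Let $\mathcal R$ be a connected metric graph with edges $e_k$, $k\in I=I_B\cup I_U$, where $I_B,I_U$ are (disjoint) finite sets of positive integers and $I_U\neq\emptyset$. For $k\in I_B$, $e_k$ has finite length $\ell_k$ and is identified with $(0,\ell_k)$; for $k\in I_U$, $e_k$ is infinite and identified with $(0,+\infty)$. $\mathcal R_B$ is the subgraph made of the $e_k$, $k\in I_B$, and $\mathcal R_U=\mathcal R\setminus\mathcal R_B$. $V$ is the set of vertices, $I_v$ the set of edges having $v$ as a vertex (a loop is counted with both ends), $V_{\rm ext}=\{v:\#I_v=1\}$, $V_{\rm int}=\{v:\#I_v\ge2\}$, $V_{\rm connecting}=\{v\in V_{\rm int}:I_v\cap I_U\ne\emptyset\}$; $V_{\rm connecting}$ is nonempty and $\#I_v\ge3$ for $v\in V_{\rm connecting}$. The vertices in $V_{\rm int}$ are regarded as interior vertices of $\mathcal R_B$. Put $\mathcal H=L^2(\mathcal R)=\prod_{k\in I}L^2(e_k)$. $H$ is the nonnegative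 self-adjoint operator $Hu=(-u_k'')_{k\in I}$ on $\mathcal H$ with domain the set of $u=(u_k)\in C(\mathcal R)\cap\prod_{k\in I}H^2(e_k)$ with $u(v)=0$ for $v\in V_{\rm ext}$ and $\sum_{k\in I_v}\frac{du_k}{dn_k}(v)=0$ for $v\in V_{\rm int}$ (outward normal derivatives). The set $S_d$. $-\Delta^{\rm Dir}_{\mathcal R_B}$ is the operator $(-u_k'')_{k\in I_B}$ on $L^2(\mathcal R_B)$ with the same type of vertex conditions on $\mathcal R_B$ (continuity, Dirichlet at $V_{\rm ext}$, Kirchhoff at $V_{\rm int}$). $S_d$ is the set of its eigenvalues having an eigenvector $\varphi$ with $\varphi(v)=0$ for all $v\in V_{\rm connecting}$. One has $0\notin S_d$; if $S_d\ne\emptyset$, write $S_d=\{\lambda_m^2\}_{m\in\mathbb N}$, $\lambda_m>0$, repeated according to the number of linearly independent such eigenvectors, with corresponding independent eigenvectors $\varphi^{(m)}$, extended by zero to $\mathcal R_U$. The matrix $\mathcal D(z)$. Let $\mathbb C_+=\{\Im z>0\}$, $\mathbb R^*=\mathbb R\setminus\{0\}$, $N=2\#I_B+\#I_U$. For $z\in\mathbb C_+\cup\mathbb R^*$ one looks for $u$ with $u_k''+z^2u_k=f_k$ on every edge in the form ( * ): $u_k(x)=c_ke^{-izx}+d_ke^{izx}+\frac1{2iz}\int_0^{\ell_k}e^{iz|x-y|}f_k(y)dy$ ($k\in I_B$), $u_k(x)=d_ke^{izx}+\frac1{2iz}\int_0^\infty e^{iz|x-y|}f_k(y)dy$ ($k\in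 I_U$). The vertex conditions of $D(H)$ (Kirchhoff conditions divided by $iz$), written in a fixed order, are a linear system $\mathcal D(z)\big((c_k,d_k)_{k\in I_B},(d_k)_{k\in I_U}\big)^\top=b(z,f)=RF(z,f)$, where $\mathcal D(z)$ is $N\times N$ with entries $0$, $\pm1$, $\pm e^{\pm iz\ell_k}$ or $\pm1\pm e^{\pm iz\ell_k}$ ($k\in I_B$), $R$ is a constant $N\times N$ matrix with entries $0,\pm1$, and $F(z,f)=\big((F_{k+},F_{k-})_{k\in I_B},(F_{k+})_{k\in I_U}\big)^\top$ with $F_{k+}=\frac1{2iz}\int_0^{\ell_k}e^{izy}f_k\,dy$, $F_{k-}=\frac1{2iz}\int_0^{\ell_k}e^{iz(\ell_k-y)}f_k\,dy$ for $k\in I_B$, and $F_{k+}=\frac1{2iz}\int_0^\infty e^{izy}f_k\,dy$ for $k\in I_U$. Put $d(z)=\det\mathcal D(z)$. Assumption (A1). $d(z)=d_d(z)d_c(z)$ for all $z\in\mathbb C_+\cup\mathbb R$, with $d_d,d_c$ holomorphic on $\mathbb C$, polynomials in the variables $e^{izr_j^+\ell_j},e^{-izr_j^-\ell_j}$, $j\in I_B$, for some positive $r_j^+,r_j^-\in\mathbb Q$, with coefficients independent of $z$, such that $d_d(z)=0\Leftrightarrow z^2\in S_d$, and $d_c(z)\ne0$ for all $z\in\mathbb R$. There exist $\mathcal M_c,\mathcal M_p:\mathbb C_+\cup\mathbb R^*\to\mathbb C^{N\times N}$ with entries polynomials of the same kind such that $\operatorname{adj}(\mathcal D(z))=\mathcal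 M_p(z)+d_d(z)\mathcal M_c(z)$ for all $z\in\mathbb C_+\cup\mathbb R^*$. For all $m\in\mathbb N$ there is a matrix $\mathcal M_m$ such that $\mathcal D(z)^{-1}=\frac1{z-\lambda_m}\mathcal M_m+\mathcal R_m(z)$ for $z$ near $\lambda_m$, with $\mathcal R_m$ holomorphic at $\lambda_m$. (If $S_d=\emptyset$ this is understood with $d_d=1$, $\mathcal M_p=0$, the last condition being void.) Subspaces. For $k\in I_U$, $Y_k$ is the closed subspace of functions in $L^2(\mathcal R)$ vanishing on all edges other than $e_k$; $Y_D$ is the closed span of $\{\varphi^{(m)}\}_{m\in\mathbb N}$; $Y_B$ is the orthogonal complement of $(\oplus_{k\in I_U}Y_k)\oplus Y_D$ in $L^2(\mathcal R)$ (so elements of $Y_B$ vanish on $\mathcal R_U$). Assumption (A3). $\mathcal M_p(z)RF(z,f)=0$ for all $f\in Y_B$. Kernel $K_B$. Under (A1) and (A3), for $f\in Y_B$ the coefficient vector is $\mathcal D(z)^{-1}RF(z,f)=\frac1{d_c(z)}\mathcal M_c(z)RF(z,f)$. Inserting the right-hand side in ( * ), for data supported in $\mathcal R_B$, defines a kernel $K_B(x,y,z^2)$, $x\in\mathcal R$, $y\in\mathcal R_B$, with $[(z^2\mathbb I-H)^{-1}f](x)=\int_{\mathcal R_B}K_B(x,y,z^2)f(y)dy$ for $z\in\mathbb C_+$, $f\in Y_B$. It has the form: $K_B=\frac1{2iz}\big(e^{iz|x-y|}+\frac1{d_c(z)}\sum_{\sigma=\pm,\tau=\pm}c^c_{B,k,\sigma,\tau}(z)e^{iz(\sigma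 x+\tau y)}\big)$ for $x,y\in e_k$, $k\in I_B$; $K_B=\frac1{2izd_c(z)}\sum_{\sigma=\pm,\tau=\pm}c^c_{B,k,k',\sigma,\tau}(z)e^{iz(\sigma x+\tau y)}$ for $x\in e_k,y\in e_{k'}$, $k\ne k'\in I_B$; $K_B=\frac1{2izd_c(z)}\sum_{\tau=\pm}c^c_{B,k,k',\tau}(z)e^{iz(x+\tau y)}$ for $x\in e_k$, $k\in I_U$, $y\in e_{k'}$, $k'\in I_B$, with coefficients $c^c_B$ holomorphic in $z$, polynomials in exponentials $e^{izr_j^+\ell_j},e^{-izr_j^-\ell_j}$. For $\lambda>0$, $K_B(x,y,\lambda)$ is given by these formulas with $z=\sqrt\lambda>0$. *)

(* Defs.v *)
From HB Require Import structures.
From mathcomp Require Import all_boot all_order all_algebra.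
From mathcomp Require Import all_classical all_reals all_analysis.
From mathcomp Require Import complex.
From mathcomp Require mpoly.
Set Implicit Arguments.
Unset Strict Implicit.
Unset Printing Implicit Defensive.
Import Order.TTheory GRing.Theory Num.Theory.
Import numFieldNormedType.Exports.
Local Open Scope classical_set_scope.
Local Open Scope ring_scope.
Local Open Scope complex_scope.

Section ComplexAnalysis.
Context {R : realType}.

(* e^{a+ib} = e^a (cos b + i sin b) *)
Definition cexp (z : R[i]) : R[i] :=
  (expR (complex.Re z))%:C * (cos (complex.Im z) +i* sin (complex.Im z)).

(* [R[i]^o] is [R[i]] as a normed space over itself, so [derivable] in the
   direction [1] is complex differentiability. *)
Definition cdiff (h : R[i] -> R[i]) (z : R[i]) : Prop :=
  derivable (h : R[i]^o -> R[i]^o) z 1.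

Definition entire (h : R[i] -> R[i]) : Prop := forall z, cdiff h z.

Definition holomorphic_at (h : R[i] -> R[i]) (z0 : R[i]) : Prop :=
  \forall z \near (z0 : R[i]^o), cdiff h z.

Definition cint (D : set R) (f : R -> R[i]) : R[i] :=
  (\int[lebesgue_measure]_(x in D) complex.Re (f x))
  +i* (\int[lebesgue_measure]_(x in D) complex.Im (f x)).

Definition cmeasurable (D : set R) (f : R -> R[i]) : Prop :=
  measurable_fun D (fun x => complex.Re (f x)) /\
  measurable_fun D (fun x => complex.Im (f x)).

Definition sqmod (z : R[i]) : R := complex.Re z ^+ 2 + complex.Im z ^+ 2.

Definition square_integrable (D : set R) (f : R -> R[i]) : Prop :=
  cmeasurable D f /\
  (\int[lebesgue_measure]_(x in D) (sqmod (f x))%:E < +oo)%E.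

Definition upper_or_real (z : R[i]) : Prop := 0 <= complex.Im z.

(* C_+ together with the nonzero reals *)
Definition upper_or_real_nz (z : R[i]) : Prop := 0 <= complex.Im z /\ z != 0.

End ComplexAnalysis.

(* An edge is [inl k] (finite) or [inr k] (infinite).  A slot is
   [inl (k, true)], [inl (k, false)] or [inr k]; slots index both
   - the ends of edges: x = 0 and x = len k on [inl k], x = 0 on [inr k];
   - the unknowns c_k, d_k (k finite) and d_k (k infinite).
   [enum] lists them as (.., (k, true), (k, false), ..) followed by the infinite
   edges, i.e. in the order of the vectors ((c_k, d_k), (d_k)) and
   ((F_k+, F_k-), (F_k+)). *)
Definition slot_of (B U : finType) : finType := ((B * bool) + U)%type.
Definition edge_of (B U : finType) : finType := (B + U)%type.

Definition slot_edge (B U : finType) (e : slot_of B U) : edge_of B U :=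
  match e with inl kb => inl kb.1 | inr k => inr k end.

Section Incidence.
Variables (B U V : finType).

(* number of edge ends at [v]; a loop contributes two *)
Definition degree (at_end : slot_of B U -> V) (v : V) : nat :=
  #|[set e : slot_of B U | at_end e == v]|.

Definition vertex_adj (at_end : slot_of B U -> V) : rel V :=
  fun v w => [exists k : B, exists b : bool,
    (at_end (inl (k, b)) == v) && (at_end (inl (k, ~~ b)) == w)].

Definition is_connecting (at_end : slot_of B U -> V) (v : V) : bool :=
  (1 < degree at_end v)%N && [exists k : U, at_end (inr k) == v].

End Incidence.

Record metric_graph (R : realType) := MetricGraph {
  IB : finType;
  IU : finType;
  vertex : finType;
  len : IB -> R;
  vert : slot_of IB IU -> vertex;
  len_gt0 : forall k, 0 < len k;
  IU_neq0 : (0 < #|IU|)%N;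
  graph_connected : forall v w, connect (vertex_adj vert) v w;
  connecting_neq0 : exists v, is_connecting vert v;
  connecting_degree : forall v, is_connecting vert v -> (3 <= degree vert v)%N
}.

Section Graph.
Context {R : realType} (G : metric_graph R).

Definition slot : finType := slot_of (IB G) (IU G).
Definition edge : finType := edge_of (IB G) (IU G).
Definition v_ext (v : vertex G) : bool := degree (@vert R G) v == 1%N.
Definition v_int (v : vertex G) : bool := (2 <= degree (@vert R G) v)%N.
Definition v_connecting (v : vertex G) : bool := is_connecting (@vert R G) v.

Definition edge_dom (k : edge) : set R :=
  match k with inl j => `]0, len j[ | inr _ => `]0, +oo[ end.

Definition edge_cl (k : edge) : set R :=
  match k with inl j => `[0, len j] | inr _ => `[0, +oo[ end.

Definition end_pos (e : slot) : R :=
  match e with inl (k, false) => len k | _ => 0 end.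

(* sign of the outward direction at an end, relative to increasing x *)
Definition end_sign (e : slot) : R[i] :=
  match e with inl (_, false) => 1 | _ => - 1 end.

(* A family of complex functions on the edges; elements of L^2(graph) are such
   families, taken up to [eq_ae]. *)
Definition gfun : Type := edge -> R -> R[i].

Definition L2 (u : gfun) : Prop := forall k, square_integrable (edge_dom k) (u k).

Definition eq_ae_on (k : edge) (u v : R -> R[i]) : Prop :=
  {ae lebesgue_measure, forall x, edge_dom k x -> u x = v x}.

Definition eq_ae (u v : gfun) : Prop := forall k, eq_ae_on k (u k) (v k).

Definition gcomb (c : R[i]) (u v : gfun) : gfun := fun k x => c * u k x + v k x.

Definition inner (u v : gfun) : R[i] :=
  \sum_(k : edge) cint (edge_dom k) (fun x => u k x * conjc (v k x)).

Definition vanishes_on (k : edge) (u : gfun) : Prop := eq_ae_on k (u k) (fun=> 0).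

(* The finite edges are bounded, so only the infinite ones constrain the
   support; vertices may belong to it. *)
Definition compact_support (u : gfun) : Prop :=
  exists M : R, forall k : IU G,
    {ae lebesgue_measure, forall x, M < x -> u (inr k) x = 0}.

(* H^2 on the edge [k]: [u] is the continuously differentiable representative,
   [du] its derivative, [ddu] the second derivative. *)
Definition H2_on (k : edge) (u du ddu : R -> R[i]) : Prop :=
  [/\ square_integrable (edge_dom k) u,
      square_integrable (edge_dom k) du,
      square_integrable (edge_dom k) ddu,
      (forall x, edge_cl k x -> u x = u 0 + cint `[0, x] du) &
      (forall x, edge_cl k x -> du x = du 0 + cint `[0, x] ddu)].

(* Conditions on the values [U] and outward derivatives [W] at the ends of the
   edges in [P]; exterior and interior refer to the whole graph. *)
Definition vertex_conditions (P : pred edge) (U W : slot -> R[i]) : Prop :=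
  [/\ (forall e e', P (slot_edge e) -> P (slot_edge e') ->
         vert e = vert e' -> U e = U e'),
      (forall e, P (slot_edge e) -> v_ext (vert e) -> U e = 0) &
      (forall v, v_int v ->
         \sum_(e : slot | P (slot_edge e) && (vert e == v)) W e = 0)].

Definition end_value (u : gfun) (e : slot) : R[i] := u (slot_edge e) (end_pos e).
Definition end_deriv (du : gfun) (e : slot) : R[i] :=
  end_sign e * du (slot_edge e) (end_pos e).

Definition lap_dom (P : pred edge) (u du ddu : gfun) : Prop :=
  (forall k, P k -> H2_on k (u k) (du k) (ddu k)) /\
  vertex_conditions P (end_value u) (end_deriv du).

Definition Hop (u w : gfun) : Prop :=
  exists v dv ddv : gfun,
    [/\ lap_dom predT v dv ddv, eq_ae u v & eq_ae w (fun k x => - ddv k x)].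

Definition is_bounded_edge (k : edge) : bool := if k is inl _ then true else false.

(* [phi], zero on the infinite edges, restricts to a (possibly zero) solution of
   -phi'' = mu phi in the domain of the Dirichlet Laplacian of the bounded part,
   and vanishes at the connecting vertices. *)
Definition Sd_space (mu : R[i]) (phi : gfun) : Prop :=
  L2 phi /\ (forall k : IU G, vanishes_on (inr k) phi) /\
  exists v dv ddv : gfun,
    [/\ lap_dom is_bounded_edge v dv ddv,
        (forall k : IB G, eq_ae_on (inl k) (phi (inl k)) (v (inl k))),
        (forall k : IB G,
           eq_ae_on (inl k) (fun x => - ddv (inl k) x) (fun x => mu * v (inl k) x)) &
        (forall e, is_bounded_edge (slot_edge e) -> v_connecting (vert e) ->
           end_value v e = 0)].

Definition Sd : set R[i] :=
  [set mu | exists phi, Sd_space mu phi /\ ~ eq_ae phi (fun _ _ => 0)].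

Definition Y_U (k : IU G) (u : gfun) : Prop :=
  L2 u /\ forall j : edge, j != inr k -> vanishes_on j u.

(* The span of the phi^(m) is the span of all the eigenspaces [Sd_space mu]. *)
Definition Y_D (u : gfun) : Prop :=
  L2 u /\ forall eps : R, 0 < eps ->
    exists (n : nat) (mu : 'I_n -> R[i]) (phi : 'I_n -> gfun),
      (forall i, Sd_space (mu i) (phi i)) /\
      let r : gfun := fun k x => u k x - \sum_(i < n) phi i k x in
      complex.Re (inner r r) < eps.

Definition Y_B (f : gfun) : Prop :=
  L2 f /\ forall (y : IU G -> gfun) (p : gfun),
    (forall k, Y_U k (y k)) -> Y_D p ->
    inner f (fun j x => \sum_(k : IU G) y k j x + p j x) = 0.

(* Resolutions of the identity on L^2(graph).  The scalar measures
   A |-> (E(A)u, u) are carried as data, which is where countable additivity and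
   E(set0) = 0 come from. *)
Record resolution := Resolution {
  Eproj : set R -> gfun -> gfun;
  sm : gfun -> {measure set (measurableTypeR R) -> \bar R};
  Eproj_L2 : forall A u, measurable A -> L2 u -> L2 (Eproj A u);
  Eproj_linear : forall A c u v, measurable A -> L2 u -> L2 v ->
    eq_ae (Eproj A (gcomb c u v)) (gcomb c (Eproj A u) (Eproj A v));
  Eproj_sym : forall A u v, measurable A -> L2 u -> L2 v ->
    inner (Eproj A u) v = inner u (Eproj A v);
  Eproj_I : forall A B u, measurable A -> measurable B -> L2 u ->
    eq_ae (Eproj (A `&` B) u) (Eproj A (Eproj B u));
  Eproj_T : forall u, L2 u -> eq_ae (Eproj setT u) u;
  smE : forall A u, measurable A -> L2 u ->
    sm u A = (complex.Re (inner (Eproj A u) u))%:E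
}.

Section SpectralIntegral.
Variable E : resolution.

Definition int_sm (h : R -> R[i]) (u : gfun) : R[i] :=
  Rintegral (sm E u) setT (fun x => complex.Re (h x))
  +i* Rintegral (sm E u) setT (fun x => complex.Im (h x)).

(* domain of the operator [h dE] *)
Definition sp_dom (h : R -> R[i]) (u : gfun) : Prop :=
  L2 u /\ (\int[sm E u]_(x in setT) (sqmod (h x))%:E < +oo)%E.

(* integral of [h] against the complex measure (E(.)u, v), by polarization *)
Definition sp_form (h : R -> R[i]) (u v : gfun) : R[i] :=
  4%:R^-1 * \sum_(n < 4) 'i%C ^+ n * int_sm h (gcomb ('i%C ^+ n) v u).

(* graph of the operator [h dE]: (w, v) is tested on its dense domain, where the
   four integrals in [sp_form] converge *)
Definition sp_graph (h : R -> R[i]) (u w : gfun) : Prop :=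
  [/\ sp_dom h u, L2 w & forall v, sp_dom h v -> inner w v = sp_form h u v].

Definition fcalc (h : R -> R[i]) (u : gfun) : gfun :=
  xget (fun _ _ => 0) [set w | sp_graph h u w].

(* [E] is the resolution of the identity of [T]: [T] is the operator x dE *)
Definition is_resolution_of (T : gfun -> gfun -> Prop) : Prop :=
  forall u w, L2 u -> L2 w -> (T u w <-> sp_graph (fun x => x%:C) u w).

End SpectralIntegral.

Definition N : nat := #|slot|.

Lemma NE : N = (2 * #|IB G| + #|IU G|)%N.
Proof. by rewrite /N card_sum card_prod card_bool mulnC. Qed.

(* One scalar equation: u(e) = u(e'), u(e) = 0, or the Kirchhoff sum at v. *)
Inductive vcond :=
  | Continuity of slot & slot
  | Dirichlet of slot
  | Kirchhoff of vertex G.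

Definition vcond_lhs (c : vcond) (U W : slot -> R[i]) : R[i] :=
  match c with
  | Continuity e e' => U e - U e'
  | Dirichlet e => U e
  | Kirchhoff v => \sum_(e : slot | vert e == v) W e
  end.

Definition lists_vertex_conditions (conds : 'I_N -> vcond) : Prop :=
  forall U W : slot -> R[i],
    vertex_conditions predT U W <-> forall i, vcond_lhs (conds i) U W = 0.

Definition unknown_sign (j : slot) : R[i] :=
  match j with inl (_, true) => - 1 | _ => 1 end.

(* the exponential multiplying the unknown [j]: e^{-izx} for c_k, e^{izx} for d_k *)
Definition basis (z : R[i]) (j : slot) (x : R) : R[i] :=
  cexp (unknown_sign j * 'i%C * z * x%:C).

(* value, and outward derivative divided by iz, of that exponential at the end [e] *)
Definition tr_value (z : R[i]) (j e : slot) : R[i] :=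
  if slot_edge e == slot_edge j then basis z j (end_pos e) else 0.
Definition tr_deriv (z : R[i]) (j e : slot) : R[i] :=
  end_sign e * unknown_sign j * tr_value z j e.

(* weights defining F_{k+} and F_{k-} *)
Definition weight (z : R[i]) (l : slot) (y : R) : R[i] :=
  match l with
  | inl (k, false) => cexp ('i%C * z * (len k - y)%:C)
  | _ => cexp ('i%C * z * y%:C)
  end.

Definition Fentry (z : R[i]) (f : gfun) (l : slot) : R[i] :=
  (2%:R * 'i%C * z)^-1 *
  cint (edge_dom (slot_edge l)) (fun y => weight z l y * f (slot_edge l) y).

Definition Fvec (z : R[i]) (f : gfun) : 'cV[R[i]]_N :=
  \col_i Fentry z f (enum_val i).

Section System.
Variable conds : 'I_N -> vcond.

Definition Dmat (z : R[i]) : 'M[R[i]]_N :=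
  \matrix_(i, j) vcond_lhs (conds i) (tr_value z (enum_val j)) (tr_deriv z (enum_val j)).

(* At the end [e], the value of the integral term
   1/(2iz) int e^{iz|x-y|} f_k(y) dy and its outward derivative divided by iz are
   both equal to the entry [e] of F(z,f). *)
Definition Rmat : 'M[R[i]]_N :=
  \matrix_(i, l) - vcond_lhs (conds i) (fun e => (e == enum_val l)%:R)
                                       (fun e => (e == enum_val l)%:R).

(* K_B(x, y, z^2) for x in the edge [k] and y in the finite edge [k'] *)
Definition KB (d_c : R[i] -> R[i]) (Mc : R[i] -> 'M[R[i]]_N) (z : R[i])
    (k : edge) (x : R) (k' : IB G) (y : R) : R[i] :=
  (2%:R * 'i%C * z)^-1 *
  ((if k == inl k' then cexp ('i%C * z * `|x - y|%:C) else 0) +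
   (d_c z)^-1 *
   \sum_(j : slot | slot_edge j == k) \sum_(b : bool)
      basis z j x * (Mc z *m Rmat) (enum_rank j) (enum_rank (inl (k', b) : slot))
      * weight z (inl (k', b)) y).

(* On [D], [p] is a polynomial in e^{iz rp_j len_j}, e^{-iz rm_j len_j} *)
Definition exp_polynomial (D : set R[i]) (p : R[i] -> R[i]) : Prop :=
  exists (rp rm : IB G -> rat) (P : mpoly.mpoly #|{: IB G * bool}| R[i]),
    [/\ (forall j, 0 < rp j), (forall j, 0 < rm j) &
      forall z, D z -> p z = mpoly.meval (fun i =>
        let: (j, b) := enum_val i in
        if b then cexp ('i%C * z * (ratr (rp j) * len j)%:C)
        else cexp (- 'i%C * z * (ratr (rm j) * len j)%:C)) P].

Record assumption_A1 (d_d d_c : R[i] -> R[i]) (Mp Mc : R[i] -> 'M[R[i]]_N) : Prop :=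
  AssumptionA1 {
  A1_factor : forall z, upper_or_real z -> \det (Dmat z) = d_d z * d_c z;
  A1_entire : entire d_d /\ entire d_c;
  A1_exp : exp_polynomial setT d_d /\ exp_polynomial setT d_c;
  (* z = 0 is left out: det D(0) = 0 as soon as the graph has a cycle, whereas 0
     is never in S_d *)
  A1_zeros : forall z, upper_or_real_nz z -> (d_d z = 0 <-> Sd (z ^+ 2));
  A1_dc_neq0 : forall x : R, d_c x%:C != 0;
  A1_exp_mx : forall i j,
    exp_polynomial upper_or_real_nz (fun z => Mp z i j) /\
    exp_polynomial upper_or_real_nz (fun z => Mc z i j);
  A1_adj : forall z, upper_or_real_nz z -> \adj (Dmat z) = Mp z + d_d z *: Mc z;
  A1_pole : forall lam : R, 0 < lam -> Sd ((lam ^+ 2)%:C) ->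
    exists (M : 'M[R[i]]_N) (Rm : R[i] -> 'M[R[i]]_N),
      (forall i j, holomorphic_at (fun z => Rm z i j) lam%:C) /\
      \forall z \near (lam%:C : R[i]^o), z != lam%:C ->
        Dmat z \in unitmx /\ invmx (Dmat z) = (z - lam%:C)^-1 *: M + Rm z;
  A1_empty : Sd = set0 ->
    (forall z, d_d z = 1) /\ (forall z, upper_or_real_nz z -> Mp z = 0)
}.

Definition assumption_A3 (Mp : R[i] -> 'M[R[i]]_N) : Prop :=
  forall z f, upper_or_real_nz z -> Y_B f -> Mp z *m Rmat *m Fvec z f = 0.

End System.

End Graph.

(* Main.v *)
(** For Im z > 0, Re z > 0, the operator z^2 - H is injective, since an integral
    of x dE has no nonreal eigenvalue; hence D(z) is invertible, the ansatz gives
    the resolvent, and on Y_B assumption (A3) reduces the resolvent to the kernel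
    K_B.  As Y_B is stable under complex conjugation, the difference of the
    resolvents at l + i eps and l - i eps is, on Y_B, 2i times integration against
    Im K_B; spectrally it is -2 pi i times the Poisson kernel of width eps.  Since
    d_c has no real zero, K_B is bounded and Lipschitz in z near the positive real
    axis, locally uniformly in x and y, so integrating in l and letting eps tend to
    0 (Stone's formula) gives the density of (E(.)f,v) on (a,b) for every compactly
    supported v.  By Fubini, the right-hand side is the inner product with a
    function w0 such that (w0,v) = (h(H)E(a,b)f,v) for all these v; their density
    makes w0 square integrable and equal to h(H)E(a,b)f. *)
Require Import Defs.
From HB Require Import structures.
From mathcomp Require Import all_boot all_order all_algebra.
From mathcomp Require Import all_classical all_reals all_analysis.
From mathcomp Require Import measurable_realfun complex.
From mathcomp Require mpoly.
From mathcomp Require Import ring lra.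
Set Implicit Arguments.
Unset Strict Implicit.
Unset Printing Implicit Defensive.
Import Order.TTheory GRing.Theory Num.Theory.
Import numFieldNormedType.Exports.
Local Open Scope classical_set_scope.
Local Open Scope ring_scope.
Local Open Scope complex_scope.

(** * Complex numbers with the l1 norm *)

(** Neither the sesquilinearity of [sp_form] nor a formula for resolvents comes with the data:
    [sp_form] is defined by polarization, and [is_resolution_of] speaks only of the integral of x
    dE. Both are derived from one principle, [functional_hind_eq0]: a functional that is linear on
    bounded Borel functions, continuous under bounded pointwise convergence and zero on the
    half-weighted indicators [hind c d] is zero on every continuous function cut off to an interval.
    It is applied to differences of two spectral forms, or of a spectral form and an integral. The
    half weights at the end points are those that Stone's formula yields when E may have atoms
    there. The function h may be unbounded on the spectrum, and [fcalc] is a choice in the graph of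
    h dE. Hence the computed candidate is shown to lie in this graph, and two elements of the graph
    are compared on the dense set of spectral cutoffs. Cauchy-Schwarz estimates are replaced by
    arithmetic-geometric ones: replacing a vector by t times itself and choosing t turns a quadratic
    bound into the one required. *)

Section Norm1.
Context {R : realType}.
Implicit Types z w : R[i].

(** The norm of [R[i]] takes its values in [R[i]]; this one is real, submultiplicative, and splits
    into the two components, as does the componentwise integral. *)
Definition n1 z : R := `|complex.Re z| + `|complex.Im z|.

Lemma cReD z w : complex.Re (z + w) = complex.Re z + complex.Re w.
Proof. by case: z => ? ?; case: w. Qed.
Lemma cImD z w : complex.Im (z + w) = complex.Im z + complex.Im w.
Proof. by case: z => ? ?; case: w. Qed.
Lemma cReN z : complex.Re (- z) = - complex.Re z.
Proof. by case: z. Qed.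
Lemma cImN z : complex.Im (- z) = - complex.Im z.
Proof. by case: z. Qed.
Lemma cReM z w : complex.Re (z * w) =
  complex.Re z * complex.Re w - complex.Im z * complex.Im w.
Proof. by case: z => ? ?; case: w. Qed.
Lemma cImM z w : complex.Im (z * w) =
  complex.Re z * complex.Im w + complex.Im z * complex.Re w.
Proof. by case: z => ? ?; case: w. Qed.
Lemma cReJ z : complex.Re (conjc z) = complex.Re z.
Proof. by case: z. Qed.
Lemma cImJ z : complex.Im (conjc z) = - complex.Im z.
Proof. by case: z. Qed.

Lemma complex_ext z w : complex.Re z = complex.Re w -> complex.Im z = complex.Im w -> z = w.
Proof. by case: z => ? ?; case: w => ? ? /= -> ->. Qed.

Lemma realCD (x y : R) : (x + y)%:C = x%:C + y%:C :> R[i].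
Proof. exact: rmorphD. Qed.
Lemma realCB (x y : R) : (x - y)%:C = x%:C - y%:C :> R[i].
Proof. exact: rmorphB. Qed.

Lemma realCM (x y : R) : (x * y)%:C = x%:C * y%:C :> R[i].
Proof. exact: rmorphM. Qed.
Lemma realCV (x : R) : (x^-1)%:C = (x%:C)^-1 :> R[i].
Proof. exact: fmorphV. Qed.
Lemma realC_nat n : (n%:R : R)%:C = n%:R :> R[i].
Proof. exact: rmorph_nat. Qed.

Lemma conjcD z w : conjc (z + w) = conjc z + conjc w.
Proof. exact: rmorphD. Qed.
Lemma conjcM z w : conjc (z * w) = conjc z * conjc w.
Proof. exact: rmorphM. Qed.
Lemma conjcN z : conjc (- z) = - conjc z.
Proof. exact: rmorphN. Qed.

Lemma conjc_sum I (r : seq I) (P : pred I) (F : I -> R[i]) :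
  conjc (\sum_(i <- r | P i) F i) = \sum_(i <- r | P i) conjc (F i).
Proof. exact: rmorph_sum. Qed.

Lemma n1_ge0 z : 0 <= n1 z. Proof. by rewrite addr_ge0. Qed.
Lemma n1_eq0 z : n1 z = 0 -> z = 0.
Proof.
move=> /eqP; rewrite paddr_eq0// !normr_eq0 => /andP[/eqP a /eqP b].
exact: complex_ext.
Qed.
Lemma n10 : n1 (0 : R[i]) = 0. Proof. by rewrite /n1 /= normr0 addr0. Qed.
Lemma n1D z w : n1 (z + w) <= n1 z + n1 w.
Proof. by rewrite /n1 cReD cImD addrACA lerD// ler_normD. Qed.
Lemma n1N z : n1 (- z) = n1 z.
Proof. by rewrite /n1 cReN cImN !normrN. Qed.
Lemma n1B z w : n1 (z - w) <= n1 z + n1 w.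
Proof. by rewrite (le_trans (n1D _ _))// n1N. Qed.

Lemma n1J z : n1 (conjc z) = n1 z.
Proof. by rewrite /n1 cReJ cImJ normrN. Qed.
Lemma n1M z w : n1 (z * w) <= n1 z * n1 w.
Proof.
rewrite /n1 cReM cImM.
apply: (@le_trans _ _ (`|complex.Re z * complex.Re w| + `|complex.Im z * complex.Im w| +
   (`|complex.Re z * complex.Im w| + `|complex.Im z * complex.Re w|))).
  by apply: lerD; [exact: ler_normB|exact: ler_normD].
rewrite !normrM; lra.
Qed.
Lemma n1_real (x : R) : n1 x%:C = `|x|.
Proof. by rewrite /n1 /= normr0 addr0. Qed.
Lemma n1Zreal (t : R) z : 0 <= t -> n1 (t%:C * z) = t * n1 z.
Proof.
move=> t0; rewrite /n1 cReM cImM /= !mul0r subr0 addr0 !normrM (ger0_norm t0).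
by rewrite -mulrDr.
Qed.
Lemma n1_1 : n1 (1 : R[i]) = 1.
Proof. by rewrite (n1_real 1) normr1. Qed.
Lemma n1_Re z : `|complex.Re z| <= n1 z.
Proof. by rewrite lerDl. Qed.
Lemma n1_Im z : `|complex.Im z| <= n1 z.
Proof. by rewrite lerDr. Qed.
Lemma n1_sum I (r : seq I) (P : pred I) (F : I -> R[i]) :
  n1 (\sum_(i <- r | P i) F i) <= \sum_(i <- r | P i) n1 (F i).
Proof.
elim/big_rec2 : _ => [|i x y _ h]; first by rewrite n10.
by rewrite (le_trans (n1D _ _))// lerD2l.
Qed.
Lemma sqmod_ge0 z : 0 <= sqmod z.
Proof. by rewrite addr_ge0// sqr_ge0. Qed.
Lemma sqmod_n1 z : sqmod z <= n1 z ^+ 2.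
Proof.
rewrite /sqmod /n1 sqrrD !real_normK ?num_real//.
have : 0 <= `|complex.Re z| * `|complex.Im z| by rewrite mulr_ge0.
rewrite -mulr_natl; lra.
Qed.
Lemma n1_sqmod z : n1 z ^+ 2 <= 2 * sqmod z.
Proof.
rewrite /sqmod /n1 -(real_normK (num_real (complex.Re z))) -(real_normK (num_real (complex.Im z))).
have := sqr_ge0 (`|complex.Re z| - `|complex.Im z|); lra.
Qed.
Lemma sqmodM z w : sqmod (z * w) = sqmod z * sqmod w.
Proof. rewrite /sqmod cReM cImM; ring. Qed.
Lemma sqmodJ z : sqmod (conjc z) = sqmod z.
Proof. by rewrite /sqmod cReJ cImJ sqrrN. Qed.
Lemma mulcJ z : z * conjc z = (sqmod z)%:C.
Proof. apply: complex_ext; rewrite ?cReM ?cImM cReJ cImJ /sqmod /=; ring. Qed.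
Lemma sqmod_eq0 z : (sqmod z == 0) = (z == 0).
Proof.
rewrite /sqmod paddr_eq0 ?sqr_ge0// !sqrf_eq0.
by case: z => a b /=; rewrite eq_complex.
Qed.
(** The inverse is [conjc z] divided by [sqmod z], and the factor 2 is the constant of [n1_sqmod];
    it is attained at 1 + i. *)
Lemma n1V z : n1 z^-1 <= 2 / n1 z.
Proof.
have [->|z0] := eqVneq z 0; first by rewrite invr0 n10 invr0 mulr0.
have s0 : 0 < sqmod z by rewrite lt_def sqmod_ge0 sqmod_eq0 z0.
have -> : z^-1 = conjc z * ((sqmod z)^-1)%:C.
  apply: (mulfI z0); rewrite divff// mulrA mulcJ -rmorphM/= divff ?rmorph1//.
  by rewrite gt_eqF.
have n0 : 0 < n1 z.
  rewrite lt_def n1_ge0 andbT; apply: contraNN z0 => /eqP /n1_eq0 ->//.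
rewrite (le_trans (n1M _ _))// n1J n1_real ger0_norm ?invr_ge0 ?sqmod_ge0//.
rewrite ler_pdivlMr// mulrAC -expr2 ler_pdivrMr//.
exact: n1_sqmod.
Qed.

Lemma sqmod_real (x : R) : sqmod x%:C = x ^+ 2.
Proof. by rewrite /sqmod /= expr0n addr0. Qed.

Lemma sqmod1 : sqmod (1 : R[i]) = 1.
Proof. by rewrite (sqmod_real 1) expr1n. Qed.

Lemma sqmodD_le z w : sqmod (z + w) <= 2 * sqmod z + 2 * sqmod w.
Proof.
rewrite /sqmod cReD cImD.
have := sqr_ge0 (complex.Re z - complex.Re w).
have := sqr_ge0 (complex.Im z - complex.Im w); lra.
Qed.

End Norm1.

(** * Convergence of complex sequences *)

Section Ccvg.
Context {R : realType}.
Implicit Types (u v : nat -> R[i]).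

Definition ccvg u (l : R[i]) : Prop := (n1 (u n - l) @[n --> \oo] --> (0 : R)).

Lemma ccvgP u l : ccvg u l <->
  (complex.Re (u n) @[n --> \oo] --> complex.Re l) /\
  (complex.Im (u n) @[n --> \oo] --> complex.Im l).
Proof.
split=> [ul|[a b]].
- split; apply/cvgrPdist_le => e e0;
    move/cvgrPdist_le : ul => /(_ e e0); apply: filterS => n;
    rewrite sub0r normrN ger0_norm ?n1_ge0// => h; rewrite distrC;
    apply: le_trans h.
    by rewrite -cReN -cReD n1_Re.
  by rewrite -cImN -cImD n1_Im.
- rewrite /ccvg /n1.
  rewrite -[X in _ --> X](addr0 0).
  apply: cvgD.
  + apply/norm_cvg0P; under eq_fun do rewrite cReD cReN.
    by apply/subr_cvg0.
  + apply/norm_cvg0P; under eq_fun do rewrite cImD cImN.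
    by apply/subr_cvg0.
Qed.

Lemma ccvg_unique u l1 l2 : ccvg u l1 -> ccvg u l2 -> l1 = l2.
Proof.
move=> /ccvgP[a b] /ccvgP[c d]; apply: complex_ext.
- by rewrite -(cvg_lim (@norm_hausdorff _ _) a) (cvg_lim (@norm_hausdorff _ _) c).
- by rewrite -(cvg_lim (@norm_hausdorff _ _) b) (cvg_lim (@norm_hausdorff _ _) d).
Qed.

Lemma ccvg_cst l : ccvg (fun=> l) l.
Proof. by apply/ccvgP; split; exact: cvg_cst. Qed.

Lemma ccvgD u v l m : ccvg u l -> ccvg v m -> ccvg (fun n => u n + v n) (l + m).
Proof.
move=> /ccvgP[a b] /ccvgP[c d]; apply/ccvgP; rewrite cReD cImD; split.
- by under eq_fun do rewrite cReD; exact: cvgD.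
- by under eq_fun do rewrite cImD; exact: cvgD.
Qed.

Lemma ccvgM u v l m : ccvg u l -> ccvg v m -> ccvg (fun n => u n * v n) (l * m).
Proof.
move=> /ccvgP[a b] /ccvgP[c d]; apply/ccvgP; rewrite cReM cImM; split.
- by under eq_fun do rewrite cReM; apply: cvgB; apply: cvgM.
- by under eq_fun do rewrite cImM; apply: cvgD; apply: cvgM.
Qed.

Lemma ccvgZ c u l : ccvg u l -> ccvg (fun n => c * u n) (c * l).
Proof. by move=> ul; apply: ccvgM => //; exact: ccvg_cst. Qed.

Lemma ccvg_sum (I : finType) (u : I -> nat -> R[i]) (l : I -> R[i]) :
  (forall i, ccvg (u i) (l i)) ->
  ccvg (fun n => \sum_i u i n) (\sum_i l i).
Proof.
move=> h; elim: (index_enum I) => [|i s ih].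
  by under eq_fun do rewrite big_nil; rewrite big_nil; exact: ccvg_cst.
by under eq_fun do rewrite big_cons; rewrite big_cons; exact: ccvgD.
Qed.

Lemma ccvg_near_bound u l (b : nat -> R) :
  (\forall n \near \oo, n1 (u n - l) <= b n) -> b n @[n --> \oo] --> (0 : R) -> ccvg u l.
Proof.
move=> h; apply: (@squeeze_cvgr _ _ _ _ (fun=> 0)); last exact: cvg_cst.
by near=> n; rewrite n1_ge0/=; near: n.
Unshelve. all: by end_near. Qed.

End Ccvg.

(** * Complex-valued measurability and integration *)

Section AlmostEverywhere.
Context {R : realType} {d} {T : measurableType d} (mu : {measure set T -> \bar R}).
Implicit Types P Q S : T -> Prop.

Lemma ae_imp P Q : (forall x, P x -> Q x) ->
  {ae mu, forall x, P x} -> {ae mu, forall x, Q x}.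
Proof. by move=> PQ; apply: filterS. Qed.

Lemma ae_imp2 P Q S : (forall x, P x -> Q x -> S x) ->
  {ae mu, forall x, P x} -> {ae mu, forall x, Q x} -> {ae mu, forall x, S x}.
Proof. by move=> PQ; apply: filterS2. Qed.

End AlmostEverywhere.

Section ComplexMeasurable.
Context {R : realType} {d} {T : measurableType d}.
Implicit Types (D : set T) (f g : T -> R[i]).

Definition cmf D f : Prop :=
  measurable_fun D (fun x => complex.Re (f x)) /\
  measurable_fun D (fun x => complex.Im (f x)).

Lemma cmf_cst D (c : R[i]) : cmf D (fun=> c).
Proof. by split; exact: measurable_cst. Qed.

Lemma cmfD D f g : cmf D f -> cmf D g -> cmf D (fun x => f x + g x).
Proof.
move=> [a b] [a' b']; split.
- by under eq_fun do rewrite cReD; exact: measurable_funD.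
- by under eq_fun do rewrite cImD; exact: measurable_funD.
Qed.

Lemma cmfN D f : cmf D f -> cmf D (fun x => - f x).
Proof.
move=> [a b]; split.
- by under eq_fun do rewrite cReN; exact: measurableT_comp.
- by under eq_fun do rewrite cImN; exact: measurableT_comp.
Qed.

Lemma cmfB D f g : cmf D f -> cmf D g -> cmf D (fun x => f x - g x).
Proof. by move=> a b; apply: cmfD => //; exact: cmfN. Qed.

Lemma cmfM D f g : cmf D f -> cmf D g -> cmf D (fun x => f x * g x).
Proof.
move=> [a b] [a' b']; split.
- by under eq_fun do rewrite cReM; apply: measurable_funB; exact: measurable_funM.
- by under eq_fun do rewrite cImM; apply: measurable_funD; exact: measurable_funM.
Qed.

Lemma cmfJ D f : cmf D f -> cmf D (fun x => conjc (f x)).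
Proof.
move=> [a b]; split.
- by under eq_fun do rewrite cReJ.
- by under eq_fun do rewrite cImJ; exact: measurableT_comp.
Qed.

Lemma cmf_real D (f : T -> R) : measurable_fun D f -> cmf D (fun x => (f x)%:C).
Proof. by move=> mf; split => //=; exact: measurable_cst. Qed.

Lemma eq_cmf D f g : {in D, f =1 g} -> cmf D f -> cmf D g.
Proof.
move=> fg [a b]; split.
- by apply: eq_measurable_fun a => x xD; rewrite fg.
- by apply: eq_measurable_fun b => x xD; rewrite fg.
Qed.

Lemma cmf_sum D (I : Type) (s : seq I) (P : pred I) (f : I -> T -> R[i]) :
  (forall i, P i -> cmf D (f i)) -> cmf D (fun x => \sum_(i <- s | P i) f i x).
Proof.
move=> h; elim: s => [|i s ih].
  by apply: eq_cmf (cmf_cst D 0) => x _; rewrite big_nil.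
have [Pi|nPi] := boolP (P i).
  by apply: eq_cmf (cmfD (h i Pi) ih) => x _; rewrite big_cons Pi.
by apply: eq_cmf ih => x _; rewrite big_cons (negbTE nPi).
Qed.

Lemma cmfS (D E : set T) f : measurable E -> D `<=` E -> cmf E f -> cmf D f.
Proof. by move=> mE DE [a b]; split; exact: measurable_funS mE DE _. Qed.

Lemma cmf_sqmod D f : cmf D f -> measurable_fun D (fun x => sqmod (f x)).
Proof. by move=> [a b]; apply: measurable_funD; exact: measurable_funX. Qed.

Lemma cmf_cexp D f : cmf D f -> cmf D (fun x => cexp (f x)).
Proof.
move=> [a b]; apply: cmfM.
  by apply: cmf_real; apply: measurableT_comp => //; exact: measurable_expR.
have [mc ms] : measurable_fun setT (@cos R) /\ measurable_fun setT (@sin R).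
  by split; apply: continuous_measurable_fun;
    [exact: continuous_cos|exact: continuous_sin].
by split => /=; apply: measurableT_comp.
Qed.

Lemma cmf_cvg D (f : nat -> T -> R[i]) g : (forall n, cmf D (f n)) ->
  (forall x, D x -> ccvg (f^~ x) (g x)) -> cmf D g.
Proof.
move=> mf fg; split.
- apply: (@measurable_fun_cvg _ _ _ D (fun n x => complex.Re (f n x))) => [n|x Dx].
    by case: (mf n).
  by have /ccvgP[] := fg x Dx.
- apply: (@measurable_fun_cvg _ _ _ D (fun n x => complex.Im (f n x))) => [n|x Dx].
    by case: (mf n).
  by have /ccvgP[] := fg x Dx.
Qed.

End ComplexMeasurable.

Lemma cmf_comp {R : realType} {d d'} {T : measurableType d} {T' : measurableType d'}
    (f : T' -> R[i]) (g : T -> T') (D : set T) :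
  cmf setT f -> measurable_fun D g -> cmf D (fun x => f (g x)).
Proof. by move=> [a b] mg; split; [exact: measurableT_comp a mg|exact: measurableT_comp b mg]. Qed.

Section ComplexIntegral.
Context {R : realType} {d} {T : measurableType d} (mu : {measure set T -> \bar R}).
Implicit Types (D : set T) (f g : T -> R[i]).

Definition cinteg D f : R[i] :=
  (\int[mu]_(x in D) complex.Re (f x)) +i* (\int[mu]_(x in D) complex.Im (f x)).

Definition cintegrable D f : Prop :=
  mu.-integrable D (EFin \o (fun x => complex.Re (f x))) /\
  mu.-integrable D (EFin \o (fun x => complex.Im (f x))).

Lemma cintegrable_cmf D f : cintegrable D f -> cmf D f.
Proof.
by move=> [a b]; split; apply/measurable_EFinP;
  [exact: measurable_int a|exact: measurable_int b].
Qed.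

Lemma eq_cinteg D f g : {in D, f =1 g} -> cinteg D f = cinteg D g.
Proof.
by move=> fg; congr (_ +i* _); apply: eq_Rintegral => x xD; rewrite fg.
Qed.

Lemma eq_cintegrable D f g : measurable D -> {in D, f =1 g} ->
  cintegrable D f -> cintegrable D g.
Proof.
move=> mD fg [a b]; split.
- by apply: eq_integrable a => //= x xD; rewrite fg.
- by apply: eq_integrable b => //= x xD; rewrite fg.
Qed.

Section fixD.
Variables (D : set T) (mD : measurable D).

Lemma cintegrable_dom f (g : T -> R) : cmf D f ->
  mu.-integrable D (EFin \o g) -> (forall x, D x -> n1 (f x) <= g x) ->
  cintegrable D f.
Proof.
move=> [a b] ig fg; split.
- apply: le_integrable ig => //; first exact/measurable_EFinP.
  move=> x Dx /=; rewrite lee_fin (le_trans _ (ler_norm _))//.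
  by rewrite (le_trans (n1_Re _))// fg.
- apply: le_integrable ig => //; first exact/measurable_EFinP.
  move=> x Dx /=; rewrite lee_fin (le_trans _ (ler_norm _))//.
  by rewrite (le_trans (n1_Im _))// fg.
Qed.

Lemma le_Rintegrable (f g : T -> R) : measurable_fun D f ->
  mu.-integrable D (EFin \o g) -> (forall x, D x -> `|f x| <= g x) ->
  mu.-integrable D (EFin \o f).
Proof.
move=> mf ig fg; apply: le_integrable ig => //; first exact/measurable_EFinP.
by move=> x Dx /=; rewrite lee_fin (le_trans (fg _ Dx))// ler_norm.
Qed.

Lemma RintegrableD (f g : T -> R) : mu.-integrable D (EFin \o f) ->
  mu.-integrable D (EFin \o g) -> mu.-integrable D (EFin \o (fun x => f x + g x)).
Proof. by move=> fi gi; apply: eq_integrable (integrableD mD fi gi). Qed.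

Lemma RintegrableZ (c : R) (f : T -> R) : mu.-integrable D (EFin \o f) ->
  mu.-integrable D (EFin \o (fun x => c * f x)).
Proof. by move=> fi; apply: eq_integrable (integrableZl mD c fi). Qed.

Lemma integrable_n1 f : cintegrable D f -> mu.-integrable D (EFin \o (fun x => n1 (f x))).
Proof.
move=> [a b].
have := integrableD mD (integrable_norm a) (integrable_norm b).
by apply: eq_integrable.
Qed.

Lemma cintegrableP f : cintegrable D f <->
  cmf D f /\ mu.-integrable D (EFin \o (fun x => n1 (f x))).
Proof.
split=> [h|[mf h]]; first by split; [exact: cintegrable_cmf|exact: integrable_n1].
exact: cintegrable_dom h _.
Qed.

Lemma cintegrableD f g : cintegrable D f -> cintegrable D g ->
  cintegrable D (fun x => f x + g x).
Proof.
move=> [a b] [a' b']; split.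
- by apply: eq_integrable (integrableD mD a a') => // x _; rewrite /= cReD.
- by apply: eq_integrable (integrableD mD b b') => // x _; rewrite /= cImD.
Qed.

Lemma cintegD f g : cintegrable D f -> cintegrable D g ->
  cinteg D (fun x => f x + g x) = cinteg D f + cinteg D g.
Proof.
move=> [a b] [a' b']; apply: complex_ext; rewrite ?cReD ?cImD /=.
- by under eq_Rintegral do rewrite cReD; rewrite RintegralD.
- by under eq_Rintegral do rewrite cImD; rewrite RintegralD.
Qed.

Lemma cintegrableMl (c : T -> R[i]) (M : R) f : cmf D c ->
  (forall x, D x -> n1 (c x) <= M) -> cintegrable D f ->
  cintegrable D (fun x => c x * f x).
Proof.
move=> mc cM fi; have [mf nf] := (cintegrableP f).1 fi.
apply: (@cintegrable_dom _ (fun x => M * n1 (f x))); first exact: cmfM.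
  by apply: eq_integrable (integrableZl mD M nf).
move=> x Dx; rewrite (le_trans (n1M _ _))// ler_wpM2r ?n1_ge0//.
exact: cM.
Qed.

Lemma cintegrableZ c f : cintegrable D f -> cintegrable D (fun x => c * f x).
Proof. by apply: (cintegrableMl (M := n1 c)) => //; exact: cmf_cst. Qed.

Lemma cintegrableN f : cintegrable D f -> cintegrable D (fun x => - f x).
Proof.
move=> /(cintegrableZ (-1)); apply: eq_cintegrable => // x _.
by rewrite mulN1r.
Qed.

Lemma cintegrableB f g : cintegrable D f -> cintegrable D g ->
  cintegrable D (fun x => f x - g x).
Proof. by move=> fi gi; apply: cintegrableD => //; exact: cintegrableN. Qed.

Lemma cintegrableJ f : cintegrable D f -> cintegrable D (fun x => conjc (f x)).
Proof.
move=> /cintegrableP[mf fi]; apply: (cintegrable_dom _ fi); first exact: cmfJ.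
by move=> x _; rewrite n1J.
Qed.

Lemma cintegZ c f : cintegrable D f -> cinteg D (fun x => c * f x) = c * cinteg D f.
Proof.
move=> [a b].
have h (r : R) (k : T -> R) : mu.-integrable D (EFin \o k) ->
    mu.-integrable D (EFin \o (fun x => r * k x)).
  by move=> ik; apply: eq_integrable (integrableZl mD r ik).
apply: complex_ext; rewrite ?cReM ?cImM /=.
- under eq_Rintegral do rewrite cReM.
  by rewrite RintegralB// ?RintegralZl//; exact: h.
- under eq_Rintegral do rewrite cImM.
  by rewrite RintegralD// ?RintegralZl//; exact: h.
Qed.

Lemma cintegN f : cintegrable D f -> cinteg D (fun x => - f x) = - cinteg D f.
Proof.
move=> fi; rewrite -mulN1r -cintegZ//.
by apply: eq_cinteg => x _; rewrite mulN1r.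
Qed.

Lemma cintegB f g : cintegrable D f -> cintegrable D g ->
  cinteg D (fun x => f x - g x) = cinteg D f - cinteg D g.
Proof.
by move=> fi gi; rewrite cintegD ?cintegN//; exact: cintegrableN.
Qed.

Lemma cintegJ f : cintegrable D f ->
  cinteg D (fun x => conjc (f x)) = conjc (cinteg D f).
Proof.
move=> [a b]; apply: complex_ext; rewrite ?cReJ ?cImJ /=.
- by under eq_Rintegral do rewrite cReJ.
- under eq_Rintegral do rewrite cImJ -mulN1r.
  by rewrite RintegralZl// mulN1r.
Qed.

Lemma cintegrable0 : cintegrable D (fun=> 0).
Proof. by split; exact: integrable0. Qed.

Lemma cinteg0 : cinteg D (fun=> 0) = 0.
Proof. by apply: complex_ext; rewrite /= /Rintegral integral0. Qed.

Lemma cintegrable_sum (I : Type) (s : seq I) (P : pred I) (f : I -> T -> R[i]) :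
  (forall i, P i -> cintegrable D (f i)) ->
  cintegrable D (fun x => \sum_(i <- s | P i) f i x).
Proof.
move=> h; elim: s => [|i s ih].
  by apply: eq_cintegrable cintegrable0 => // x _; rewrite big_nil.
have [Pi|nPi] := boolP (P i).
  by apply: eq_cintegrable (cintegrableD (h i Pi) ih) => // x _; rewrite big_cons Pi.
by apply: eq_cintegrable ih => // x _; rewrite big_cons (negbTE nPi).
Qed.

Lemma cinteg_sum (I : Type) (s : seq I) (P : pred I) (f : I -> T -> R[i]) :
  (forall i, P i -> cintegrable D (f i)) ->
  cinteg D (fun x => \sum_(i <- s | P i) f i x) = \sum_(i <- s | P i) cinteg D (f i).
Proof.
move=> h; elim: s => [|i s ih].
  by rewrite big_nil -[RHS]cinteg0; apply: eq_cinteg => x _; rewrite big_nil.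
rewrite big_cons -ih; case: ifPn => Pi; last first.
  by apply: eq_cinteg => x _; rewrite big_cons (negbTE Pi).
rewrite -cintegD; [|exact: h|exact: cintegrable_sum].
by apply: eq_cinteg => x _; rewrite big_cons Pi.
Qed.

Lemma n1_cinteg f : cintegrable D f -> n1 (cinteg D f) <= \int[mu]_(x in D) n1 (f x).
Proof.
move=> [a b].
rewrite /n1/= RintegralD//; [|exact: (integrable_norm a)|exact: (integrable_norm b)].
by apply: lerD; exact: le_normr_Rintegral.
Qed.

Lemma n1_cinteg_le f (g : T -> R) : cmf D f ->
  mu.-integrable D (EFin \o g) -> (forall x, D x -> n1 (f x) <= g x) ->
  n1 (cinteg D f) <= \int[mu]_(x in D) g x.
Proof.
move=> mf ig fg; have fi := cintegrable_dom mf ig fg.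
by rewrite (le_trans (n1_cinteg fi))// le_Rintegral//; exact: integrable_n1.
Qed.

Lemma cintegrable_bounded f (M : R) : (mu D < +oo)%E -> cmf D f ->
  (forall x, D x -> n1 (f x) <= M) -> cintegrable D f.
Proof.
move=> fD mf fM; apply: (cintegrable_dom mf _ fM).
apply: (@measurable_bounded_integrable _ _ _ mu (cst M)) => //.
apply: bounded_cst.
Qed.

Lemma ae_eq_cinteg f g : cmf D f -> cmf D g ->
  {ae mu, forall x, D x -> f x = g x} -> cinteg D f = cinteg D g.
Proof.
move=> [a b] [a' b'] fg; congr (_ +i* _).
- congr fine; apply: ae_eq_integral => //; [exact/measurable_EFinP|exact/measurable_EFinP|].
  by apply: filterS fg => x h Dx; rewrite h.
- congr fine; apply: ae_eq_integral => //; [exact/measurable_EFinP|exact/measurable_EFinP|].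
  by apply: filterS fg => x h Dx; rewrite h.
Qed.

Lemma Rintegral_cvg_dct (f : nat -> T -> R) (l g : T -> R) :
  (forall n, measurable_fun D (f n)) -> measurable_fun D l ->
  mu.-integrable D (EFin \o g) ->
  (forall n x, D x -> `|f n x| <= g x) ->
  (forall x, D x -> f n x @[n --> \oo] --> l x) ->
  \int[mu]_(x in D) f n x @[n --> \oo] --> \int[mu]_(x in D) l x.
Proof.
move=> mf ml ig fg fl.
have [] := @dominated_convergence _ _ _ mu D mD (fun n => EFin \o f n) (EFin \o l) (EFin \o g).
- by move=> n; exact/measurable_EFinP.
- exact/measurable_EFinP.
- by apply: aeW => x Dx; apply: cvg_EFin; [near=> n|exact: fl].
- exact: ig.
- by apply: aeW => x n Dx; rewrite /= lee_fin fg.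
move=> il _ h.
rewrite /Rintegral; apply: fine_cvg; rewrite fineK//; exact: integrable_fin_num.
Unshelve. all: by end_near. Qed.

Lemma cinteg_dct (f : nat -> T -> R[i]) (l : T -> R[i]) (g : T -> R) :
  (forall n, cmf D (f n)) -> cmf D l ->
  mu.-integrable D (EFin \o g) ->
  (forall n x, D x -> n1 (f n x) <= g x) ->
  (forall x, D x -> ccvg (f^~ x) (l x)) ->
  ccvg (fun n => cinteg D (f n)) (cinteg D l).
Proof.
move=> mf [ml1 ml2] ig fg fl; apply/ccvgP; split => /=.
- apply: (Rintegral_cvg_dct (g := g)) => //.
  + by move=> n; case: (mf n).
  + by move=> n x Dx; rewrite (le_trans (n1_Re _))// fg.
  + by move=> x Dx; have /ccvgP[] := fl x Dx.
- apply: (Rintegral_cvg_dct (g := g)) => //.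
  + by move=> n; case: (mf n).
  + by move=> n x Dx; rewrite (le_trans (n1_Im _))// fg.
  + by move=> x Dx; have /ccvgP[] := fl x Dx.
Qed.

End fixD.

Lemma cintegrableS (D E : set T) f : measurable E -> measurable D -> D `<=` E ->
  cintegrable E f -> cintegrable D f.
Proof. by move=> mE mD DE [a b]; split; exact: (integrableS mE mD DE). Qed.

Definition ind (A : set T) (x : T) : R[i] := (\1_A x)%:C.

Lemma ind_in (A : set T) x : x \in A -> ind A x = 1.
Proof. by move=> xA; rewrite /ind indicE xA. Qed.

Lemma ind_out (A : set T) x : x \notin A -> ind A x = 0.
Proof. by move=> /negbTE xA; rewrite /ind indicE xA. Qed.

Lemma cinteg_setIr (D A : set T) f :
  cinteg (D `&` A) f = cinteg D (fun x => ind A x * f x).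
Proof.
congr (_ +i* _).
- rewrite Rintegral_mkcondr; apply: eq_Rintegral => x _.
  by rewrite /ind cReM /= mul0r subr0 patchE indicE; case: ifPn; rewrite ?mul1r ?mul0r.
- rewrite Rintegral_mkcondr; apply: eq_Rintegral => x _.
  by rewrite /ind cImM /= mul0r addr0 patchE indicE; case: ifPn; rewrite ?mul1r ?mul0r.
Qed.

Lemma cinteg_mkcond (D : set T) f :
  cinteg D f = cinteg setT (fun x => ind D x * f x).
Proof. by rewrite -cinteg_setIr setTI. Qed.

Lemma cmf_ind D (A : set T) : measurable A -> cmf D (ind A).
Proof. by move=> mA; apply: cmf_real; exact: measurable_indic. Qed.

Lemma n1_ind A x : n1 (ind A x) <= 1.
Proof. by rewrite /ind n1_real indicE; case: (_ \in _); rewrite ?normr1 ?normr0. Qed.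

Lemma cmf_mkcond (D : set T) f : measurable D -> cmf D f ->
  cmf setT (fun x => ind D x * f x).
Proof.
move=> mD [a b]; split.
- have := (measurable_restrictT _ mD).1 a; apply: eq_measurable_fun => x _.
  by rewrite /ind cReM /= mul0r subr0 patchE indicE; case: ifPn; rewrite ?mul1r ?mul0r.
- have := (measurable_restrictT _ mD).1 b; apply: eq_measurable_fun => x _.
  by rewrite /ind cImM /= mul0r addr0 patchE indicE; case: ifPn; rewrite ?mul1r ?mul0r.
Qed.

Lemma cintegrable_mkcond (D : set T) f : measurable D -> cintegrable D f ->
  cintegrable setT (fun x => ind D x * f x).
Proof.
move=> mD [a b]; split.
- have := (integrable_mkcond _ mD).1 a; apply: eq_integrable => // x _.
  by rewrite /ind /= cReM /= mul0r subr0 patchE indicE; case: ifPn; rewrite ?mul1r ?mul0r.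
- have := (integrable_mkcond _ mD).1 b; apply: eq_integrable => // x _.
  by rewrite /ind /= cImM /= mul0r addr0 patchE indicE; case: ifPn; rewrite ?mul1r ?mul0r.
Qed.

Lemma cinteg_ind (D A : set T) : measurable D -> measurable A ->
  cinteg D (ind A) = (fine (mu (D `&` A)))%:C.
Proof.
move=> mD mA.
rewrite -[LHS](eq_cinteg (f := fun x => ind A x * 1)); last by move=> x _; rewrite mulr1.
rewrite -cinteg_setIr; apply: complex_ext => /=.
- by rewrite Rintegral_cst ?mul1r//; exact: measurableI.
- by rewrite Rintegral_cst ?mul0r//; exact: measurableI.
Qed.

Lemma cinteg_setU (A B : set T) f : measurable A -> measurable B ->
  cintegrable (A `|` B) f -> [disjoint A & B] ->
  cinteg (A `|` B) f = cinteg A f + cinteg B f.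
Proof.
move=> mA mB [a b] AB; apply: complex_ext; rewrite ?cReD ?cImD /=;
  exact: Rintegral_setU.
Qed.

End ComplexIntegral.
Arguments ind {R d T}.

Lemma integrable_indic_lty {R : realType} {d} {T : measurableType d}
    (mu : {measure set T -> \bar R}) (A : set T) : measurable A ->
  (mu A < +oo)%E -> mu.-integrable setT (EFin \o \1_A).
Proof.
move=> mA fA; apply/integrableP; split; first exact/measurable_EFinP.
rewrite (eq_integral (fun x => (\1_A x)%:E)); last first.
  by move=> t _; rewrite gee0_abs// lee_fin.
by rewrite integral_indic// setIT.
Qed.

(** * Fubini's theorem for complex integrands *)

Section ComplexFubini.
Context {R : realType} {d d'} {T : measurableType d} {T' : measurableType d'}.
Variables (mu : {sigma_finite_measure set T -> \bar R})
          (nu : {sigma_finite_measure set T' -> \bar R}).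

Lemma Rfubini_integrable (f : T * T' -> R) (g : T' -> R) (A : set T) :
  measurable_fun setT f -> measurable A -> (mu A < +oo)%E ->
  nu.-integrable setT (EFin \o g) ->
  (forall x y, `|f (x, y)| <= \1_A x * g y) ->
  (mu \x nu)%E.-integrable setT (EFin \o f).
Proof.
move=> mf mA fA ig fg.
have mg : measurable_fun setT g by exact/measurable_EFinP/(measurable_int _ ig).
apply/integrable12ltyP; first exact/measurable_EFinP.
apply: (@le_lt_trans _ _ (\int[mu]_x (\1_A x * \int[nu]_y `|g y|)%:E)%E); last first.
  apply: integrable_lty => //.
  have -> : (fun x => (\1_A x * \int[nu]_y `|g y|)%:E) =
     (fun x => (\int[nu]_y `|g y|)%:E * (EFin \o \1_A) x)%E.
    by apply/funext => x /=; rewrite -EFinM mulrC.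
  by apply: integrableZl => //; exact: integrable_indic_lty.
apply: ge0_le_integral => //.
- by move=> x _; apply: integral_ge0.
- apply: (measurable_fun_fubini_tonelli_F (abse \o (EFin \o f))) => //=.
  by apply: measurableT_comp => //; exact/measurable_EFinP.
- apply/measurable_EFinP; apply: measurable_funM => //.
- move=> x _.
  apply: (@le_trans _ _ (\int[nu]_y (\1_A x * `|g y|)%:E)%E).
    apply: ge0_le_integral => //.
    + apply: measurableT_comp => //; apply/measurable_EFinP.
      by apply: measurableT_comp.
    + by apply/measurable_EFinP; apply: measurable_funM => //; exact: measurableT_comp.
    + move=> y _; rewrite lee_fin (le_trans (fg _ _))//.
      by rewrite ler_wpM2l// ler_norm.
  rewrite le_eqVlt; apply/orP; left; apply/eqP.
  rewrite EFinM fineK; last first.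
    by apply: integrable_fin_num => //; exact: integrable_norm.
  under [LHS]eq_integral do rewrite EFinM.
  by rewrite ge0_integralZl//; apply/measurable_EFinP; exact: measurableT_comp.
Qed.

Lemma Rfubini_measurable (f : T * T' -> R) (g : T' -> R) (A : set T) :
  measurable_fun setT f -> measurable A -> (mu A < +oo)%E ->
  nu.-integrable setT (EFin \o g) ->
  (forall x y, `|f (x, y)| <= \1_A x * g y) ->
  measurable_fun setT (fun x => \int[nu]_y f (x, y)).
Proof.
move=> mf mA fA ig fg; apply: measurableT_comp => //.
exact: (measurable_fubini_F (Rfubini_integrable mf mA fA ig fg)).
Qed.

Lemma RFubini (f : T * T' -> R) (g : T' -> R) (A : set T) :
  measurable_fun setT f -> measurable A -> (mu A < +oo)%E ->
  nu.-integrable setT (EFin \o g) ->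
  (forall x y, `|f (x, y)| <= \1_A x * g y) ->
  \int[mu]_x \int[nu]_y f (x, y) = \int[nu]_y \int[mu]_x f (x, y).
Proof.
move=> mf mA fA ig fg.
have imf := Rfubini_integrable mf mA fA ig fg.
(* The inner [Rintegral] is the [fine] part of an extended integral, which is finite for almost
   every x by integrability of f; so [fine] alters it on a null set only. *)
have key1 : (\int[mu]_x (\int[nu]_y f (x,y))%:E = \int[mu]_x \int[nu]_y (f (x,y))%:E)%E.
  apply: ae_eq_integral => //.
  - have : measurable_fun setT (fun x => fine (\int[nu]_y (f (x,y))%:E)%E).
      apply: measurableT_comp => //.
      exact: (measurable_fubini_F imf).
    by move=> h; exact/measurable_EFinP.
  - exact: (measurable_fubini_F imf).
  - apply: filterS (ae_integrable1 imf) => x h _.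
    by rewrite fineK//; exact: integrable_fin_num.
have key2 : (\int[nu]_y (\int[mu]_x f (x,y))%:E = \int[nu]_y \int[mu]_x (f (x,y))%:E)%E.
  apply: ae_eq_integral => //.
  - have : measurable_fun setT (fun y => fine (\int[mu]_x (f (x,y))%:E)%E).
      apply: measurableT_comp => //.
      exact: (measurable_fubini_G imf).
    by move=> h; exact/measurable_EFinP.
  - exact: (measurable_fubini_G imf).
  - apply: filterS (ae_integrable2 imf) => x h _.
    by rewrite fineK//; exact: integrable_fin_num.
rewrite [LHS]/Rintegral [RHS]/Rintegral; congr fine.
by rewrite key1 key2; exact: (Fubini imf).
Qed.

Lemma cinteg_fubini (f : T * T' -> R[i]) (g : T' -> R) (A : set T) :
  cmf setT f -> measurable A -> (mu A < +oo)%E ->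
  nu.-integrable setT (EFin \o g) ->
  (forall x y, n1 (f (x, y)) <= \1_A x * g y) ->
  cinteg mu setT (fun x => cinteg nu setT (fun y => f (x, y))) =
  cinteg nu setT (fun y => cinteg mu setT (fun x => f (x, y))).
Proof.
move=> [a b] mA fA ig fg; apply: complex_ext => /=.
- apply: (RFubini (f := fun z => complex.Re (f z)) (g := g) (A := A)) => //.
  by move=> x y; rewrite (le_trans (n1_Re _)).
- apply: (RFubini (f := fun z => complex.Im (f z)) (g := g) (A := A)) => //.
  by move=> x y; rewrite (le_trans (n1_Im _)).
Qed.

Lemma cmf_fubini (f : T * T' -> R[i]) (g : T' -> R) (A : set T) :
  cmf setT f -> measurable A -> (mu A < +oo)%E ->
  nu.-integrable setT (EFin \o g) ->
  (forall x y, n1 (f (x, y)) <= \1_A x * g y) ->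
  cmf setT (fun x => cinteg nu setT (fun y => f (x, y))).
Proof.
move=> [a b] mA fA ig fg; split => /=.
- apply: (Rfubini_measurable (f := fun z => complex.Re (f z)) a mA fA ig) => // x y.
  by rewrite (le_trans (n1_Re _)).
- apply: (Rfubini_measurable (f := fun z => complex.Im (f z)) b mA fA ig) => // x y.
  by rewrite (le_trans (n1_Im _)).
Qed.

End ComplexFubini.

(** Fubini on the rectangle [A] x [B], after extension by zero to the whole product. The weight [a]
    and the kernel [k] are bounded, [A] has finite measure and [g] is integrable, which provides the
    majorant. The first conclusion is kept because it is the source of measurability for functions
    defined by such integrals. *)
Lemma cinteg_kernel {R : realType} {d d'} {T : measurableType d}
    {T' : measurableType d'} (mu : {sigma_finite_measure set T -> \bar R})
    (nu : {sigma_finite_measure set T' -> \bar R})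
    (k : T * T' -> R[i]) (a : T -> R[i]) (g : T' -> R[i]) (A : set T) (B : set T') (M : R) :
  measurable A -> measurable B -> (mu A < +oo)%E ->
  cmf (A `*` B) k -> cmf A a -> cintegrable nu B g ->
  (forall x y, A x -> B y -> n1 (k (x, y)) <= M) ->
  (forall x, A x -> n1 (a x) <= M) ->
  cmf A (fun x => a x * cinteg nu B (fun y => k (x, y) * g y)) /\
  cinteg mu A (fun x => a x * cinteg nu B (fun y => k (x, y) * g y)) =
  cinteg nu B (fun y => cinteg mu A (fun x => a x * k (x, y)) * g y).
Proof.
move=> mA mB fA mk ma ig kM aM.
pose f (z : T * T') := ind (A `*` B) z * (a z.1 * k z * g z.2).
have mAB : measurable (A `*` B) by exact: measurableX.
have [mg ng] := (cintegrableP _ mB _).1 ig.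
have indX x y : ind (A `*` B) (x, y) = ind A x * ind B y :> R[i].
  by rewrite /ind -rmorphM/= !indicE in_setX/= -natrM mulnb.
have mf : cmf setT f.
  apply: cmf_mkcond => //; apply: cmfM; first apply: cmfM => //.
  - split.
    + apply: (measurable_comp (F := A) (f := fun x => complex.Re (a x)) (g := fst)) => //.
      * by move=> _ [[x y] [/= Ax By] <-].
      * by case: ma.
      * exact: measurable_funTS.
    + apply: (measurable_comp (F := A) (f := fun x => complex.Im (a x)) (g := fst)) => //.
      * by move=> _ [[x y] [/= Ax By] <-].
      * by case: ma.
      * exact: measurable_funTS.
  - split.
    + apply: (measurable_comp (F := B) (f := fun x => complex.Re (g x)) (g := snd)) => //.
      * by move=> _ [[x y] [/= Ax By] <-].
      * by case: mg.
      * exact: measurable_funTS.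
    + apply: (measurable_comp (F := B) (f := fun x => complex.Im (g x)) (g := snd)) => //.
      * by move=> _ [[x y] [/= Ax By] <-].
      * by case: mg.
      * exact: measurable_funTS.
(* One factor [M] bounds the weight and the other bounds the kernel. *)
pose G y := M * M * (n1 (g y) * \1_B y).
have M0 x : A x -> 0 <= M by move=> Ax; rewrite (le_trans _ (aM _ Ax))// n1_ge0.
have secf x : A x -> cmf B (fun y => k (x, y)).
  move=> Ax; split.
  - apply: (measurable_comp (F := A `*` B) (f := fun x => complex.Re (k x)) (g := pair x)) => //.
    + by move=> _ [y By <-].
    + by case: mk.
    + by apply: measurable_funTS; exact: pair1_measurable.
  - apply: (measurable_comp (F := A `*` B) (f := fun x => complex.Im (k x)) (g := pair x)) => //.
    + by move=> _ [y By <-].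
    + by case: mk.
    + by apply: measurable_funTS; exact: pair1_measurable.
have sec2 y : B y -> cmf A (fun x => k (x, y)).
  move=> By; split.
  - apply: (measurable_comp (F := A `*` B) (f := fun x => complex.Re (k x)) (g := pair^~ y)) => //.
    + by move=> _ [x Ax <-].
    + by case: mk.
    + by apply: measurable_funTS; exact: pair2_measurable.
  - apply: (measurable_comp (F := A `*` B) (f := fun x => complex.Im (k x)) (g := pair^~ y)) => //.
    + by move=> _ [x Ax <-].
    + by case: mk.
    + by apply: measurable_funTS; exact: pair2_measurable.
have fE x : ind A x * (a x * cinteg nu B (fun y => k (x, y) * g y)) =
    cinteg nu setT (fun y => f (x, y)).
  have [xA|xA] := boolP (x \in A).
    have Ax : A x by exact: set_mem.
    rewrite ind_in// mul1r -cintegZ//; last first.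
      by apply: (cintegrableMl _ _ (fun y => @kM x y Ax)) => //; exact: secf.
    rewrite cinteg_mkcond; apply: eq_cinteg => y _; rewrite /f indX /=.
    by rewrite (ind_in xA) mul1r !mulrA.
  rewrite ind_out// mul0r -[LHS](cinteg0 nu setT); apply: eq_cinteg => y _.
  by rewrite /f indX (ind_out xA) !mul0r.
have iG : nu.-integrable setT (EFin \o G).
  have := integrableZl measurableT (M * M) ((integrable_mkcond (mu := nu) _ mB).1 ng).
  apply: eq_integrable => // y _ /=; rewrite /G patchE indicE.
  by case: ifPn; rewrite ?mulr1 ?mulr0 ?mule0.
have fG x y : n1 (f (x, y)) <= \1_A x * G y.
  rewrite /f indX /G.
  have [xA|xA] := boolP (x \in A); last first.
    by rewrite (ind_out xA) !mul0r n10 indicE (negbTE xA) mul0r.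
  have [yB|yB] := boolP (y \in B); last first.
    by rewrite (ind_out yB) mulr0 mul0r n10 !indicE (negbTE yB) !mulr0.
  rewrite (ind_in xA) (ind_in yB) !indicE xA yB !mul1r mulr1 (le_trans (n1M _ _))//.
  rewrite ler_wpM2r ?n1_ge0// (le_trans (n1M _ _))// ler_pM ?n1_ge0//.
  + by apply: aM; exact: set_mem.
  + by apply: kM; exact: set_mem.
split.
  apply: (@eq_cmf _ _ _ _ (fun x => cinteg nu setT (fun y => f (x, y)))).
    by move=> x xA; rewrite -fE ind_in// mul1r.
  apply: (cmfS (E := setT)) => //; exact: (cmf_fubini mf mA fA iG fG).
transitivity (cinteg mu setT (fun x => cinteg nu setT (fun y => f (x, y)))).
  by rewrite [LHS]cinteg_mkcond; apply: eq_cinteg => x _; rewrite fE.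
rewrite (cinteg_fubini mf mA fA iG fG).
rewrite [RHS]cinteg_mkcond; apply: eq_cinteg => y _.
have [yB|yB] := boolP (y \in B).
  have By : B y by exact: set_mem.
  rewrite (ind_in yB) mul1r mulrC -cintegZ//; last first.
    apply: (cintegrableMl mA (M := M)) => //.
    apply: (cintegrable_bounded mA (M := M)) => //; first exact: sec2.
    by move=> x Ax; exact: kM.
  rewrite [RHS]cinteg_mkcond; apply: eq_cinteg => x _; rewrite /f indX /=.
  by rewrite (ind_in yB) mulr1 [g y * _]mulrC !mulrA.
rewrite (ind_out yB) mul0r -[RHS](cinteg0 mu setT); apply: eq_cinteg => x _.
by rewrite /f indX (ind_out yB) mulr0 !mul0r.
Qed.

Lemma cinteg_fubini_kernel {R : realType} {d d'} {T : measurableType d}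
    {T' : measurableType d'} (mu : {sigma_finite_measure set T -> \bar R})
    (nu : {sigma_finite_measure set T' -> \bar R})
    (k : T * T' -> R[i]) (a : T -> R[i]) (g : T' -> R[i]) (A : set T) (B : set T') (M : R) :
  measurable A -> measurable B -> (mu A < +oo)%E ->
  cmf (A `*` B) k -> cmf A a -> cintegrable nu B g ->
  (forall x y, A x -> B y -> n1 (k (x, y)) <= M) ->
  (forall x, A x -> n1 (a x) <= M) ->
  cinteg mu A (fun x => a x * cinteg nu B (fun y => k (x, y) * g y)) =
  cinteg nu B (fun y => cinteg mu A (fun x => a x * k (x, y)) * g y).
Proof. by move=> mA mB fA mk ma ig kM aM; case: (cinteg_kernel mA mB fA mk ma ig kM aM). Qed.

(** * The Hilbert space of the graph *)

Notation leb := lebesgue_measure.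

(* The domain carries the measurable structure of [lebesgue_measure], whose display
   differs from the default one of [R]. *)
Notation cmfR := (@cmf _ _ (measurableTypeR _)).

Lemma cintE {R : realType} (D : set R) (f : R -> R[i]) : cint D f = cinteg leb D f.
Proof. by []. Qed.

Section L2space.
Context {R : realType} (G : metric_graph R).
Implicit Types (u v w : gfun G) (k : edge G) (c : R[i]).

Lemma measurable_edge_dom k : measurable (edge_dom k : set (measurableTypeR R)).
Proof. by case: k => k; exact: measurable_itv. Qed.
Hint Extern 0 (@measurable _ _ (edge_dom _)) => solve [apply: measurable_edge_dom] : core.

Lemma L2_cmf u k : L2 u -> cmfR (edge_dom k) (u k).
Proof. by move=> /(_ k)[[a b] _]. Qed.

Lemma L2P u : L2 u <-> forall k, cmfR (edge_dom k) (u k) /\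
  leb.-integrable (edge_dom k) (EFin \o (fun x => sqmod (u k x))).
Proof.
split=> [Lu k|h k].
  have [[a b] c] := Lu k; split => //.
  apply/integrableP; split; first exact/measurable_EFinP/cmf_sqmod.
  apply: le_lt_trans c; rewrite le_eqVlt; apply/orP; left; apply/eqP.
  by apply: eq_integral => x _ /=; rewrite ger0_norm// sqmod_ge0.
have [[a b] /integrableP[_ c]] := h k; split => //.
apply: le_lt_trans c; rewrite le_eqVlt; apply/orP; left; apply/eqP.
by apply: eq_integral => x _ /=; rewrite ger0_norm// sqmod_ge0.
Qed.

Lemma integrable_sqmod u k : L2 u ->
  leb.-integrable (edge_dom k) (EFin \o (fun x => sqmod (u k x))).
Proof. by move=> /L2P /(_ k)[]. Qed.

Lemma L2_dom u (g : edge G -> R -> R) :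
  (forall k, cmfR (edge_dom k) (u k)) ->
  (forall k, leb.-integrable (edge_dom k) (EFin \o g k)) ->
  (forall k x, edge_dom k x -> sqmod (u k x) <= g k x) -> L2 u.
Proof.
move=> mu ig ug; apply/L2P => k; split => //.
apply: (le_Rintegrable _ _ (ig k)) => //; first exact: cmf_sqmod.
by move=> x kx; rewrite ger0_norm ?sqmod_ge0// ug.
Qed.

(** Arithmetic-geometric inequality: it dominates a product of two square integrable functions
    pointwise by an integrable one. *)
Lemma n1M_sqmod (a b : R[i]) : n1 (a * b) <= sqmod a + sqmod b.
Proof.
rewrite (le_trans (n1M _ _))//.
have := n1_sqmod a; have := n1_sqmod b; have := sqr_ge0 (n1 a - n1 b); lra.
Qed.

Lemma cintegrable_inner u v k : L2 u -> L2 v ->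
  cintegrable leb (edge_dom k) (fun x => u k x * conjc (v k x)).
Proof.
move=> Lu Lv.
apply: (cintegrable_dom (mu := leb) _ _ (g := fun x => sqmod (u k x) + sqmod (v k x))) => //.
- by apply: cmfM; [exact: L2_cmf|apply: cmfJ; exact: L2_cmf].
- by apply: RintegrableD => //; exact: integrable_sqmod.
- by move=> x _; rewrite (le_trans (n1M_sqmod _ _))// sqmodJ.
Qed.

Lemma L2_gcomb c u v : L2 u -> L2 v -> L2 (gcomb c u v).
Proof.
move=> Lu Lv.
apply: (@L2_dom _ (fun k x => 2 * sqmod c * sqmod (u k x) + 2 * sqmod (v k x))) => [k|k|k x _].
- by apply: cmfD; [apply: cmfM; [exact: cmf_cst|exact: L2_cmf]|exact: L2_cmf].
- by apply: RintegrableD => //; apply: RintegrableZ => //; exact: integrable_sqmod.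
- by rewrite /gcomb (le_trans (sqmodD_le _ _))// sqmodM mulrA.
Qed.

Definition gzero : gfun G := fun _ _ => 0.

Lemma L2_zero : L2 gzero.
Proof.
apply: (@L2_dom _ (fun _ _ => 0)) => [k|k|k x _]; first exact: cmf_cst.
  exact: integrable0.
by rewrite (sqmod_real 0) expr0n.
Qed.

Definition gconj u : gfun G := fun k x => conjc (u k x).

Lemma L2_conj u : L2 u -> L2 (gconj u).
Proof.
move=> Lu; apply: (@L2_dom _ (fun k x => sqmod (u k x))) => [k|k|k x _].
- by apply: cmfJ; exact: L2_cmf.
- exact: integrable_sqmod.
- by rewrite /gconj sqmodJ.
Qed.

Lemma eq_ae_refl u : eq_ae u u.
Proof. by move=> k; exact: aeW. Qed.

Lemma eq_ae_sym u v : eq_ae u v -> eq_ae v u.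
Proof. by move=> uv k; apply: ae_imp (uv k) => x h /h ->.
Qed.
Lemma eq_ae_trans u v w : eq_ae u v -> eq_ae v w -> eq_ae u w.
Proof.
move=> uv vw k; apply: ae_imp2 (uv k) (vw k) => x h1 h2 kx.
by rewrite h1// h2.
Qed.

Lemma eq_ae_gcomb c u v u' v' : eq_ae u u' -> eq_ae v v' -> eq_ae (gcomb c u v) (gcomb c u' v').
Proof.
move=> uu vv k; apply: ae_imp2 (uu k) (vv k) => x h1 h2 kx.
by rewrite /gcomb h1// h2.
Qed.

Lemma innerDl c u v w : L2 u -> L2 v -> L2 w ->
  inner (gcomb c u v) w = c * inner u w + inner v w.
Proof.
move=> Lu Lv Lw; rewrite /inner mulr_sumr -big_split; apply: eq_bigr => k _ /=.
rewrite !cintE -cintegZ//; last exact: cintegrable_inner.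
rewrite -cintegD//; [|exact/cintegrableZ/cintegrable_inner|exact: cintegrable_inner].
by apply: eq_cinteg => x _; rewrite /gcomb; ring.
Qed.

Lemma inner_conjC u v : L2 u -> L2 v -> inner v u = conjc (inner u v).
Proof.
move=> Lu Lv; rewrite /inner conjc_sum; apply: eq_bigr => k _.
rewrite !cintE -cintegJ//; last exact: cintegrable_inner.
by apply: eq_cinteg => x _; rewrite conjcM conjcK mulrC.
Qed.

Lemma innerDr c u v w : L2 u -> L2 v -> L2 w ->
  inner w (gcomb c u v) = conjc c * inner w u + inner w v.
Proof.
move=> Lu Lv Lw; rewrite inner_conjC//; last exact: L2_gcomb.
by rewrite innerDl// conjcD conjcM -!inner_conjC.
Qed.

Lemma inner_gconj u v : L2 u -> L2 v -> inner (gconj u) (gconj v) = conjc (inner u v).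
Proof.
move=> Lu Lv; rewrite -inner_conjC// /inner; apply: eq_bigr => k _; rewrite !cintE.
by apply: eq_cinteg => x _; rewrite /gconj conjcK mulrC.
Qed.

Lemma inner_eq_ael u u' v : L2 u -> L2 u' -> L2 v -> eq_ae u u' -> inner u v = inner u' v.
Proof.
move=> Lu Lu' Lv uu; apply: eq_bigr => k _; rewrite !cintE; apply: ae_eq_cinteg => //.
- by apply: cmfM; [exact: L2_cmf|apply: cmfJ; exact: L2_cmf].
- by apply: cmfM; [exact: L2_cmf|apply: cmfJ; exact: L2_cmf].
- by apply: ae_imp (uu k) => x h /h ->.
Qed.

Lemma inner_eq_aer u v v' : L2 u -> L2 v -> L2 v' -> eq_ae v v' -> inner u v = inner u v'.
Proof.
move=> Lu Lv Lv' uu; apply: eq_bigr => k _; rewrite !cintE; apply: ae_eq_cinteg => //.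
- by apply: cmfM; [exact: L2_cmf|apply: cmfJ; exact: L2_cmf].
- by apply: cmfM; [exact: L2_cmf|apply: cmfJ; exact: L2_cmf].
- by apply: ae_imp (uu k) => x h /h ->.
Qed.

Definition sqnorm u : R := \sum_k \int[leb]_(x in edge_dom k) sqmod (u k x).

Lemma inner_sqnorm u : inner u u = (sqnorm u)%:C.
Proof.
rewrite /inner /sqnorm rmorph_sum/=; apply: eq_bigr => k _; rewrite cintE.
rewrite (_ : (fun x => u k x * _) = (fun x => (sqmod (u k x))%:C)); last first.
  by apply/funext => x; rewrite mulcJ.
by apply: complex_ext => //=; rewrite /Rintegral integral0.
Qed.

Lemma Re_inner_sqnorm u : complex.Re (inner u u) = sqnorm u.
Proof. by rewrite inner_sqnorm. Qed.

Lemma sqnorm_ge0 u : 0 <= sqnorm u.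
Proof. by apply: sumr_ge0 => k _; apply: Rintegral_ge0 => x _; exact: sqmod_ge0. Qed.

Lemma sqnorm_eq0 u : L2 u -> sqnorm u = 0 -> eq_ae u gzero.
Proof.
move=> Lu /eqP; rewrite psumr_eq0; last first.
  by move=> k _; apply: Rintegral_ge0 => x _; exact: sqmod_ge0.
move=> /allP h k; have := h k (mem_index_enum k).
rewrite /= => /eqP z.
have ig := integrable_sqmod k Lu.
(* The real integral z could vanish as the [fine] part of an infinite one; integrability excludes
   this. *)
have e0 : (\int[leb]_(x in edge_dom k) `|(sqmod (u k x))%:E| = 0)%E.
  rewrite -[LHS]fineK; last first.
    by apply: integrable_fin_num => //; exact: (integrable_norm ig).
  rewrite -[RHS]/((0 : R)%:E) -[in RHS]z /Rintegral; congr (fine _)%:E; apply: eq_integral => x _ /=.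
  by rewrite ger0_norm// sqmod_ge0.
have := (ae_eq_integral_abs leb (measurable_edge_dom k) (measurable_int _ ig)).1 e0.
apply: ae_imp => x h1 kx; have := h1 kx => -[] /eqP.
by rewrite sqmod_eq0 => /eqP ->.
Qed.

Lemma sqnorm_eq_ae u v : L2 u -> L2 v -> eq_ae u v -> sqnorm u = sqnorm v.
Proof.
move=> Lu Lv uv; rewrite -!Re_inner_sqnorm.
by rewrite (inner_eq_ael Lu Lv Lu uv) (inner_eq_aer Lv Lu Lv uv).
Qed.

Lemma sqnormZ c u : L2 u -> sqnorm (gcomb c u gzero) = sqmod c * sqnorm u.
Proof.
move=> Lu; rewrite /sqnorm mulr_sumr; apply: eq_bigr => k _.
rewrite -RintegralZl//; last exact: integrable_sqmod.
by apply: eq_Rintegral => x _; rewrite /gcomb addr0 sqmodM.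
Qed.

Lemma sqnormD_le c u v : L2 u -> L2 v ->
  sqnorm (gcomb c u v) <= 2 * sqmod c * sqnorm u + 2 * sqnorm v.
Proof.
move=> Lu Lv; rewrite /sqnorm !mulr_sumr -big_split; apply: ler_sum => k _ /=.
have i1 := RintegrableZ (measurable_edge_dom k) (2 * sqmod c) (integrable_sqmod k Lu).
have i2 := RintegrableZ (measurable_edge_dom k) 2 (integrable_sqmod k Lv).
rewrite -RintegralZl//; last exact: integrable_sqmod.
rewrite -[X in _ <= _ + X]RintegralZl//; last exact: integrable_sqmod.
rewrite -RintegralD//; apply: le_Rintegral => //.
- by apply: integrable_sqmod; exact: L2_gcomb.
- exact: RintegrableD.
- by move=> x _; rewrite /gcomb (le_trans (sqmodD_le _ _))// sqmodM mulrA.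
Qed.

Lemma n1_inner_le u v : L2 u -> L2 v -> n1 (inner u v) <= sqnorm u + sqnorm v.
Proof.
move=> Lu Lv; rewrite (le_trans (n1_sum _ _ _))// /sqnorm -big_split/=.
apply: ler_sum => k _; rewrite cintE -RintegralD//; try exact: integrable_sqmod.
apply: n1_cinteg_le => //.
- by apply: cmfM; [exact: L2_cmf|apply: cmfJ; exact: L2_cmf].
- by apply: RintegrableD => //; exact: integrable_sqmod.
- by move=> x _; rewrite (le_trans (n1M_sqmod _ _))// sqmodJ.
Qed.

Lemma inner0l u : L2 u -> inner gzero u = 0.
Proof.
move=> Lu; have := innerDl (-1) L2_zero L2_zero Lu; rewrite mulN1r addNr => <-.
by congr inner; apply/funext => k; apply/funext => x; rewrite /gcomb /gzero mulr0 addr0.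
Qed.

Lemma inner0r u : L2 u -> inner u gzero = 0.
Proof. by move=> Lu; rewrite inner_conjC ?inner0l ?conjc0//; exact: L2_zero. Qed.

Lemma innerZl c u v : L2 u -> L2 v -> inner (gcomb c u gzero) v = c * inner u v.
Proof. by move=> Lu Lv; rewrite innerDl ?inner0l ?addr0//; exact: L2_zero. Qed.

Lemma innerZr c u v : L2 u -> L2 v -> inner v (gcomb c u gzero) = conjc c * inner v u.
Proof. by move=> Lu Lv; rewrite innerDr ?inner0r ?addr0//; exact: L2_zero. Qed.

(* The scaling [t] makes this a substitute for the Cauchy-Schwarz inequality. *)
Lemma n1_inner_scaled (t : R) u v : 0 < t -> L2 u -> L2 v ->
  n1 (inner u v) <= t * sqnorm u + sqnorm v / t.
Proof.
move=> t0 Lu Lv.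
have := n1_inner_le (L2_gcomb t%:C Lu L2_zero) Lv.
rewrite innerZl// sqnormZ// sqmod_real => h.
have e : n1 (inner u v) = t^-1 * n1 (t%:C * inner u v).
  by rewrite n1Zreal ?ltW// mulKf// gt_eqF.
rewrite e mulrC ler_pdivrMr// (le_trans h)//.
rewrite le_eqVlt; apply/orP; left; apply/eqP; field.
by rewrite gt_eqF.
Qed.

Lemma inner_cvgr u v (s : nat -> gfun G) : L2 u -> L2 v -> (forall n, L2 (s n)) ->
  sqnorm (gcomb (-1) (s n) v) @[n --> \oo] --> 0 -> ccvg (fun n => inner u (s n)) (inner u v).
Proof.
move=> Lu Lv Ls sv.
apply/cvgrPdist_le => e e0.
(* This t makes the first term of [n1_inner_scaled] at most e / 2 for all n; the second one is then
   made small by the convergence of s. The [+ 1] guards against [sqnorm u = 0]. *)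
pose t := e / (2 * (sqnorm u + 1)).
have su : 0 < sqnorm u + 1 by rewrite ltr_pwDr// sqnorm_ge0.
have t0 : 0 < t by rewrite divr_gt0// mulr_gt0.
have te : t * sqnorm u <= e / 2.
  rewrite /t mulrAC ler_pdivrMr ?mulr_gt0//.
  rewrite (_ : e / 2 * _ = e * sqnorm u + e); last by field.
  by rewrite lerDl ltW.
have /cvgrPdist_le/(_ (t * (e / 2))) : sqnorm (gcomb (-1) (s n) v) @[n --> \oo] --> 0 by [].
move=> /(_ (mulr_gt0 t0 (divr_gt0 e0 (ltr0n _ 2)))); apply: filterS => n.
rewrite !sub0r !normrN !ger0_norm ?n1_ge0 ?sqnorm_ge0// => h.
have -> : inner u (s n) - inner u v = - inner u (gcomb (-1) (s n) v).
  by rewrite innerDr// conjcN conjc1; ring.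
rewrite n1N (le_trans (n1_inner_scaled t0 Lu (L2_gcomb _ (Ls n) Lv)))//.
rewrite [e]splitr lerD//.
by rewrite ler_pdivrMr// mulrC.
Qed.

End L2space.
#[export] Hint Extern 0 (@measurable _ _ (edge_dom _)) => solve [apply: measurable_edge_dom] : core.

(** * Spectral forms *)

Lemma sum4 {R : realType} (F : nat -> R[i]) :
  \sum_(n < 4) F n = F 0%N + F 1%N + F 2%N + F 3%N.
Proof. by rewrite !big_ord_recr big_ord0 /= add0r. Qed.

Lemma sqr_ci {R : realType} : 'i%C * 'i%C = -1 :> R[i].
Proof. by rewrite -expr2 sqr_i. Qed.

(** The four letters stand for the entries of the Gram matrix of u and v under a sesquilinear form.
    In the sum over n, the powers of i cancel the terms in uu and vv, those of i^2 = -1 cancel vu,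
    and each n contributes one copy of uv. *)
Lemma polarize4 {R : realType} (uu uv vu vv : R[i]) :
  4%:R^-1 * \sum_(n < 4) 'i%C ^+ n *
    ('i%C ^+ n * conjc ('i%C ^+ n) * vv + 'i%C ^+ n * vu + conjc ('i%C ^+ n) * uv + uu) = uv.
Proof.
have ci : conjc 'i%C = - 'i%C :> R[i] by apply: complex_ext; rewrite /= ?oppr0.
rewrite (sum4 (fun n => 'i%C ^+ n * ('i%C ^+ n * conjc ('i%C ^+ n) * vv +
  'i%C ^+ n * vu + conjc ('i%C ^+ n) * uv + uu))).
have e3 : 'i%C ^+ 3 = - 'i%C :> R[i] by rewrite exprS sqr_i mulrN1.
rewrite expr0 expr1 sqr_i e3 !conjcN ci conjc1.
move: (@sqr_ci R); set i := 'i%C => hi.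
rewrite [X in _ * X = _](_ : _ = 4%:R * uv); first by rewrite mulKf// pnatr_eq0.
transitivity ((2 + 2 * (i * i)) * vu + (2 - 2 * (i * i)) * uv); first by ring.
rewrite hi; ring.
Qed.

Section Spectral.
Context {R : realType} (G : metric_graph R) (E : resolution G).
Implicit Types (u v w : gfun G) (A B : set R) (c : R[i]) (phi psi : R -> R[i]).

(** E(A) is a symmetric idempotent, the latter being [Eproj_I] with both sets equal to A. *)
Lemma Eproj_self A u : measurable A -> L2 u ->
  inner (Eproj E A u) u = (sqnorm (Eproj E A u))%:C.
Proof.
move=> mA Lu; have LE := Eproj_L2 E mA Lu.
rewrite -inner_sqnorm -[in LHS](setIid A).
rewrite (inner_eq_ael (Eproj_L2 E _ Lu) (Eproj_L2 E mA LE) Lu (Eproj_I E mA mA Lu)).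
  by rewrite Eproj_sym.
by rewrite setIid.
Qed.

Lemma smE_sqnorm A u : measurable A -> L2 u -> sm E u A = (sqnorm (Eproj E A u))%:E.
Proof. by move=> mA Lu; rewrite smE// Eproj_self. Qed.

Lemma inner_smE A u : measurable A -> L2 u -> inner (Eproj E A u) u = (fine (sm E u A))%:C.
Proof. by move=> mA Lu; rewrite smE_sqnorm// Eproj_self. Qed.

Lemma smT u : L2 u -> sm E u setT = (sqnorm u)%:E.
Proof.
move=> Lu; rewrite smE// (inner_eq_ael (Eproj_L2 E _ Lu) Lu Lu (Eproj_T E Lu))//.
by rewrite Re_inner_sqnorm.
Qed.

Lemma sm_lty u A : measurable A -> L2 u -> (sm E u A < +oo)%E.
Proof. by move=> mA Lu; rewrite smE// ltry. Qed.

(** By [smE_sqnorm], the mass of A depends on u only through the class of E(A)u. All comparisons of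
    spectral measures below go through this remark. *)
Lemma sm_eq A u v : measurable A -> L2 u -> L2 v ->
  eq_ae (Eproj E A u) (Eproj E A v) -> sm E u A = sm E v A.
Proof.
move=> mA Lu Lv uv; rewrite !smE_sqnorm//; congr _%:E.
by apply: sqnorm_eq_ae => //; exact: Eproj_L2.
Qed.

Lemma inner_EprojDl A c u v w : measurable A -> L2 u -> L2 v -> L2 w ->
  inner (Eproj E A (gcomb c u v)) w = c * inner (Eproj E A u) w + inner (Eproj E A v) w.
Proof.
move=> mA Lu Lv Lw; have LE x (Lx : L2 x) := Eproj_L2 E mA Lx.
rewrite -innerDl; [|exact: LE..|by []].
by apply: inner_eq_ael (Eproj_linear E c mA Lu Lv) => //;
  [apply: LE; exact: L2_gcomb|apply: L2_gcomb; exact: LE].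
Qed.

Lemma sm_gcomb A c u v : measurable A -> L2 u -> L2 v ->
  (fine (sm E (gcomb c v u) A))%:C =
  c * conjc c * inner (Eproj E A v) v + c * inner (Eproj E A v) u +
  conjc c * inner (Eproj E A u) v + inner (Eproj E A u) u.
Proof.
move=> mA Lu Lv; rewrite -inner_smE//; last exact: L2_gcomb.
rewrite inner_EprojDl//; last exact: L2_gcomb.
rewrite !innerDr//; try exact: Eproj_L2.
ring.
Qed.

Lemma cintegrable_sm u phi (M : R) : L2 u -> cmfR setT phi ->
  (forall x, n1 (phi x) <= M) -> cintegrable (sm E u) setT phi.
Proof.
move=> Lu mp pM; apply: (cintegrable_bounded _ _ (M := M)) => //.
exact: sm_lty.
Qed.

(** On this class all integrals in [sp_form] converge for square integrable vectors, because the
    measures [sm E u] are then finite. *)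
Definition bborel phi := cmfR setT phi /\ exists M : R, forall x, n1 (phi x) <= M.

Lemma bborel_sm u phi : L2 u -> bborel phi -> cintegrable (sm E u) setT phi.
Proof. by move=> Lu [mp [M pM]]; exact: cintegrable_sm pM. Qed.

Lemma bborelD phi psi : bborel phi -> bborel psi -> bborel (fun t => phi t + psi t).
Proof.
move=> [mp [M pM]] [mq [M' qM]]; split; first exact: cmfD.
by exists (M + M') => x; rewrite (le_trans (n1D _ _))// lerD.
Qed.

Lemma bborelM phi psi : bborel phi -> bborel psi -> bborel (fun t => phi t * psi t).
Proof.
move=> [mp [M pM]] [mq [M' qM]]; split; first exact: cmfM.
by exists (M * M') => x; rewrite (le_trans (n1M _ _))// ler_pM ?n1_ge0.
Qed.

Lemma bborel_cst c : bborel (fun=> c).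
Proof. by split; [exact: cmf_cst|exists (n1 c)]. Qed.

Lemma bborelZ c phi : bborel phi -> bborel (fun t => c * phi t).
Proof. by move=> bp; apply: bborelM => //; exact: bborel_cst. Qed.

Lemma bborel_ind A : measurable A -> bborel (ind (A : set (measurableTypeR R))).
Proof. by move=> mA; split; [exact: cmf_ind|exists 1 => x; exact: n1_ind]. Qed.

Lemma bborel_sum (I : Type) (s : seq I) (P : pred I) (F : I -> R -> R[i]) :
  (forall i, bborel (F i)) -> bborel (fun t => \sum_(i <- s | P i) F i t).
Proof.
move=> h; elim: s => [|i s ih].
  rewrite (_ : (fun _ => _) = fun=> 0); first exact: bborel_cst.
  by apply/funext => t; rewrite big_nil.
have [Pi|Pi] := boolP (P i).
  rewrite (_ : (fun _ => _) = fun t => F i t + \sum_(j <- s | P j) F j t).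
    exact: bborelD.
  by apply/funext => t; rewrite big_cons Pi.
rewrite (_ : (fun _ => _) = fun t => \sum_(j <- s | P j) F j t)//.
by apply/funext => t; rewrite big_cons (negbTE Pi).
Qed.

Lemma sp_formE phi u v : sp_form E phi u v =
  4%:R^-1 * \sum_(n < 4) 'i%C ^+ n * cinteg (sm E (gcomb ('i%C ^+ n) v u)) setT phi.
Proof. by []. Qed.

Lemma sp_form_ind A u v : measurable A -> L2 u -> L2 v ->
  sp_form E (ind (A : set (measurableTypeR R))) u v = inner (Eproj E A u) v.
Proof.
move=> mA Lu Lv; rewrite sp_formE -[RHS](polarize4 (inner (Eproj E A u) u) _
  (inner (Eproj E A v) u) (inner (Eproj E A v) v)).
congr (_ * _); apply: eq_bigr => n _; rewrite cinteg_ind// setTI.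
by rewrite sm_gcomb.
Qed.

Lemma sp_formD phi psi u v : L2 u -> L2 v -> bborel phi -> bborel psi ->
  sp_form E (fun t => phi t + psi t) u v = sp_form E phi u v + sp_form E psi u v.
Proof.
move=> Lu Lv bp bq; rewrite !sp_formE -mulrDr -big_split/=; congr (_ * _).
apply: eq_bigr => n _; rewrite -mulrDr cintegD//;
  by apply: bborel_sm => //; exact: L2_gcomb.
Qed.

Lemma sp_formZ c phi u v : L2 u -> L2 v -> bborel phi ->
  sp_form E (fun t => c * phi t) u v = c * sp_form E phi u v.
Proof.
move=> Lu Lv bp; rewrite !sp_formE mulrCA; congr (_ * _).
rewrite mulr_sumr; apply: eq_bigr => n _; rewrite mulrCA cintegZ//.
by apply: bborel_sm => //; exact: L2_gcomb.
Qed.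

Lemma n1_in n : n1 ('i%C ^+ n : R[i]) <= 1.
Proof.
elim: n => [|n ih]; first by rewrite expr0 n1_1.
by rewrite exprS (le_trans (n1M _ _))// /n1 /= normr0 normr1 add0r mul1r.
Qed.

Lemma sqmod_in n : sqmod ('i%C ^+ n : R[i]) = 1.
Proof.
elim: n => [|n ih]; first by rewrite expr0 sqmod1.
by rewrite exprS sqmodM ih /sqmod /= expr0n expr1n add0r mulr1.
Qed.

Lemma n1_quarter : n1 (4%:R^-1 : R[i]) = 4^-1.
Proof.
have -> : (4%:R^-1 : R[i]) = (4^-1)%:C by rewrite rmorphV ?unitfE ?pnatr_eq0//= rmorph_nat.
by rewrite n1_real ger0_norm.
Qed.

(** Each of the four measures has mass at most 2 [sqnorm v] + 2 [sqnorm u], and the factor 1/4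
    averages the four terms. The bound is quadratic; rescaling v recovers a homogeneous one where it
    is needed. *)
Lemma n1_sp_form phi (M : R) u v : L2 u -> L2 v -> cmfR setT phi ->
  (forall x, n1 (phi x) <= M) -> n1 (sp_form E phi u v) <= 2 * M * (sqnorm u + sqnorm v).
Proof.
move=> Lu Lv mp pM; have M0 : 0 <= M by rewrite (le_trans (n1_ge0 _) (pM 0)).
rewrite sp_formE (le_trans (n1M _ _))// n1_quarter mulrC ler_pdivrMr//.
rewrite (le_trans (n1_sum _ _ _))//.
have -> : 2 * M * (sqnorm u + sqnorm v) * 4 =
    \sum_(n < 4) (M * (2 * sqnorm v + 2 * sqnorm u)).
  rewrite big_const_ord /= addr0; ring.
apply: ler_sum => n _; rewrite (le_trans (n1M _ _))//.
have Lg := L2_gcomb ('i%C ^+ n) Lv Lu.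
rewrite -[leRHS]mul1r ler_pM ?n1_ge0// ?n1_in//.
apply: (@le_trans _ _ (\int[sm E (gcomb ('i%C ^+ n) v u)]_(x in setT) M)).
  apply: n1_cinteg_le => //.
  apply: (@measurable_bounded_integrable _ _ _ _ (cst M)) => //.
    exact: sm_lty.
  exact: bounded_cst.
rewrite Rintegral_cst// smT//= ler_wpM2l//.
by rewrite (le_trans (sqnormD_le _ Lv Lu))// sqmod_in mulr1.
Qed.

Lemma sp_form_dct (f : nat -> R -> R[i]) phi (M : R) u v : L2 u -> L2 v ->
  (forall n, cmfR setT (f n)) -> cmfR setT phi ->
  (forall n x, n1 (f n x) <= M) -> (forall x, ccvg (f^~ x) (phi x)) ->
  ccvg (fun n => sp_form E (f n) u v) (sp_form E phi u v).
Proof.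
move=> Lu Lv mf mp fM fp; apply: ccvgZ; apply: ccvg_sum => k; apply: ccvgZ.
apply: (cinteg_dct (mu := sm E _) measurableT (g := cst M)) => //.
apply: (@measurable_bounded_integrable _ _ _ _ (cst M)) => //.
  by apply: sm_lty => //; exact: L2_gcomb.
exact: bounded_cst.
Qed.

Lemma eq_sp_form phi psi u v : phi =1 psi -> sp_form E phi u v = sp_form E psi u v.
Proof. by move=> /funext ->. Qed.

Lemma eq_cinteg_measure (m1 m2 : {measure set (measurableTypeR R) -> \bar R}) A phi :
  (forall B, measurable B -> B `<=` A -> m1 B = m2 B) -> cinteg m1 A phi = cinteg m2 A phi.
Proof.
move=> m12; congr (_ +i* _); congr fine; exact: eq_measure_integral.
Qed.

Lemma cintegrable_measure (m1 m2 : {measure set (measurableTypeR R) -> \bar R}) A phi :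
  measurable A ->
  (forall B, measurable B -> B `<=` A -> m1 B = m2 B) ->
  cintegrable m1 A phi -> cintegrable m2 A phi.
Proof.
move=> mA m12 [] /integrableP[a b] /integrableP[a' b']; split; apply/integrableP; split => //.
- apply: le_lt_trans b; rewrite le_eqVlt; apply/orP; left; apply/eqP.
  by apply: eq_measure_integral => B mB BA; rewrite m12.
- apply: le_lt_trans b'; rewrite le_eqVlt; apply/orP; left; apply/eqP.
  by apply: eq_measure_integral => B mB BA; rewrite m12.
Qed.

Lemma Eproj_set0 u : L2 u -> eq_ae (Eproj E set0 u) (@gzero _ G).
Proof.
move=> Lu; apply: sqnorm_eq0; first exact: Eproj_L2.
by have := smE_sqnorm measurable0 Lu; rewrite measure0 => -[].
Qed.

(** On subsets B of A one has E(B)E(A) = E(B), so inserting E(A) is invisible there; on subsets of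
    the complement E(B)E(A) = 0, and the vector under E(A) drops out. This lemma and its variants
    below record the cases for the two vectors of the polarization. *)
Lemma sm_restr_in A B c u v : measurable A -> measurable B -> B `<=` A ->
  L2 u -> L2 v -> sm E (gcomb c (Eproj E A v) u) B = sm E (gcomb c v u) B.
Proof.
move=> mA mB BA Lu Lv; have LE := Eproj_L2 E mA Lv.
apply: sm_eq => //; [exact: L2_gcomb|exact: L2_gcomb|].
apply: eq_ae_trans (Eproj_linear E c mB LE Lu) _.
apply: eq_ae_trans _ (eq_ae_sym (Eproj_linear E c mB Lv Lu)).
apply: eq_ae_gcomb; last exact: eq_ae_refl.
apply: eq_ae_trans (eq_ae_sym (Eproj_I E mB mA Lv)) _.
by rewrite setIidl//; exact: eq_ae_refl.
Qed.

Lemma sm_restr_inr A B c u v : measurable A -> measurable B -> B `<=` A ->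
  L2 u -> L2 v -> sm E (gcomb c v (Eproj E A u)) B = sm E (gcomb c v u) B.
Proof.
move=> mA mB BA Lu Lv; have LE := Eproj_L2 E mA Lu.
apply: sm_eq => //; [exact: L2_gcomb|exact: L2_gcomb|].
apply: eq_ae_trans (Eproj_linear E c mB Lv LE) _.
apply: eq_ae_trans _ (eq_ae_sym (Eproj_linear E c mB Lv Lu)).
apply: eq_ae_gcomb; first exact: eq_ae_refl.
apply: eq_ae_trans (eq_ae_sym (Eproj_I E mB mA Lu)) _.
by rewrite setIidl//; exact: eq_ae_refl.
Qed.

Lemma Eproj_disj A B u : measurable A -> measurable B -> B `<=` ~` A -> L2 u ->
  eq_ae (Eproj E B (Eproj E A u)) (@gzero _ G).
Proof.
move=> mA mB BA Lu; apply: eq_ae_trans (eq_ae_sym (Eproj_I E mB mA Lu)) _.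
by rewrite (disjoints_subset _ _).2//; exact: Eproj_set0.
Qed.

Lemma sm_restr_out A B c u v : measurable A -> measurable B -> B `<=` ~` A ->
  L2 u -> L2 v -> sm E (gcomb c (Eproj E A v) u) B = sm E u B.
Proof.
move=> mA mB BA Lu Lv; have LE := Eproj_L2 E mA Lv.
apply: sm_eq => //; first exact: L2_gcomb.
apply: eq_ae_trans (Eproj_linear E c mB LE Lu) _.
apply: (@eq_ae_trans _ _ _ (gcomb c (@gzero _ G) (Eproj E B u))).
  by apply: eq_ae_gcomb; [exact: Eproj_disj|exact: eq_ae_refl].
rewrite (_ : gcomb c _ _ = Eproj E B u); first exact: eq_ae_refl.
by apply/funext => k; apply/funext => x; rewrite /gcomb mulr0 add0r.
Qed.

Lemma sm_scale B c v : measurable B -> L2 v ->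
  sm E (gcomb c v (@gzero _ G)) B = (sqmod c * fine (sm E v B))%:E.
Proof.
move=> mB Lv; have L0 := @L2_zero R G; have LE x (Lx : L2 x) := Eproj_L2 E mB Lx.
rewrite !smE_sqnorm//=; last exact: L2_gcomb.
rewrite -sqnormZ; last exact: LE.
congr _%:E; apply: sqnorm_eq_ae; [by apply: LE; exact: L2_gcomb|apply: L2_gcomb => //; exact: LE|].
apply: eq_ae_trans (Eproj_linear E c mB Lv L0) _.
apply: eq_ae_gcomb; first exact: eq_ae_refl.
apply: sqnorm_eq0; first exact: LE.
have h := inner_EprojDl (-1) mB L0 L0 L0.
apply: (@complexI R); rewrite -Eproj_self// inner0r//; exact: LE.
Qed.

(** Outside A only c v remains. As c is unimodular, the mass no longer depends on c, so the four
    terms of the polarization are the same up to the powers of i. *)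
Lemma sm_restr_outr A B c u v : measurable A -> measurable B -> B `<=` ~` A ->
  sqmod c = 1 -> L2 u -> L2 v -> sm E (gcomb c v (Eproj E A u)) B = sm E v B.
Proof.
move=> mA mB BA c1 Lu Lv; have LE := Eproj_L2 E mA Lu; have L0 := @L2_zero R G.
transitivity (sm E (gcomb c v (@gzero _ G)) B); last first.
  by rewrite sm_scale// c1 mul1r fineK// smE.
apply: sm_eq => //; [exact: L2_gcomb|exact: L2_gcomb|].
apply: eq_ae_trans (Eproj_linear E c mB Lv LE) _.
apply: eq_ae_trans _ (eq_ae_sym (Eproj_linear E c mB Lv L0)).
apply: eq_ae_gcomb; first exact: eq_ae_refl.
apply: eq_ae_trans (Eproj_disj mA mB BA Lu) _.
apply/eq_ae_sym/sqnorm_eq0; first exact: Eproj_L2.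
apply: (@complexI R); rewrite -Eproj_self// inner0r//; exact: Eproj_L2.
Qed.

Lemma sum_in_cst (x : R[i]) : \sum_(n < 4) 'i%C ^+ n * x = 0.
Proof.
rewrite -mulr_suml (sum4 (fun n => 'i%C ^+ n)).
rewrite expr0 expr1 sqr_i [_ ^+ 3]exprS sqr_i mulrN1.
by rewrite [X in X * _](_ : _ = 0) ?mul0r//; ring.
Qed.

Lemma Rintegrable_setC (mu : {measure set (measurableTypeR R) -> \bar R}) A (f : R -> R) :
  measurable A -> mu.-integrable A (EFin \o f) -> mu.-integrable (~` A) (EFin \o f) ->
  mu.-integrable setT (EFin \o f).
Proof.
move=> mA /integrableP[a b] /integrableP[a' b'].
have mC := measurableC mA.
have mf : measurable_fun setT (EFin \o f).
  by rewrite -(setUv A); apply/measurable_funU.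
apply/integrableP; split => //.
rewrite -(setUv A) ge0_integral_setU//.
- by rewrite lte_add_pinfty.
- by rewrite setUv; exact: measurableT_comp.
- exact/disj_setPCl.
Qed.

Lemma cintegrable_setC (mu : {measure set (measurableTypeR R) -> \bar R}) A phi :
  measurable A -> cintegrable mu A phi -> cintegrable mu (~` A) phi ->
  cintegrable mu setT phi.
Proof. by move=> mA [a b] [a' b']; split; exact: Rintegrable_setC a _ || exact: Rintegrable_setC b _. Qed.

Lemma cinteg_setC (mu : {measure set (measurableTypeR R) -> \bar R}) A phi :
  measurable A -> cintegrable mu setT phi ->
  cinteg mu setT phi = cinteg mu A phi + cinteg mu (~` A) phi.
Proof.
move=> mA iA; rewrite -(setUv A) cinteg_setU//; first exact: measurableC.
  by rewrite setUv.
exact/disj_setPCl.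
Qed.

(* [phi] need not be bounded outside [A]: the contributions of the complement of [A]
   to the four terms of the polarization cancel. *)
Lemma sp_form_restr A phi u v : measurable A -> L2 u -> L2 v ->
  bborel (fun t => ind (A : set (measurableTypeR R)) t * phi t) ->
  cintegrable (sm E u) setT phi ->
  sp_form E phi u (Eproj E A v) = sp_form E (fun t => ind (A : set (measurableTypeR R)) t * phi t) u v.
Proof.
move=> mA Lu Lv bp ip; have mC := measurableC mA.
have LE := Eproj_L2 E mA Lv.
rewrite !sp_formE; congr (_ * _).
rewrite -[RHS]addr0 -[X in _ = _ + X](sum_in_cst (cinteg (sm E u) (~` A) phi)) -big_split/=.
apply: eq_bigr => n _; rewrite -mulrDr; congr (_ * _).
set c := 'i%C ^+ n.
have Lg := L2_gcomb c Lv Lu.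
have iA : cintegrable (sm E (gcomb c v u)) A phi.
  apply: (@eq_cintegrable _ _ _ _ _ (fun t => ind (A : set (measurableTypeR R)) t * phi t)) => //.
    by move=> t tA; rewrite ind_in// mul1r.
  by apply: (cintegrableS _ _ _ (bborel_sm Lg bp)).
rewrite (@cinteg_setC _ A)//; last first.
  apply: (@cintegrable_setC _ A) => //.
    apply: (@cintegrable_measure (sm E (gcomb c v u))) => //.
    by move=> B mB BA; rewrite sm_restr_in.
  apply: (@cintegrable_measure (sm E u)) => //.
    by move=> B mB BA; rewrite (sm_restr_out c mA)//.
  by apply: (cintegrableS _ _ _ ip).
congr (_ + _); last first.
  by apply: eq_cinteg_measure => B mB BA; rewrite (sm_restr_out c mA).
rewrite -[RHS]cinteg_mkcond.
by apply: eq_cinteg_measure => B mB BA; rewrite sm_restr_in.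
Qed.

(** Mirror image of [sp_form_restr]: off A all four measures coincide with [sm E v], and
    [sum_in_cst] cancels their integrals. Hence [phi] has to be integrable for [sm E v] instead of
    [sm E u]. *)
Lemma sp_form_restl A phi u v : measurable A -> L2 u -> L2 v ->
  bborel (fun t => ind (A : set (measurableTypeR R)) t * phi t) ->
  cintegrable (sm E v) setT phi ->
  sp_form E phi (Eproj E A u) v = sp_form E (fun t => ind (A : set (measurableTypeR R)) t * phi t) u v.
Proof.
move=> mA Lu Lv bp ip; have mC := measurableC mA.
have LE := Eproj_L2 E mA Lu.
rewrite !sp_formE; congr (_ * _).
rewrite -[RHS]addr0 -[X in _ = _ + X](sum_in_cst (cinteg (sm E v) (~` A) phi)) -big_split/=.
apply: eq_bigr => n _; rewrite -mulrDr; congr (_ * _).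
set c := 'i%C ^+ n; have c1 : sqmod c = 1 by exact: sqmod_in.
have Lg := L2_gcomb c Lv Lu.
have iA : cintegrable (sm E (gcomb c v u)) A phi.
  apply: (@eq_cintegrable _ _ _ _ _ (fun t => ind (A : set (measurableTypeR R)) t * phi t)) => //.
    by move=> t tA; rewrite ind_in// mul1r.
  by apply: (cintegrableS _ _ _ (bborel_sm Lg bp)).
rewrite (@cinteg_setC _ A)//; last first.
  apply: (@cintegrable_setC _ A) => //.
    apply: (@cintegrable_measure (sm E (gcomb c v u))) => //.
    by move=> B mB BA; rewrite sm_restr_inr.
  apply: (@cintegrable_measure (sm E v)) => //.
    by move=> B mB BA; rewrite (sm_restr_outr mA).
  by apply: (cintegrableS _ _ _ ip).
congr (_ + _); last first.
  by apply: eq_cinteg_measure => B mB BA; rewrite (sm_restr_outr mA).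
rewrite -[RHS]cinteg_mkcond.
by apply: eq_cinteg_measure => B mB BA; rewrite sm_restr_inr.
Qed.

End Spectral.

(** * Functionals on bounded Borel functions *)

Section HalfIndicator.
Context {R : realType}.
Implicit Types (c d t : R).

(* [hind c d], for [c < d], is the mean of the indicators of ]c,d[ and [c,d]: the
   weight of the end points which comes out of Stone's formula. *)
Definition jump c t : R := ((c < t)%R%:R + (c <= t)%R%:R) / 2.
Definition hind c d t : R := jump c t - jump d t.

Lemma jump_mono c d t : c <= d -> jump d t <= jump c t.
Proof.
move=> cd; rewrite /jump ler_wpM2r// lerD// ler_nat.
- by case: ltP => // /(le_lt_trans cd) ->.
- by case: leP => // /(le_trans cd) ->.
Qed.

Lemma jump_ge0 c t : 0 <= jump c t.
Proof. by rewrite divr_ge0// addr_ge0// ler0n. Qed.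

Lemma jump_le1 c t : jump c t <= 1.
Proof.
have : (c < t)%R%:R <= 1 :> R by rewrite lern1 leq_b1.
have : (c <= t)%R%:R <= 1 :> R by rewrite lern1 leq_b1.
rewrite /jump; lra.
Qed.

Lemma hind_ge0 c d t : c <= d -> 0 <= hind c d t.
Proof. by move=> cd; rewrite subr_ge0 jump_mono. Qed.

Lemma hind_le1 c d t : hind c d t <= 1.
Proof. have := jump_le1 c t; have := jump_ge0 d t; rewrite /hind; lra. Qed.

Lemma jump_out c t : t < c -> jump c t = 0.
Proof. by move=> tc; rewrite /jump leNgt tc ltNge (ltW tc)/= addr0 mul0r. Qed.

Lemma jump_in c t : c < t -> jump c t = 1.
Proof. by move=> ct; rewrite /jump ct (ltW ct) /=; lra. Qed.

Lemma hind_lt c d t : c <= d -> t < c -> hind c d t = 0.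
Proof. by move=> cd tc; rewrite /hind !jump_out ?subrr// (lt_le_trans tc). Qed.

Lemma hind_gt c d t : c <= d -> d < t -> hind c d t = 0.
Proof. by move=> cd tc; rewrite /hind !jump_in ?subrr// (le_lt_trans cd). Qed.

Lemma hind_in c d t : c < t -> t < d -> hind c d t = 1.
Proof. by move=> ct td; rewrite /hind jump_in// jump_out// subr0. Qed.

Lemma measurable_jump c : measurable_fun setT (jump c).
Proof.
apply: measurable_funM => //; apply: measurable_funD.
- rewrite (_ : (fun t => _) = \1_`]c, +oo[).
    by apply: measurable_indic; exact: measurable_itv.
  by apply/funext => t; rewrite indicE mem_setE in_itv/= andbT.
- rewrite (_ : (fun t => _) = \1_`[c, +oo[).
    by apply: measurable_indic; exact: measurable_itv.
  by apply/funext => t; rewrite indicE mem_setE in_itv/= andbT.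
Qed.

Lemma cmf_hind c d : cmfR setT (fun t => (hind c d t)%:C).
Proof. by apply: cmf_real; apply: measurable_funB; exact: measurable_jump. Qed.

Lemma n1_hind c d t : c <= d -> n1 (hind c d t)%:C = hind c d t.
Proof. by move=> cd; rewrite n1_real ger0_norm// hind_ge0. Qed.

Lemma bborel_hind c d : c <= d -> bborel (fun t => (hind c d t)%:C).
Proof.
by move=> cd; split; [exact: cmf_hind|exists 1 => t; rewrite n1_hind// hind_le1].
Qed.

Definition node p q (n j : nat) : R := p + (q - p) * (j%:R / n.+1%:R).

Lemma node_lt p q n j : p < q -> node p q n j < node p q n j.+1.
Proof.
move=> pq; rewrite ltrD2l ltr_pM2l ?subr_gt0// ltr_pM2r ?invr_gt0 ?ltr0n//.
by rewrite ltr_nat.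
Qed.

Lemma node_bnd p q n j : p < q -> (j <= n.+1)%N -> p <= node p q n j <= q.
Proof.
move=> pq jn; rewrite lerDl mulr_ge0 ?subr_ge0 ?(ltW pq)//=.
rewrite -lerBrDl -[leRHS]mulr1 ler_wpM2l ?subr_ge0 ?(ltW pq)//.
by rewrite ler_pdivrMr ?ltr0n// mul1r ler_nat.
Qed.

Lemma node0 p q n : node p q n 0 = p.
Proof. by rewrite /node mul0r mulr0 addr0. Qed.

Lemma nodeS p q n : node p q n n.+1 = q.
Proof. by rewrite /node divff ?pnatr_eq0// mulr1 addrC subrK. Qed.

(** Neighbouring cells give weight 1/2 each to the node that they share, so the sum telescopes in
    [jump] and no node is counted twice. *)
Lemma hind_sum p q n t :
  \sum_(0 <= j < n.+1) hind (node p q n j) (node p q n j.+1) t = hind p q t.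
Proof.
rewrite -[RHS]opprK opprB -[in RHS](nodeS p q n) -[X in _ = - (_ - jump X t)](node0 p q n).
rewrite -(telescope_sumr (fun j => jump (node p q n j) t))// -sumrN.
by apply: eq_bigr => j _; rewrite /hind opprB.
Qed.

(** Continuity along uniformly bounded pointwise limits: the form of dominated convergence for
    finite measures, where a constant is a majorant. *)
Definition dct_continuous (L : (R -> R[i]) -> R[i]) := forall (f : nat -> R -> R[i]) phi (M : R),
  (forall n, cmfR setT (f n)) -> cmfR setT phi ->
  (forall n x, n1 (f n x) <= M) -> (forall x, ccvg (f^~ x) (phi x)) ->
  ccvg (fun n => L (f n)) (L phi).

Definition linear_on_bborel (L : (R -> R[i]) -> R[i]) := forall (c : R[i]) phi psi,
  bborel phi -> bborel psi -> L (fun t => c * phi t + psi t) = c * L phi + L psi.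

Lemma linear_bborel0 L : linear_on_bborel L -> L (fun=> 0) = 0.
Proof.
move=> Ll; have h := Ll (-1) (fun=> 0) (fun=> 0) (bborel_cst 0) (bborel_cst 0).
rewrite -[RHS](addNr (L (fun=> 0))) -mulN1r -h; congr L.
by apply/funext => t; rewrite mulr0 addr0.
Qed.

Lemma linear_bborel_sum L (F : nat -> R -> R[i]) (c : nat -> R[i]) (s : seq nat) :
  linear_on_bborel L -> (forall j, bborel (F j)) ->
  L (fun t => \sum_(j <- s) c j * F j t) = \sum_(j <- s) c j * L (F j).
Proof.
move=> Ll bF; elim: s => [|j s ih].
  rewrite big_nil -[RHS](linear_bborel0 Ll); congr L; apply/funext => t.
  by rewrite big_nil.
rewrite big_cons -ih -Ll//; last by apply: bborel_sum => i; exact: bborelZ.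
by congr L; apply/funext => t; rewrite big_cons.
Qed.

(** The step functions with value phi(node) on the cell that follows the node converge to phi times
    [hind p q], boundedly and pointwise, and [L] vanishes on each of them. The continuity of phi is
    used at one point t at a time. *)
Lemma functional_hind_eq0 L p q phi (M : R) : p < q ->
  linear_on_bborel L -> dct_continuous L ->
  (forall c d, p <= c -> c < d -> d <= q -> L (fun t => (hind c d t)%:C) = 0) ->
  (forall t, p <= t <= q -> n1 (phi t) <= M) ->
  (forall t, p <= t <= q -> forall e : R, 0 < e -> exists2 del, 0 < del &
     forall s, p <= s <= q -> `|s - t| <= del -> n1 (phi s - phi t) <= e) ->
  L (fun t => phi t * (hind p q t)%:C) = 0.
Proof.
move=> pq Ll Lc L0 phiM phic.
pose F n j t := (hind (node p q n j) (node p q n j.+1) t)%:C.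
pose f n t := \sum_(0 <= j < n.+1) phi (node p q n j) * F n j t.
have hle n j : node p q n j <= node p q n j.+1 by exact/ltW/node_lt.
have bF n j : bborel (F n j) by exact: bborel_hind.
have mf n : cmfR setT (f n).
  by apply: cmf_sum => j _; apply: cmfM; [exact: cmf_cst|exact: cmf_hind].
have Lf n : L (f n) = 0.
  rewrite linear_bborel_sum// big_nat big1// => j /andP[_ jn].
  have /andP[a _] := node_bnd pq (ltnW jn : (j <= n.+1)%N).
  have /andP[_ b] := node_bnd pq (jn : (j.+1 <= n.+1)%N).
  by rewrite L0 ?mulr0//; exact: node_lt.
have M0 : 0 <= M by rewrite (le_trans (n1_ge0 _) (phiM p _))// lexx ltW.
have fM n t : n1 (f n t) <= M.
  rewrite (le_trans (n1_sum _ _ _))//.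
  apply: (@le_trans _ _ (\sum_(0 <= j < n.+1) M * hind (node p q n j) (node p q n j.+1) t)).
    rewrite big_nat [leRHS]big_nat; apply: ler_sum => j /andP[_ jn].
    rewrite (le_trans (n1M _ _))// n1_hind// ler_wpM2r ?hind_ge0//.
    by apply: phiM; exact: node_bnd pq (ltnW jn).
  by rewrite -mulr_sumr hind_sum -[leRHS]mulr1 ler_wpM2l// hind_le1.
have fphi t : ccvg (f^~ t) (phi t * (hind p q t)%:C).
  apply/cvgrPdist_le => e e0.
  have [tp|pt] := ltP t p.
    near=> n; rewrite hind_lt ?ltW// mulr0 subr0 sub0r normrN ger0_norm ?n1_ge0//.
    rewrite /f big_nat big1 ?n10 ?ltW// => j /andP[_ jn]; rewrite /F hind_lt ?mulr0//.
    by rewrite (lt_le_trans tp)//; have /andP[] := node_bnd pq (ltnW jn : (j <= n.+1)%N).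
  have [qt|tq] := ltP q t.
    near=> n; rewrite hind_gt ?ltW// mulr0 subr0 sub0r normrN ger0_norm ?n1_ge0//.
    rewrite /f big_nat big1 ?n10 ?ltW// => j /andP[_ jn]; rewrite /F hind_gt ?mulr0//.
    by rewrite (le_lt_trans _ qt)//; have /andP[] := node_bnd pq (jn : (j.+1 <= n.+1)%N).
  have tpq : p <= t <= q by rewrite pt.
  have [del del0 hdel] := phic t tpq e e0.
  near=> n.
  have nd : (q - p) / n.+1%:R <= del.
    rewrite ler_pdivrMr ?ltr0n// mulrC -ler_pdivrMr//.
    rewrite (@le_trans _ _ n%:R)// ?ler_nat//.
    by near: n; exact: nbhs_infty_ger.
  rewrite sub0r normrN ger0_norm ?n1_ge0//.
  have -> : f n t - phi t * (hind p q t)%:C =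
     \sum_(0 <= j < n.+1) (phi (node p q n j) - phi t) * F n j t.
    rewrite -(hind_sum p q n) rmorph_sum/= mulr_sumr -sumrB.
    by apply: eq_bigr => j _; rewrite mulrBl.
  rewrite (le_trans (n1_sum _ _ _))//.
  apply: (@le_trans _ _ (\sum_(0 <= j < n.+1) e * hind (node p q n j) (node p q n j.+1) t)).
    rewrite big_nat [leRHS]big_nat; apply: ler_sum => j /andP[_ jn].
    rewrite (le_trans (n1M _ _))// n1_hind//.
    (* Only a cell whose closure contains t has a nonzero weight, and its node lies within one mesh
       of t. *)
    have [tj|jt] := ltP t (node p q n j); first by rewrite hind_lt// !mulr0.
    have [jt'|tj] := ltP (node p q n j.+1) t; first by rewrite hind_gt// !mulr0.
    rewrite ler_wpM2r ?hind_ge0// hdel//; first exact: node_bnd pq (ltnW jn).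
    rewrite distrC ger0_norm ?subr_ge0// (le_trans _ nd)// lerBlDl (le_trans tj)//.
    by rewrite /node -natr1 le_eqVlt; apply/orP; left; apply/eqP; ring.
  by rewrite -mulr_sumr hind_sum -[leRHS]mulr1 ler_wpM2l ?hind_le1// ltW.
have mphi : cmfR setT (fun t => phi t * (hind p q t)%:C) by apply: cmf_cvg mf _ => t _.
have := Lc f _ M mf mphi fM fphi.
under eq_fun do rewrite Lf.
by move=> /ccvg_unique; apply; exact: ccvg_cst.
Unshelve. all: by end_near. Qed.

End HalfIndicator.

(** * Resolvents as spectral forms *)

Lemma cmfV {R : realType} {d} {T : measurableType d} (D : set T) (f : T -> R[i]) :
  cmf D f -> cmf D (fun x => (f x)^-1).
Proof.
move=> mf.
(* Where f vanishes, both sides are 0, by the convention on the inverse and by [conjc 0 = 0]. The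
   real inverse is written as a power in order to use the measurability of powers. *)
have -> : (fun x => (f x)^-1) = (fun x => conjc (f x) * ((sqmod (f x)) `^ (-1))%:C).
  apply/funext => x; rewrite powR_inv1 ?sqmod_ge0//.
  have [->|z0] := eqVneq (f x) 0; first by rewrite invr0 conjc0 mul0r.
  apply: (mulfI z0); rewrite divff// mulrA mulcJ -rmorphM/= divff ?rmorph1//.
  by rewrite sqmod_eq0.
apply: cmfM; first exact: cmfJ.
apply: cmf_real.
apply: (measurableT_comp (measurable_powR _)); exact: cmf_sqmod.
Qed.

Lemma cmf_id {R : realType} : cmfR setT (fun t : R => t%:C).
Proof. by apply: cmf_real; exact: measurable_id. Qed.

Lemma hindE {R : realType} (c d t : R) : c < d -> (hind c d t)%:C =
  2^-1 * (ind (`]c, d[ : set (measurableTypeR R)) t + ind (`[c, d] : set (measurableTypeR R)) t) :> R[i].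
Proof.
move=> cd; rewrite /ind !indicE !mem_setE !in_itv/= /hind /jump.
have e : (2^-1 : R[i]) = (2^-1)%:C by rewrite realCV realC_nat.
rewrite e -realCD -realCM; congr _%:C.
by case: (ltgtP t c) => h1; case: (ltgtP t d) => h2 /=; lra.
Qed.

Section SpectralForms.
Context {R : realType} (G : metric_graph R) (E : resolution G).
Implicit Types (u v w : gfun G) (A B : set R) (phi psi : R -> R[i]).

Lemma sp_form_linear u v : L2 u -> L2 v -> linear_on_bborel (fun phi => sp_form E phi u v).
Proof.
by move=> Lu Lv c phi psi bp bq; rewrite sp_formD ?sp_formZ//; exact: bborelZ.
Qed.

Lemma sp_form_dctc u v : L2 u -> L2 v -> dct_continuous (fun phi => sp_form E phi u v).
Proof. by move=> Lu Lv f phi M mf mp fM fp; exact: sp_form_dct fp. Qed.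

Lemma sp_formM_linear K u v : bborel K -> L2 u -> L2 v ->
  linear_on_bborel (fun phi => sp_form E (fun t => phi t * K t) u v).
Proof.
move=> bK Lu Lv c phi psi bp bq; rewrite -sp_form_linear//; try exact: bborelM.
by apply: eq_sp_form => t; rewrite mulrDl mulrA.
Qed.

Lemma sp_formM_dctc K u v : bborel K -> L2 u -> L2 v ->
  dct_continuous (fun phi => sp_form E (fun t => phi t * K t) u v).
Proof.
move=> [mK [M' KM]] Lu Lv f phi M mf mp fM fp.
apply: (@sp_form_dct _ _ E (fun n t => f n t * K t) _ (M * M')) => // [n||n x|x].
- exact: cmfM.
- exact: cmfM.
- by rewrite (le_trans (n1M _ _))// ler_pM ?n1_ge0.
- by apply: ccvgM; [exact: fp|exact: ccvg_cst].
Qed.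

Lemma linear_onB (L1 L2 : (R -> R[i]) -> R[i]) : linear_on_bborel L1 ->
  linear_on_bborel L2 -> linear_on_bborel (fun phi => L1 phi - L2 phi).
Proof. by move=> h1 h2 c phi psi bp bq; rewrite h1// h2//; ring. Qed.

Lemma dct_continuousB (L1 L2 : (R -> R[i]) -> R[i]) : dct_continuous L1 ->
  dct_continuous L2 -> dct_continuous (fun phi => L1 phi - L2 phi).
Proof.
move=> h1 h2 f phi M mf mp fM fp.
have a := h1 f phi M mf mp fM fp; have b := h2 f phi M mf mp fM fp.
have := ccvgD a (ccvgZ (-1) b); rewrite mulN1r.
by under eq_fun do rewrite mulN1r.
Qed.

Lemma sp_dom_cintegrable phi u : cmfR setT phi -> sp_dom E phi u ->
  cintegrable (sm E u) setT phi.
Proof.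
move=> mp [Lu fi].
have isq : (sm E u).-integrable setT (EFin \o (fun x => sqmod (phi x))).
  apply/integrableP; split; first by apply/measurable_EFinP; exact: cmf_sqmod.
  apply: le_lt_trans fi; rewrite le_eqVlt; apply/orP; left; apply/eqP.
  by apply: eq_integral => x _ /=; rewrite ger0_norm// sqmod_ge0.
have i1 : (sm E u).-integrable setT (EFin \o cst (1 : R)).
  apply: (@measurable_bounded_integrable _ _ _ _ (cst 1)) => //.
    exact: sm_lty.
  exact: bounded_cst.
apply: (cintegrable_dom (mu := sm E u) _ _ (g := fun x => 1 + 2 * sqmod (phi x))) => //.
  by apply: RintegrableD => //; exact: RintegrableZ.
move=> x _; rewrite (le_trans _ (_ : 1 + n1 (phi x) ^+ 2 <= _))//.
  have := sqr_ge0 (n1 (phi x) - 1); rewrite sqrrB expr1n mulr1 => h.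
  have := n1_ge0 (phi x); rewrite -mulr_natl in h; lra.
by rewrite lerD2l n1_sqmod.
Qed.

(** The spectral measure of E(A)v is carried by A, so a bound for phi on A is enough. This supplies
    vectors in the domain of phi dE, such as the spectral cutoffs of any v. *)
Lemma sp_dom_Eproj A phi (M : R) v : measurable A -> cmfR setT phi -> L2 v ->
  (forall t, A t -> n1 (phi t) <= M) -> sp_dom E phi (Eproj E A v).
Proof.
move=> mA mp Lv pM; have LE := Eproj_L2 E mA Lv; split => //.
have mC := measurableC mA.
pose psi t := ind (A : set (measurableTypeR R)) t * phi t.
have mpsi : cmfR setT psi by apply: cmfM => //; exact: cmf_ind.
(* Replacing phi by its product with the indicator of A changes it only on the complement of A,
   where E(A)v has no mass. *)
have -> : (\int[sm E (Eproj E A v)]_x (sqmod (phi x))%:E =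
           \int[sm E (Eproj E A v)]_x (sqmod (psi x))%:E)%E.
  apply: ae_eq_integral => //.
  - by apply/measurable_EFinP; exact: cmf_sqmod.
  - by apply/measurable_EFinP; exact: cmf_sqmod.
  - exists (~` A); split => //.
      rewrite smE_sqnorm//; congr _%:E.
      rewrite (sqnorm_eq_ae (v := @gzero R G))//; last exact: Eproj_disj.
      + by apply: (@complexI R); rewrite -inner_sqnorm inner0l//; exact: L2_zero.
      + exact: Eproj_L2.
      + exact: L2_zero.
    move=> t /= h tA; apply: h => _; rewrite /psi ind_in ?mul1r//.
    exact: mem_set.
apply: (@le_lt_trans _ _ (\int[sm E (Eproj E A v)]_x (cst (M ^+ 2)%:E x))%E).
  apply: ge0_le_integral => //.
  - by move=> x _; rewrite lee_fin sqmod_ge0.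
  - by apply/measurable_EFinP; exact: cmf_sqmod.
  - move=> x _; rewrite lee_fin /psi.
    have [xA|xA] := boolP (x \in A); last first.
      by rewrite ind_out// mul0r (sqmod_real 0) expr0n sqr_ge0.
    rewrite ind_in// mul1r (le_trans (sqmod_n1 _))// ler_sqr ?nnegrE ?n1_ge0//.
      by apply: pM; exact: set_mem.
    by rewrite (le_trans (n1_ge0 _) (pM x (set_mem xA))).
rewrite integral_cst// lte_mul_pinfty ?lee_fin ?sqr_ge0//.
exact: sm_lty.
Qed.

Hypothesis hE : is_resolution_of E (@Hop R G).

(** The projection is moved to v, and E(A)v lies in the domain of x dE because A is bounded; there
    the hypothesis on E can be tested. *)
Lemma Hop_Eproj A (M : R) u w v : measurable A -> (forall t, A t -> `|t| <= M) ->
  Hop u w -> L2 u -> L2 w -> L2 v ->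
  inner (Eproj E A w) v =
  sp_form E (fun t => ind (A : set (measurableTypeR R)) t * t%:C) u v.
Proof.
move=> mA AM huw Lu Lw Lv.
have [du _ h] := (hE Lu Lw).1 huw.
rewrite Eproj_sym// h; last first.
  by apply: (sp_dom_Eproj (M := M)) => //; [exact: cmf_id|move=> t At; rewrite n1_real AM].
apply: sp_form_restr => //.
- split; first by apply: cmfM; [exact: cmf_ind|exact: cmf_id].
  exists `|M| => t; have [tA|tA] := boolP (t \in A).
    by rewrite ind_in// mul1r n1_real (le_trans (AM _ (set_mem tA)))// ler_norm.
  by rewrite ind_out// mul0r n10.
- by apply: sp_dom_cintegrable => //; exact: cmf_id.
Qed.

Lemma n1V_Im (z : R[i]) : complex.Im z != 0 -> n1 z^-1 <= 2 / `|complex.Im z|.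
Proof.
move=> z0; rewrite (le_trans (n1V _))// ler_wpM2l// lef_pV2 ?posrE ?normr_gt0//.
  exact: n1_Im.
rewrite lt_def n1_ge0 andbT; apply: contraNN z0 => /eqP /n1_eq0 ->//.
Qed.

(** Since f = (zeta - H)u, the measure (E(.)f, v) should be zeta - t times (E(.)u, v). This is known
    on bounded sets, hence (zeta - t)^-1 can be integrated against it over [-N, N], and then N tends
    to infinity. *)
Lemma resolvent_sp_form (zeta : R[i]) u f v : complex.Im zeta != 0 ->
  L2 u -> L2 f -> L2 v -> Hop u (fun k x => zeta * u k x - f k x) ->
  inner u v = sp_form E (fun t => (zeta - t%:C)^-1) f v.
Proof.
move=> z0 Lu Lf Lv; set w := (fun k x => _) => huw.
have fE : f = gcomb (-1) w (gcomb zeta u (@gzero R G)).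
  by apply/funext => k; apply/funext => x; rewrite /gcomb /w /gzero; ring.
have wE : w = gcomb (-1) f (gcomb zeta u (@gzero R G)).
  by apply/funext => k; apply/funext => x; rewrite /gcomb /w /gzero; ring.
have L0 := @L2_zero R G.
have Lw : L2 w by rewrite wE; apply: L2_gcomb => //; exact: L2_gcomb.
(* Here w stands for Hu, so that f = zeta u - w, and [Hop_Eproj] computes the term in w. *)
have keyA A M : measurable A -> (forall t, A t -> `|t| <= M) ->
    sp_form E (ind (A : set (measurableTypeR R))) f v =
    sp_form E (fun t => ind (A : set (measurableTypeR R)) t * (zeta - t%:C)) u v.
  move=> mA AM; rewrite sp_form_ind//.
  have -> : inner (Eproj E A f) v = zeta * inner (Eproj E A u) v - inner (Eproj E A w) v.
    rewrite [in LHS]fE inner_EprojDl//; last exact: L2_gcomb.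
    rewrite inner_EprojDl//.
    have -> : inner (Eproj E A (@gzero R G)) v = 0 by rewrite Eproj_sym// inner0l//; exact: Eproj_L2.
    by rewrite addr0 mulN1r addrC.
  rewrite (Hop_Eproj mA AM huw)// -sp_form_ind//.
  have bi : bborel (ind (A : set (measurableTypeR R))) := bborel_ind mA.
  have bt : bborel (fun t => ind (A : set (measurableTypeR R)) t * t%:C).
    split; first by apply: cmfM; [exact: cmf_ind|exact: cmf_id].
    exists `|M| => t; have [tA|tA] := boolP (t \in A).
      by rewrite ind_in// mul1r n1_real (le_trans (AM _ (set_mem tA)))// ler_norm.
    by rewrite ind_out// mul0r n10.
  rewrite -mulN1r -!sp_formZ// -sp_formD//; [|exact: bborelZ|exact: bborelZ].
  by apply: eq_sp_form => t; ring.
have mphi : cmfR setT (fun t => (zeta - t%:C)^-1).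
  by apply: cmfV; apply: cmfB; [exact: cmf_cst|exact: cmf_id].
have Imz t : complex.Im (zeta - t%:C) = complex.Im zeta by rewrite cImD cImN /= oppr0 addr0.
have zt0 t : zeta - t%:C != 0.
  by apply: contraNN z0 => /eqP e; rewrite -(Imz t) e.
pose M := 2 / `|complex.Im zeta|.
have phiM t : n1 (zeta - t%:C)^-1 <= M by rewrite /M -(Imz t) n1V_Im// Imz.
have M0 : 0 <= M by rewrite divr_ge0.
have keyn n : sp_form E (fun t => (zeta - t%:C)^-1 * (hind (- n.+1%:R) n.+1%:R t)%:C) f v =
    sp_form E (fun t => (hind (- n.+1%:R) n.+1%:R t)%:C) u v.
  set N := n.+1%:R : R.
  have N0 : 0 < N by rewrite ltr0n.
  have NN : - N < N by rewrite (@lt_trans _ _ 0)// oppr_lt0.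
  pose J := (`[(- N), N]%classic : set (measurableTypeR R)).
  have mJ : measurable J by exact: measurable_itv.
  pose K t := ind J t * (zeta - t%:C).
  have bK : bborel K.
    split.
      by apply: cmfM; [exact: cmf_ind|apply: cmfB; [exact: cmf_cst|exact: cmf_id]].
    exists (n1 zeta + N) => t; have [tJ|tJ] := boolP (t \in J).
      rewrite /K ind_in// mul1r (le_trans (n1B _ _))// lerD2l n1_real ler_norml.
      by have := set_mem tJ; rewrite /J /= in_itv.
    by rewrite /K ind_out// mul0r n10 addr_ge0 ?n1_ge0// ltW.
  (* The functional sends phi to the form of phi at (f, v) minus the form of phi K at (u, v). By
     [keyA] it vanishes on each [hind c d] within [-N, N]; at phi = (zeta - t)^-1 the factor K
     cancels. *)
  have : sp_form E (fun t => (zeta - t%:C)^-1 * (hind (- N) N t)%:C) f v -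
      sp_form E (fun t => (zeta - t%:C)^-1 * (hind (- N) N t)%:C * K t) u v = 0.
    apply: (@functional_hind_eq0 R
      (fun phi => sp_form E phi f v - sp_form E (fun t => phi t * K t) u v)
      (- N) N (fun t => (zeta - t%:C)^-1) M NN
      (linear_onB (sp_form_linear Lf Lv) (sp_formM_linear bK Lu Lv))
      (dct_continuousB (sp_form_dctc Lf Lv) (sp_formM_dctc bK Lu Lv))).
  - move=> c d Nc cd dN.
    have ci : (forall t, (`]c, d[%classic : set R) t -> `|t| <= N).
      move=> t /=; rewrite in_itv/= => /andP[h1 h2].
      by rewrite ler_norml (le_trans Nc (ltW h1)) (le_trans (ltW h2) dN).
    have cI : (forall t, (`[c, d]%classic : set R) t -> `|t| <= N).
      move=> t /=; rewrite in_itv/= => /andP[h1 h2].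
      by rewrite ler_norml (le_trans Nc h1) (le_trans h2 dN).
    have mo : measurable (`]c, d[%classic : set (measurableTypeR R)) by exact: measurable_itv.
    have mc : measurable (`[c, d]%classic : set (measurableTypeR R)) by exact: measurable_itv.
    under eq_sp_form do rewrite hindE//.
    under [X in _ - X]eq_sp_form do rewrite hindE//.
    have bo := bborel_ind mo; have bc := bborel_ind mc.
    rewrite sp_formZ ?sp_formD//; last exact: bborelD.
    rewrite (keyA _ _ mo ci) (keyA _ _ mc cI).
    have sub S : S `<=` J -> measurable S ->
        sp_form E (fun t => ind (S : set (measurableTypeR R)) t * (zeta - t%:C)) u v =
        sp_form E (fun t => ind (S : set (measurableTypeR R)) t * K t) u v.
      move=> SJ mS; apply: eq_sp_form => t.
      have [tS|tS] := boolP (t \in S); last by rewrite ind_out// !mul0r.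
      by rewrite /K [ind J t]ind_in ?mul1r//; apply: mem_set; apply: SJ; exact: set_mem.
    rewrite sub//; last by move=> t /ci; rewrite /J /= in_itv/= ler_norml.
    rewrite (sub `[c, d]%classic)//; last by move=> t /cI; rewrite /J /= in_itv/= ler_norml.
    rewrite -sp_formD//; [|exact: bborelM|exact: bborelM].
    rewrite -sp_formZ//; last by apply: bborelD; exact: bborelM.
    apply/eqP; rewrite subr_eq0; apply/eqP; apply: eq_sp_form => t; ring.
  - by move=> t _; exact: phiM.
  (* By the resolvent identity the difference of the two inverses is s - t times a product bounded
     by M * M. *)
  - move=> t _ e e0; exists (e / (M * M + 1)).
      by rewrite divr_gt0// ltr_pwDr// mulr_ge0.
    move=> s _ st.
    have -> : (zeta - s%:C)^-1 - (zeta - t%:C)^-1 =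
        (s - t)%:C * ((zeta - s%:C)^-1 * (zeta - t%:C)^-1).
      by rewrite realCB; field; rewrite zt0 zt0.
    rewrite (le_trans (n1M _ _))// n1_real.
    apply: (@le_trans _ _ (e / (M * M + 1) * (M * M))).
      by rewrite ler_pM ?n1_ge0// (le_trans (n1M _ _))// ler_pM ?n1_ge0.
    rewrite mulrAC ler_pdivrMr ?ltr_pwDr ?mulr_ge0// ler_wpM2l ?lerDl//.
    exact: ltW.
  move=> /eqP; rewrite subr_eq0 => /eqP ->.
  apply: eq_sp_form => t; rewrite /K.
  have [tJ|tJ] := boolP (t \in J).
    by rewrite ind_in// mul1r mulrAC mulVf// mul1r.
  have -> : hind (- N) N t = 0.
    have [tN|Nt] := ltP t (- N); first by rewrite hind_lt// ltW.
    have [tN|tN'] := ltP N t; first by rewrite hind_gt// ltW.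
    by exfalso; move/negP: tJ; apply; apply: mem_set; rewrite /J /= in_itv/= Nt.
  by rewrite rmorph0 mulr0 mul0r.
have cvgh t : ccvg (fun n => (hind (- n.+1%:R) n.+1%:R t)%:C) 1.
  apply/cvgrPdist_le => e e0; near=> n.
  have tn : `|t| < n.+1%:R.
    rewrite (@le_lt_trans _ _ n%:R)// ?ltr_nat//.
    by near: n; exact: nbhs_infty_ger.
  move: tn; rewrite ltr_norml => /andP[h1 h2].
  by rewrite hind_in// subrr n10 subrr normr0 ltW.
have NN n : - n.+1%:R <= n.+1%:R :> R by rewrite (@le_trans _ _ 0)// oppr_le0.
have c1 := @sp_form_dct _ _ E (fun n t => (zeta - t%:C)^-1 * (hind (- n.+1%:R) n.+1%:R t)%:C)
  (fun t => (zeta - t%:C)^-1) (M * 1) f v Lf Lv.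
have c2 := @sp_form_dct _ _ E (fun n t => (hind (- n.+1%:R) n.+1%:R t)%:C)
  (fun t => 1) 1 u v Lu Lv.
have {}c1 : ccvg (fun n => sp_form E (fun t => (zeta - t%:C)^-1 * (hind (- n.+1%:R) n.+1%:R t)%:C) f v)
    (sp_form E (fun t => (zeta - t%:C)^-1) f v).
  apply: c1; [move=> n|exact: mphi|move=> n t|move=> t].
  - by apply: cmfM => //; exact: cmf_hind.
  - rewrite (le_trans (n1M _ _))// ler_pM ?n1_ge0//.
    by rewrite n1_hind// hind_le1.
  - by rewrite -[X in ccvg _ X]mulr1; apply: ccvgZ.
have {}c2 : ccvg (fun n => sp_form E (fun t => (hind (- n.+1%:R) n.+1%:R t)%:C) u v)
    (sp_form E (fun t => 1) u v).
  apply: c2; [move=> n| |move=> n t|exact: cvgh].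
  - exact: cmf_hind.
  - exact: cmf_cst.
  - by rewrite n1_hind// hind_le1.
have e : inner u v = sp_form E (fun=> 1) u v.
  have -> : sp_form E (fun=> 1) u v = sp_form E (ind (setT : set (measurableTypeR R))) u v.
    by apply: eq_sp_form => t; rewrite ind_in// in_setT.
  rewrite sp_form_ind//; apply: inner_eq_ael => //; first exact: Eproj_L2.
  exact/eq_ae_sym/Eproj_T.
rewrite e; apply: (ccvg_unique c2).
by under eq_fun do rewrite -keyn.
Unshelve. all: by end_near. Qed.

Lemma bborel_resolvent (zeta : R[i]) : complex.Im zeta != 0 ->
  bborel (fun t : R => (zeta - t%:C)^-1).
Proof.
move=> z0; split; first by apply: cmfV; apply: cmfB; [exact: cmf_cst|exact: cmf_id].
exists (2 / `|complex.Im zeta|) => t.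
have e : complex.Im zeta = complex.Im (zeta - t%:C) by rewrite cImD cImN /= oppr0 addr0.
by rewrite e n1V_Im// -e.
Qed.

(** All four measures of the polarization are those of v multiplied by a unimodular number, so they
    coincide and cancel. *)
Lemma sp_form0l phi v : L2 v -> bborel phi -> sp_form E phi (@gzero R G) v = 0.
Proof.
move=> Lv bp; rewrite sp_formE -[RHS](mulr0 (4%:R^-1)); congr (_ * _).
rewrite -[RHS](sum_in_cst (cinteg (sm E v) setT phi)); apply: eq_bigr => n _.
congr (_ * _); apply: eq_cinteg_measure => B mB _.
by rewrite sm_scale// sqmod_in mul1r fineK// smE.
Qed.

(** An eigenvector solves the resolvent equation with zero data; the spectral formula tested on u
    itself gives its norm. *)
Lemma no_nonreal_eigenvalue (zeta : R[i]) u : complex.Im zeta != 0 -> L2 u ->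
  Hop u (fun k x => zeta * u k x) -> sqnorm u = 0.
Proof.
move=> z0 Lu huz.
have h : Hop u (fun k x => zeta * u k x - @gzero R G k x).
  rewrite (_ : (fun k x => _) = (fun k x => zeta * u k x))//.
  by apply/funext => k; apply/funext => x; rewrite /gzero subr0.
have := resolvent_sp_form z0 Lu (@L2_zero R G) Lu h.
by rewrite sp_form0l ?inner_sqnorm => [[]||]//; exact: bborel_resolvent.
Qed.

End SpectralForms.

(** * Stone's formula *)

Lemma leb_segment {R : realType} (c d : R) : c < d ->
  leb (`[c, d]%classic : set (measurableTypeR R)) = (d - c)%:E.
Proof.
move=> cd; have e : leb (`[c, d]%classic : set (measurableTypeR R)) = _ := lebesgue_measure_itv `[c, d].
by rewrite e /= lte_fin cd EFinB.
Qed.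

Section PoissonKernel.
Context {R : realType}.
Implicit Types (eps s t c d x : R).

(** The Poisson kernel eps / (pi (s^2 + eps^2)), in the form in which it is the derivative of atan(s
    / eps) / pi. *)
Definition poisson eps s : R := (1 + (s / eps) ^+ 2)^-1 / eps / pi.

Lemma poisson_den s : 1 + s ^+ 2 != 0 :> R.
Proof. by rewrite gt_eqF// ltr_pwDl// sqr_ge0. Qed.

Lemma poisson_ge0 eps s : 0 < eps -> 0 <= poisson eps s.
Proof.
move=> e0; rewrite /poisson !divr_ge0 ?pi_ge0 ?(ltW e0)// invr_ge0.
by rewrite addr_ge0// sqr_ge0.
Qed.

Lemma poisson_le eps s : 0 < eps -> poisson eps s <= eps^-1 / pi.
Proof.
move=> e0; rewrite /poisson ler_wpM2r ?invr_ge0 ?pi_ge0// -[leRHS]mul1r.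
rewrite ler_wpM2r ?invr_ge0 ?(ltW e0)// invf_le1 ?lerDl ?sqr_ge0//.
by rewrite ltr_pwDl// sqr_ge0.
Qed.

Lemma continuous_poisson eps : continuous (poisson eps).
Proof.
move=> s; apply: cvgM; last exact: cvg_cst.
apply: cvgM; last exact: cvg_cst.
apply: cvgV; first exact: poisson_den.
apply: cvgD; first exact: cvg_cst.
by apply: cvgM; apply: cvgM; [exact: cvg_id|exact: cvg_cst|exact: cvg_id|exact: cvg_cst].
Qed.

Lemma is_derive_poisson eps t x : 0 < eps ->
  is_derive x 1 (fun l => atan ((l - t) / eps) / pi) (poisson eps (x - t)).
Proof.
move=> e0.
have h1 : is_derive x (1 : R) (fun l => (l - t) / eps) (eps^-1).
  have -> : (fun l => (l - t) / eps) = (eps^-1 \*: (fun l => l - t)).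
    by apply/funext => l /=; rewrite mulrC.
  by apply: is_derive_eq; rewrite subr0 /GRing.scale /= mulr1.
have h2 := is_derive1_comp (f := @atan R) (g := fun l => (l - t) / eps) (x := x).
have {h2} h3 := h2 _ _ (is_derive1_atan _) h1.
have -> : (fun l => atan ((l - t) / eps) / pi) = (pi^-1 \*: (@atan R \o (fun l => (l - t) / eps))).
  by apply/funext => l /=; rewrite mulrC.
by apply: is_derive_eq; rewrite /GRing.scale /= /poisson; ring.
Qed.

Lemma integral_poisson eps t c d : 0 < eps -> c < d ->
  \int[leb]_(l in `[c, d]) poisson eps (l - t) =
  (atan ((d - t) / eps) - atan ((c - t) / eps)) / pi.
Proof.
move=> e0 cd; rewrite /Rintegral.
have dF x := is_derive_poisson t x e0.
have cF : continuous (fun l => atan ((l - t) / eps) / pi).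
  by move=> x; apply: differentiable_continuous; apply/derivable1_diffP; case: (dF x).
have cP : continuous (fun l => poisson eps (l - t)).
  move=> x; apply: (@continuous_comp _ _ _ (fun l => l - t) (poisson eps)).
    by apply: cvgB; [exact: cvg_id|exact: cvg_cst].
  exact: continuous_poisson.
rewrite (@continuous_FTC2 _ _ (fun l => atan ((l - t) / eps) / pi) c d cd).
- by rewrite -EFinB /= -mulrBl.
- exact: continuous_subspaceT.
- split; first by move=> x _; case: (dF x).
    by apply: cvg_at_right_filter; exact: cF.
  by apply: cvg_at_left_filter; exact: cF.
- by move=> x _; rewrite derive1E; have [_ ->] := dF x.
Qed.

(** At x = t the sequence is constantly 0, which matches the value 1/2 of [jump] there. This is the
    origin of the half weights in [hind]. *)
Lemma atan_cvg_jump x t :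
  atan ((x - t) * n.+1%:R) / pi @[n --> \oo] --> 2^-1 - jump x t.
Proof.
have pos (s : R) : 0 < s -> atan (s * n.+1%:R) / pi @[n --> \oo] --> (2^-1 : R).
  move=> s0; have -> : (2^-1 : R) = pi / 2 / pi.
    by rewrite mulrAC divff ?mul1r// gt_eqF// pi_gt0.
  apply: cvgM; last exact: cvg_cst.
  apply: (@cvg_comp _ _ _ (fun n : nat => s * n.+1%:R) (@atan R) _ (pinfty_nbhs R)).
    apply/cvgryPge => A; near=> n.
    rewrite mulrC -ler_pdivrMr// (@le_trans _ _ n%:R)// ?ler_nat//.
    by near: n; exact: nbhs_infty_ger.
  exact: cvgy_atan.
have [xt|tx|->] := ltgtP x t.
- rewrite jump_in//.
  have := pos (t - x); rewrite subr_gt0 => /(_ xt) h.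
  have -> : 2^-1 - 1 = - 2^-1 :> R by lra.
  under eq_fun do rewrite -opprB mulNr atanN mulNr.
  exact: cvgN.
- by rewrite jump_out// subr0; apply: pos; rewrite subr_gt0.
- rewrite subrr /jump ltxx lexx /= add0r mul1r subrr.
  under eq_fun do rewrite mul0r atan0 mul0r.
  exact: cvg_cst.
Unshelve. all: by end_near. Qed.

Lemma integral_poisson_cvg t c d : c < d ->
  \int[leb]_(l in `[c, d]) poisson n.+1%:R^-1 (l - t) @[n --> \oo] --> hind c d t.
Proof.
move=> cd.
have e n : \int[leb]_(l in `[c, d]) poisson n.+1%:R^-1 (l - t) =
    atan ((d - t) * n.+1%:R) / pi - atan ((c - t) * n.+1%:R) / pi.
  by rewrite integral_poisson ?invr_gt0 ?ltr0n// !invrK mulrBl.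
under eq_fun do rewrite e.
have -> : hind c d t = (2^-1 - jump d t) - (2^-1 - jump c t) by rewrite /hind; ring.
by apply: cvgB; exact: atan_cvg_jump.
Qed.

Lemma integral_poisson_le1 eps t c d : 0 < eps -> c < d ->
  0 <= \int[leb]_(l in `[c, d]) poisson eps (l - t) <= 1.
Proof.
move=> e0 cd; rewrite Rintegral_ge0; last by move=> l _; exact: poisson_ge0.
rewrite integral_poisson// ler_pdivrMr ?pi_gt0// mul1r.
have := ltW (atan_ltpi2 ((d - t) / eps)); have := ltW (atan_gtNpi2 ((c - t) / eps)); lra.
Qed.

End PoissonKernel.

Section Stone.
Context {R : realType} (G : metric_graph R) (E : resolution G).
Implicit Types (u v f g : gfun G).

(** The measure [sm E u] is known to be finite only for square integrable u; indexing the copy by a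
    proof of [L2 u] lets it carry the finite measure structure used by Fubini's theorem. *)
Definition sm_fin u (Lu : L2 u) : set (measurableTypeR R) -> \bar R := sm E u.

Section FiniteMeasure.
Variables (u : gfun G) (Lu : L2 u).

HB.instance Definition _ := Measure.on (sm_fin Lu).

Lemma sm_fin_fin : fin_num_fun (sm_fin Lu).
Proof. by apply: lty_fin_num_fun; exact: sm_lty. Qed.

HB.instance Definition _ := Measure_isFinite.Build _ _ _ (sm_fin Lu) sm_fin_fin.

End FiniteMeasure.

Lemma cinteg_sm_poisson_fubini u eps c d : L2 u -> 0 < eps -> c < d ->
  cmfR setT (fun l => cinteg (sm E u) setT (fun t => (poisson eps (l - t))%:C)) /\
  cint `[c, d] (fun l => cinteg (sm E u) setT (fun t => (poisson eps (l - t))%:C)) =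
  cinteg (sm E u) setT (fun t => (\int[leb]_(l in `[c, d]) poisson eps (l - t))%:C).
Proof.
move=> Lu e0 cd.
have mP : measurable_fun setT (poisson eps) by apply: continuous_measurable_fun; exact: continuous_poisson.
have mk : measurable_fun setT (fun z : measurableTypeR R * measurableTypeR R => poisson eps (z.1 - z.2)).
  by apply: (measurableT_comp mP); apply: measurable_funB.
have mI : measurable (`[c, d]%classic : set (measurableTypeR R)) by exact: measurable_itv.
split.
  split => /=.
  - apply: measurableT_comp => //.
    apply: (measurable_fun_fubini_tonelli_F (m2 := sm_fin Lu)
      (fun z : measurableTypeR R * measurableTypeR R => (poisson eps (z.1 - z.2))%:E)) => //.
    - exact/measurable_EFinP.
    - by move=> z; rewrite lee_fin poisson_ge0.
  - rewrite (_ : (fun x => _) = cst 0); first exact: measurable_cst.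
    by apply/funext => l; rewrite /Rintegral integral0.
rewrite cintE.
have h := @cinteg_fubini_kernel R _ _ (measurableTypeR R) (measurableTypeR R) leb (sm_fin Lu)
  (fun z => (poisson eps (z.1 - z.2))%:C) (fun=> 1) (fun=> 1) `[c, d]%classic setT (eps^-1 / pi + 1) mI measurableT.
transitivity (cinteg leb `[c, d]%classic (fun l => 1 *
   cinteg (sm_fin Lu) setT (fun t => (poisson eps (l - t))%:C * 1))).
  by apply: eq_cinteg => l _; rewrite mul1r; apply: eq_cinteg => t _; rewrite mulr1.
rewrite h//.
- apply: eq_cinteg => t _; rewrite mulr1.
  rewrite (_ : (fun x => _) = (fun l => (poisson eps (l - t))%:C)); last first.
    by apply/funext => l; rewrite mul1r.
  by apply: complex_ext => //=; rewrite /Rintegral integral0.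
- by rewrite [X in (X < _)%E](leb_segment cd) ltry.
- by apply: cmf_real; exact: measurable_funTS.
- have i1 : cintegrable (sm E u) setT (fun=> 1).
    apply: (@cintegrable_sm _ _ E u (fun=> 1) 1 Lu); first exact: cmf_cst.
    by move=> x; rewrite n1_1.
  exact: i1.
- move=> l t _ _ /=; rewrite n1_real ger0_norm ?poisson_ge0//.
  by rewrite (le_trans (poisson_le _ e0))// lerDl.
- move=> l _; rewrite n1_1 lerDr divr_ge0 ?pi_ge0// invr_ge0 ltW//.
Qed.

Lemma cmf_poisson (eps l : R) : cmfR setT (fun t => (poisson eps (l - t))%:C).
Proof.
apply: cmf_real; apply: measurableT_comp.
  by apply: continuous_measurable_fun; exact: continuous_poisson.
by apply: measurable_funB => //; exact: measurable_cst.
Qed.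

(** The forms of the Poisson kernels of width 1/(n + 1), integrated over [c, d], have two limits. By
    Fubini they are forms of the integrated kernels, which tend boundedly to [hind c d]; by
    hypothesis their integrands tend uniformly to rho. The index n0 leaves room for estimates valid
    for small widths only. *)
Lemma stone f g (rho : R -> R[i]) (p q C : R) (n0 : nat) : L2 f -> L2 g ->
  cmfR `[p, q] rho -> (forall l, p <= l <= q -> n1 (rho l) <= C) ->
  (forall n l, (n0 <= n)%N -> p <= l <= q ->
     n1 (sp_form E (fun t => (poisson n.+1%:R^-1 (l - t))%:C) f g - rho l) <= C / n.+1%:R) ->
  forall c d, p <= c -> c < d -> d <= q ->
  sp_form E (fun t => (hind c d t)%:C) f g = cint `[c, d] rho.
Proof.
move=> Lf Lg mrho rhoC close c d pc cd dq.
have mI : measurable (`[c, d]%classic : set (measurableTypeR R)) by exact: measurable_itv.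
have en n : 0 < n.+1%:R^-1 :> R by rewrite invr_gt0.
pose X n := cint `[c, d] (fun l => sp_form E (fun t => (poisson n.+1%:R^-1 (l - t))%:C) f g).
have Lg' k : L2 (gcomb ('i%C ^+ k) g f) by exact: L2_gcomb.
have fI : (leb (`[c, d]%classic : set (measurableTypeR R)) < +oo)%E.
  by rewrite [X in (X < _)%E](leb_segment cd) ltry.
have mS n : cmfR `[c, d] (fun l => sp_form E (fun t => (poisson n.+1%:R^-1 (l - t))%:C) f g).
  apply: (cmfS (E := setT)) => //.
  apply: cmfM; first exact: cmf_cst.
  apply: cmf_sum => k _; apply: cmfM; first exact: cmf_cst.
  by have [] := cinteg_sm_poisson_fubini (Lg' k) (en n) cd.
(* Fubini is applied separately to each of the four positive measures of the polarization. *)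
have X1 n : X n = sp_form E (fun t => (\int[leb]_(l in `[c, d]) poisson n.+1%:R^-1 (l - t))%:C) f g.
  rewrite /X cintE; under [LHS]eq_cinteg do rewrite sp_formE.
  have bd k : cintegrable leb `[c, d]%classic (fun l =>
      cinteg (sm E (gcomb ('i%C ^+ k) g f)) setT (fun t => (poisson n.+1%:R^-1 (l - t))%:C)).
    apply: (@cintegrable_bounded _ _ _ leb _ mI _ (n.+1%:R^-1^-1 / pi * sqnorm (gcomb ('i%C ^+ k) g f))) => //.
      apply: (cmfS (E := setT)) => //.
      by have [] := cinteg_sm_poisson_fubini (Lg' k) (en n) cd.
    move=> l _.
    apply: (@le_trans _ _ (\int[sm E (gcomb ('i%C ^+ k) g f)]_(x in setT) (n.+1%:R^-1^-1 / pi))).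
      apply: n1_cinteg_le => //.
      + exact: cmf_poisson.
      + apply: (@measurable_bounded_integrable _ _ _ _ (cst _)) => //.
          exact: sm_lty.
        exact: bounded_cst.
      + by move=> t _; rewrite n1_real ger0_norm ?poisson_ge0// poisson_le.
    by rewrite Rintegral_cst// smT.
  rewrite cintegZ//; last first.
    by apply: cintegrable_sum => // k _; apply: cintegrableZ.
  rewrite sp_formE; congr (_ * _); rewrite cinteg_sum//; last first.
    by move=> k _; apply: cintegrableZ.
  apply: eq_bigr => k _; rewrite cintegZ//; congr (_ * _).
  by have [_ <-] := cinteg_sm_poisson_fubini (Lg' k) (en n) cd.
have Xh : ccvg X (sp_form E (fun t => (hind c d t)%:C) f g).
  rewrite (_ : X = (fun n => sp_form E (fun t => (\int[leb]_(l in `[c, d]) poisson n.+1%:R^-1 (l - t))%:C) f g)); last exact/funext.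
  have int1 n t : n1 (\int[leb]_(l in `[c, d]) poisson n.+1%:R^-1 (l - t))%:C <= 1 :> R.
    have /andP[a b] := integral_poisson_le1 t (en n) cd.
    by rewrite n1_real ger0_norm.
  apply: (@sp_form_dct _ _ E (fun n t => (\int[leb]_(l in `[c, d]) poisson n.+1%:R^-1 (l - t))%:C) _ 1) => //.
  - move=> n.
    rewrite (_ : (fun t => _) = (fun t => ((atan ((d - t) / n.+1%:R^-1) - atan ((c - t) / n.+1%:R^-1)) / pi)%:C)); last first.
      by apply/funext => t; rewrite integral_poisson.
    apply: cmf_real; apply: measurable_funM; last exact: measurable_cst.
    have ma : measurable_fun setT (@atan R) by apply: continuous_measurable_fun; exact: continuous_atan.
    by apply: measurable_funB; apply: (measurableT_comp ma); apply: measurable_funM => //;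
      apply: measurable_funB => //; exact: measurable_cst.
  - exact: cmf_hind.
  - move=> t; apply/ccvgP; split => /=; last exact: cvg_cst.
    exact: integral_poisson_cvg.
have sub l : (`[c, d]%classic : set R) l -> p <= l <= q.
  by rewrite /= in_itv/= => /andP[a b]; rewrite (le_trans pc a) (le_trans b dq).
have mr : cmfR `[c, d] rho.
  by apply: cmfS mrho; [exact: measurable_itv|move=> l /sub; rewrite /= in_itv].
have ir : cintegrable leb `[c, d]%classic rho.
  by apply: (@cintegrable_bounded _ _ _ leb _ mI _ C) => // l /sub; exact: rhoC.
apply: (ccvg_unique Xh).
(* The uniform error C / (n + 1) integrated over a segment of length d - c. *)
apply: (@ccvg_near_bound _ _ _ (fun n => C * (d - c) * n.+1%:R^-1)).
  near=> n.
  have n0n : (n0 <= n)%N by near: n; exact: nbhs_infty_ge.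
  have iX : cintegrable leb `[c, d]%classic (fun l => sp_form E (fun t => (poisson n.+1%:R^-1 (l - t))%:C) f g).
    apply: (@cintegrable_bounded _ _ _ leb _ mI _ (C / n.+1%:R + C)) => // l /sub lpq.
    rewrite -[X in n1 X](subrK (rho l)) (le_trans (n1D _ _))// lerD ?close//.
    exact: rhoC.
  rewrite /X !cintE -cintegB//.
  apply: (@le_trans _ _ (\int[leb]_(x in `[c, d]) (C / n.+1%:R))).
    apply: n1_cinteg_le => //.
    - exact: cmfB.
    - apply: (@measurable_bounded_integrable _ _ _ _ (cst _)) => //.
      exact: bounded_cst.
    - by move=> l /sub lpq; rewrite close.
  rewrite Rintegral_cst// [X in fine X](leb_segment cd) /= le_eqVlt.
  by apply/orP; left; apply/eqP; ring.
rewrite -[X in _ --> X](mulr0 (C * (d - c))); apply: cvgM; first exact: cvg_cst.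
exact: cvg_harmonic.
Unshelve. all: by end_near. Qed.

End Stone.

(** * Functional calculus on an interval *)

Lemma cvgn_sum {R : realType} (I : finType) (u : I -> nat -> R) (l : I -> R) :
  (forall i, u i n @[n --> \oo] --> l i) ->
  \sum_i u i n @[n --> \oo] --> \sum_i l i.
Proof.
move=> h; elim: (index_enum I) => [|i s ih].
  by rewrite big_nil; under eq_fun do rewrite big_nil; exact: cvg_cst.
by rewrite big_cons; under eq_fun do rewrite big_cons; exact: cvgD.
Qed.

(** * Continuous functions cut off to an open interval *)

Section ContinuousFunctions.
Context {R : realType}.
Implicit Types (h phi : R -> R[i]).

Definition ccontinuous h :=
  continuous (fun t => complex.Re (h t)) /\ continuous (fun t => complex.Im (h t)).

Lemma ccontinuous_cmf h : ccontinuous h -> cmfR setT h.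
Proof. by move=> [a b]; split; exact: continuous_measurable_fun. Qed.

Lemma continuous_bounded_segment (f : R -> R) (p q : R) : continuous f ->
  exists M : R, forall t, p <= t <= q -> `|f t| <= M.
Proof.
move=> cf; have [pq|qp] := leP p q; last first.
  by exists 0 => t /andP[a b]; have := lt_le_trans qp (le_trans a b); rewrite ltxx.
have cn : continuous (fun t => `|f t|).
  by move=> t; apply: cvg_norm; exact: cf.
have [c _ hc] := EVT_max pq (continuous_subspaceT cn).
by exists `|f c| => t tpq; apply: hc; rewrite in_itv.
Qed.

Lemma ccontinuous_bounded h (p q : R) : ccontinuous h ->
  exists M : R, forall t, p <= t <= q -> n1 (h t) <= M.
Proof.
move=> [a b]; have [M hM] := continuous_bounded_segment p q a.
have [M' hM'] := continuous_bounded_segment p q b.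
by exists (M + M') => t tpq; rewrite lerD ?hM ?hM'.
Qed.

Lemma ccontinuousP h : ccontinuous h -> forall t (e : R), 0 < e ->
  exists2 del : R, 0 < del & forall s, `|s - t| <= del -> n1 (h s - h t) <= e.
Proof.
move=> [a b] t e e0.
have e2 : 0 < e / 2 by rewrite divr_gt0.
have /cvgrPdist_le/(_ _ e2) := a t; have /cvgrPdist_le/(_ _ e2) := b t.
move=> /nbhs_ballP[d1 /= d10 h1] /nbhs_ballP[d2 /= d20 h2].
exists (Num.min d1 d2 / 2); first by rewrite divr_gt0// lt_min d10.
move=> s st; have sd : `|s - t| < Num.min d1 d2.
  by rewrite (le_lt_trans st)// ltr_pdivrMr// ltr_pMr ?ltr1n// lt_min d10.
move: sd; rewrite lt_min => /andP[s1 s2].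
rewrite /n1 cReD cReN cImD cImN [leRHS]splitr lerD//.
- by rewrite distrC; apply: h2; rewrite /ball /= distrC.
- by rewrite distrC; apply: h1; rewrite /ball /= distrC.
Qed.

(** The denominator starts at 3, so that a + shrink < b - shrink already for n = 0. *)
Definition shrink (n : nat) (a b : R) : R := (b - a) / n.+3%:R.

Lemma shrink_gt0 n a b : a < b -> 0 < shrink n a b.
Proof. by move=> ab; rewrite divr_gt0 ?subr_gt0. Qed.

Lemma shrink_lt n a b : a < b -> a + shrink n a b < b - shrink n a b.
Proof.
move=> ab.
have h : shrink n a b <= (b - a) / 3%:R.
  rewrite /shrink ler_wpM2l ?subr_ge0 ?(ltW ab)// lef_pV2 ?posrE ?ltr0n// ler_nat//.
have : 0 < b - a by rewrite subr_gt0.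
lra.
Qed.

Lemma hind_shrink_cvg (a b t : R) : a < b ->
  ccvg (fun n => (hind (a + shrink n a b) (b - shrink n a b) t)%:C)
    (ind (`]a, b[%classic : set (measurableTypeR R)) t).
Proof.
move=> ab; rewrite /ind indicE mem_setE in_itv/=.
have sm (e : R) : 0 < e -> \forall n \near \oo, shrink n a b < e.
  move=> e0; near=> n.
  rewrite /shrink ltr_pdivrMr ?ltr0n// mulrC -ltr_pdivrMr// (@le_lt_trans _ _ n%:R)//.
    by near: n; exact: nbhs_infty_ger.
  by rewrite ltr_nat ltnW.
have [ta|at'] := leP t a.
  rewrite /=.
  apply: (ccvg_near_bound (b := fun=> 0)); last exact: cvg_cst.
  near=> n; rewrite hind_lt ?subrr ?n10//; first exact/ltW/shrink_lt.
  by rewrite (le_lt_trans ta)// ltrDl shrink_gt0.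
have [bt|tb] := leP b t.
  rewrite /=.
  apply: (ccvg_near_bound (b := fun=> 0)); last exact: cvg_cst.
  near=> n; rewrite hind_gt ?subrr ?n10//; first exact/ltW/shrink_lt.
  by rewrite (lt_le_trans _ bt)// ltrBlDr ltrDl shrink_gt0.
rewrite /=.
apply: (ccvg_near_bound (b := fun=> 0)); last exact: cvg_cst.
near=> n; rewrite hind_in ?subrr ?n10//.
- by rewrite -ltrBrDl; near: n; apply: sm; rewrite subr_gt0.
- by rewrite ltrBrDr -ltrBrDl; near: n; apply: sm; rewrite subr_gt0.
Unshelve. all: by end_near. Qed.

(** Here [L] is known to vanish only on cells strictly inside ]a, b[, so [functional_hind_eq0] is
    applied on closed subintervals that exhaust it. Their half-weighted indicators tend to the
    indicator of the open interval, without any weight at a and b. *)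
Lemma functional_open_eq0 (L : (R -> R[i]) -> R[i]) a b h : a < b ->
  linear_on_bborel L -> dct_continuous L -> ccontinuous h ->
  (forall c d, a < c -> c < d -> d < b -> L (fun t => (hind c d t)%:C) = 0) ->
  L (fun t => ind (`]a, b[%classic : set (measurableTypeR R)) t * h t) = 0.
Proof.
move=> ab Ll Lc ch L0.
have [M hM] := ccontinuous_bounded a b ch.
have sp n := shrink_gt0 n ab; have sl n := shrink_lt n ab.
have Ln n : L (fun t => h t * (hind (a + shrink n a b) (b - shrink n a b) t)%:C) = 0.
  apply: (functional_hind_eq0 (M := M) (sl n) Ll Lc).
  - move=> c d ac cd db; apply: L0 => //.
      by rewrite (lt_le_trans _ ac)// ltrDl.
    by rewrite (le_lt_trans db)// ltrBlDr ltrDl.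
  - move=> t /andP[h1 h2]; apply: hM.
    by rewrite (le_trans _ h1) ?lerDl ?(ltW (sp n))//= (le_trans h2)// lerBlDr lerDl ltW.
  - move=> t _ e e0; have [del d0 hd] := ccontinuousP ch t e0.
    by exists del => // s _; exact: hd.
have M0 : 0 <= M by rewrite (le_trans (n1_ge0 _) (hM a _))// lexx ltW.
have := Lc (fun n t => h t * (hind (a + shrink n a b) (b - shrink n a b) t)%:C)
  (fun t => ind (`]a, b[%classic : set (measurableTypeR R)) t * h t) M.
move=> H; have {}H : ccvg (fun n => L (fun t => h t * (hind (a + shrink n a b) (b - shrink n a b) t)%:C))
  (L (fun t => ind (`]a, b[%classic : set (measurableTypeR R)) t * h t)).
  apply: H.
  - by move=> n; apply: cmfM; [exact: ccontinuous_cmf|exact: cmf_hind].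
  - by apply: cmfM; [apply: cmf_ind; exact: measurable_itv|exact: ccontinuous_cmf].
  - move=> n t; have sle := ltW (sl n).
    have [h1|h1] := ltP t (a + shrink n a b); first by rewrite hind_lt// mulr0 n10.
    have [h2|h2] := ltP (b - shrink n a b) t; first by rewrite hind_gt// mulr0 n10.
    rewrite (le_trans (n1M _ _))// -[leRHS]mulr1 ler_pM ?n1_ge0//.
      apply: hM.
      by rewrite (le_trans _ h1) ?lerDl ?(ltW (sp n))//= (le_trans h2)// lerBlDr lerDl ltW.
    by rewrite n1_hind// hind_le1.
  - by move=> t; rewrite mulrC; apply: ccvgZ; exact: hind_shrink_cvg.
move: H; under eq_fun do rewrite Ln.
by move=> /ccvg_unique; apply; exact: ccvg_cst.
Qed.

End ContinuousFunctions.

Section FunctionalCalculus.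
Context {R : realType} (G : metric_graph R) (E : resolution G).
Implicit Types (u v f g w : gfun G).

Definition window (a b : R) (h : R -> R[i]) t :=
  ind (`]a, b[%classic : set (measurableTypeR R)) t * h t.

(** For indicators the form is an inner product with E(A)f, where the claim is clear; the defect of
    additivity is a functional to which [functional_open_eq0] applies. *)
Lemma sp_form_gcombr (a b : R) h (c : R[i]) f u v : a < b -> ccontinuous h ->
  L2 f -> L2 u -> L2 v ->
  sp_form E (window a b h) f (gcomb c u v) =
  conjc c * sp_form E (window a b h) f u + sp_form E (window a b h) f v.
Proof.
move=> ab ch Lf Lu Lv.
have Lg := L2_gcomb c Lu Lv.
pose L phi := sp_form E phi f (gcomb c u v) - (conjc c * sp_form E phi f u + sp_form E phi f v).
have Ll : linear_on_bborel L.
  move=> d phi1 phi2 b1 b2; rewrite /L !sp_form_linear//; ring.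
have Lc : dct_continuous L.
  move=> F phi M mF mp FM Fp; rewrite /L.
  have h1 := sp_form_dctc E Lf Lg mF mp FM Fp.
  have h2 := sp_form_dctc E Lf Lu mF mp FM Fp.
  have h3 := sp_form_dctc E Lf Lv mF mp FM Fp.
  have := ccvgD h1 (ccvgZ (-1) (ccvgD (ccvgZ (conjc c) h2) h3)).
  rewrite mulN1r; by under eq_fun do rewrite mulN1r.
apply/eqP; rewrite -subr_eq0; apply/eqP.
apply: (functional_open_eq0 ab Ll Lc ch) => p q _ pq _; rewrite /L.
have mo : measurable (`]p, q[%classic : set (measurableTypeR R)) by exact: measurable_itv.
have mc : measurable (`[p, q]%classic : set (measurableTypeR R)) by exact: measurable_itv.
have bo := bborel_ind mo; have bc := bborel_ind mc.
have e x : L2 x -> sp_form E (fun t => (hind p q t)%:C) f x =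
    2^-1 * (inner (Eproj E `]p, q[%classic f) x + inner (Eproj E `[p, q]%classic f) x).
  move=> Lx; under eq_sp_form do rewrite hindE//.
  by rewrite sp_formZ ?sp_formD ?sp_form_ind//; exact: bborelD.
rewrite !e//.
have hx x : measurable (x : set (measurableTypeR R)) ->
    inner (Eproj E x f) (gcomb c u v) = conjc c * inner (Eproj E x f) u + inner (Eproj E x f) v.
  by move=> mx; rewrite innerDr//; exact: Eproj_L2.
rewrite !hx//; ring.
Qed.

Definition restr_below (n : nat) u : gfun G :=
  fun k x => ind (`]-oo, n%:R]%classic : set (measurableTypeR R)) x * u k x.

Lemma measurable_below n : measurable (`]-oo, n%:R]%classic : set (measurableTypeR R)).
Proof. exact: measurable_itv. Qed.

Lemma cut_compact n u : compact_support (restr_below n u).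
Proof.
exists n%:R => k; apply: aeW => x nx; rewrite /restr_below ind_out ?mul0r//.
by rewrite mem_setE in_itv/= -ltNge.
Qed.

Lemma cut_L2 n u : L2 u -> L2 (restr_below n u).
Proof.
move=> Lu; apply: (@L2_dom _ _ _ (fun k x => sqmod (u k x))) => [k|k|k x _].
- by apply: cmfM; [apply: cmf_ind; exact: measurable_below|exact: L2_cmf].
- exact: integrable_sqmod.
- rewrite /restr_below sqmodM /ind sqmod_real indicE.
  by case: (_ \in _); rewrite ?expr1n ?mul1r// expr0n mul0r sqmod_ge0.
Qed.

Lemma cut_cvg u : L2 u -> sqnorm (gcomb (-1) (restr_below n u) u) @[n --> \oo] --> 0.
Proof.
move=> Lu; rewrite /sqnorm.
rewrite [X in _ --> X](_ : _ = \sum_(k : edge G) 0); last by rewrite big1.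
apply: (@cvgn_sum _ _ (fun k n => \int[leb]_(x in edge_dom k) sqmod (gcomb (-1) (restr_below n u) u k x))) => k.
have e0 : 0 = \int[leb]_(x in edge_dom k) (0 : R) by rewrite /Rintegral integral0.
rewrite [X in _ --> X]e0.
apply: (@Rintegral_cvg_dct _ _ (measurableTypeR R) leb _ (measurable_edge_dom k)
  (fun n x => sqmod (gcomb (-1) (restr_below n u) u k x)) (fun=> 0) (fun x => sqmod (u k x))).
- by move=> n; apply: cmf_sqmod; apply: L2_cmf; apply: L2_gcomb => //; exact: cut_L2.
- exact: measurable_cst.
- exact: integrable_sqmod.
- move=> n x _; rewrite ger0_norm ?sqmod_ge0// /gcomb /restr_below /ind indicE.
  case: (_ \in _); first by rewrite mul1r mulN1r addNr (sqmod_real 0) expr0n sqmod_ge0.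
  by rewrite mul0r mulr0 add0r.
- move=> x _; apply/cvgrPdist_le => e e1; near=> n.
  rewrite /gcomb /restr_below ind_in ?mul1r ?mulN1r ?addNr ?(sqmod_real 0) ?expr0n ?subrr ?normr0 ?ltW//.
  by rewrite mem_setE in_itv/=; near: n; exact: nbhs_infty_ger.
Unshelve. all: by end_near. Qed.

(** * From compactly supported test functions to the functional calculus *)

Section Represent.
Variables (a b : R) (ab : a < b) (h : R -> R[i]) (ch : ccontinuous h).
Variables (f w0 : gfun G) (Lf : L2 f).
Let psi := window a b h.
Hypothesis Lcut : forall n, L2 (restr_below n w0).
Hypothesis rep : forall v, L2 v -> compact_support v ->
  inner w0 v = sp_form E psi f v.

Let mo : measurable (`]a, b[%classic : set (measurableTypeR R)).
Proof. exact: measurable_itv. Qed.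

Lemma psi_bborel : bborel psi.
Proof.
have [M hM] := ccontinuous_bounded a b ch; split.
  by apply: cmfM; [exact: cmf_ind|exact: ccontinuous_cmf].
exists `|M| => t; have [tI|tI] := boolP (t \in (`]a, b[%classic : set (measurableTypeR R))).
  rewrite /psi /window ind_in// mul1r (le_trans (hM t _)) ?ler_norm//.
  by move: tI; rewrite mem_setE in_itv/= => /andP[h1 h2]; rewrite !ltW.
by rewrite /psi /window ind_out// mul0r n10.
Qed.

Lemma represent_cmf k : cmfR (edge_dom k) (w0 k).
Proof.
apply: (@cmf_cvg _ _ _ _ (fun n => restr_below n w0 k)) => [n|x _]; first exact: L2_cmf.
apply: (ccvg_near_bound (b := fun=> 0)); last exact: cvg_cst.
near=> n; rewrite /restr_below ind_in ?mul1r ?subrr ?n10//.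
by rewrite mem_setE in_itv/=; near: n; exact: nbhs_infty_ger.
Unshelve. all: by end_near. Qed.

(** Only truncations of [w0] are known to be square integrable. Testing [rep] with a multiple of
    such a truncation bounds its norm by that of f, uniformly in n. *)
Lemma represent_cut_bound : exists C : R, forall n, sqnorm (restr_below n w0) <= C.
Proof.
have [mp [M0 hM0]] := psi_bborel.
pose M := M0 + 1.
have M00 : 0 <= M0 by rewrite (le_trans (n1_ge0 _) (hM0 0)).
have Mp : 0 < M by rewrite ltr_pwDr.
have hM t : n1 (psi t) <= M by rewrite (le_trans (hM0 t))// lerDl.
exists (16 * M ^+ 2 * sqnorm f) => n; set X := sqnorm _.
(* The test gives t X <= 2 M (sqnorm f + t^2 X). Multiplied by 4 M, with this t, it reads X <= 8 M^2
   sqnorm f + X / 2, so the last term can be absorbed. *)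
pose t := (4 * M)^-1.
have t0 : 0 < t by rewrite invr_gt0 mulr_gt0.
have LX := Lcut n.
have L0 := @L2_zero R G.
pose v := gcomb t%:C (restr_below n w0) (@gzero R G).
have Lv : L2 v by exact: L2_gcomb.
have cv : compact_support v.
  have [N hN] := cut_compact n w0; exists N => k; apply: ae_imp (hN k) => x hx Nx.
  by rewrite /v /gcomb hx// mulr0 addr0.
have e1 : inner w0 v = (t * X)%:C.
  rewrite realCM /X -inner_sqnorm -[t%:C]conjc_real -innerZr// /inner.
  apply: eq_bigr => k _; rewrite !cintE; apply: eq_cinteg => x _.
  rewrite /v /gcomb /restr_below /ind indicE; case: (_ \in _); rewrite ?mul1r//.
  by rewrite !mul0r mulr0 addr0 conjc0 !mulr0.
have := n1_sp_form E Lf Lv mp hM.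
rewrite -rep// e1 n1_real ger0_norm ?mulr_ge0 ?sqnorm_ge0 ?(ltW t0)//.
rewrite sqnormZ// sqmod_real -/X => ineq.
have : 4 * M * (t * X) <= 4 * M * (2 * M * (sqnorm f + t ^+ 2 * X)).
  by rewrite ler_wpM2l// mulr_ge0 ?ltW.
have -> : 4 * M * (t * X) = X by rewrite /t; field; rewrite gt_eqF.
have -> : 4 * M * (2 * M * (sqnorm f + t ^+ 2 * X)) = 8 * M ^+ 2 * sqnorm f + X / 2.
  by rewrite /t; field; rewrite gt_eqF.
lra.
Qed.

(** Monotone convergence carries the uniform bound on the truncations over to [w0]. *)
Lemma represent_L2 : L2 w0.
Proof.
have [C hC] := represent_cut_bound.
move=> k; split; first exact: represent_cmf.
pose F n x := (sqmod (restr_below n w0 k x))%:E.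
have sF n x : (F n x <= F n.+1 x)%E.
  rewrite /F lee_fin /restr_below !sqmodM ler_wpM2r ?sqmod_ge0// /ind !sqmod_real !indicE !mem_setE !in_itv/=.
  case: (leP x n%:R) => xn; last by rewrite expr0n sqr_ge0.
  by rewrite (le_trans xn)// ler_nat.
have := @cvg_monotone_convergence _ _ _ leb (edge_dom k) (measurable_edge_dom k)
  F.
move=> H.
have {}H := H (fun n => (measurable_EFinP _ _).2 (cmf_sqmod (L2_cmf k (Lcut n)))).
have {}H : (\int[leb]_(x in edge_dom k) F n x)%E @[n --> \oo] -->
   (\int[leb]_(x in edge_dom k) (limn (F^~ x)))%E.
  apply: H.
  - by move=> n x _; rewrite lee_fin sqmod_ge0.
  - by move=> x _; apply/nondecreasing_seqP => n; exact: sF.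
have limF x : limn (F^~ x) = (sqmod (w0 k x))%:E.
  apply: cvg_lim => //.
  apply: cvg_near_cst.
  near=> n; rewrite /F /restr_below ind_in ?mul1r//.
  by rewrite mem_setE in_itv/=; near: n; exact: nbhs_infty_ger.
apply: (@le_lt_trans _ _ C%:E); last exact: ltry.
under eq_integral do rewrite -limF.
rewrite -(cvg_lim _ H)//.
apply: lime_le; first by apply/cvg_ex; exists (\int[leb]_(x in edge_dom k) (limn (F^~ x)))%E.
near=> n.
have -> : (\int[leb]_(x in edge_dom k) F n x = (\int[leb]_(x in edge_dom k) sqmod (restr_below n w0 k x))%:E)%E.
  rewrite /Rintegral fineK//; apply: integrable_fin_num => //.
  exact: integrable_sqmod.
rewrite lee_fin (le_trans _ (hC n))// /sqnorm (bigD1 k)//= lerDl.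
by apply: sumr_ge0 => j _; apply: Rintegral_ge0 => x _; exact: sqmod_ge0.
Unshelve. all: by end_near. Qed.

(** Truncations of v are dense and both sides are continuous in v. For the spectral form, continuity
    follows from the quadratic bound [n1_sp_form] at t v, divided by t. *)
Lemma represent_ext v : L2 v -> inner w0 v = sp_form E psi f v.
Proof.
move=> Lv; have Lw := represent_L2.
have Lc n := cut_L2 n Lv.
have [mp [M0 hM0]] := psi_bborel.
have M00 : 0 <= M0 by rewrite (le_trans (n1_ge0 _) (hM0 0)).
pose M := 2 * M0 + 1.
have Mp : 0 < M by rewrite ltr_pwDr// mulr_ge0.
have L0 := @L2_zero R G.
have bound x (t : R) : 0 < t -> L2 x ->
    n1 (sp_form E psi f x) <= t^-1 * (M * (sqnorm f + t ^+ 2 * sqnorm x)).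
  move=> t0 Lx.
  have Lt : L2 (gcomb t%:C x (@gzero R G)) by exact: L2_gcomb.
  have := n1_sp_form E Lf Lt mp hM0.
  rewrite (@sp_form_gcombr a b h)// (_ : sp_form E _ f (@gzero R G) = 0); last first.
    have := @sp_form_gcombr a b h (-1) f _ _ ab ch Lf L0 L0.
    rewrite (_ : gcomb (-1) (@gzero R G) (@gzero R G) = (@gzero R G)); last first.
      by apply/funext => k; apply/funext => y; rewrite /gcomb /gzero mulr0 addr0.
    by rewrite conjcN conjc1 mulN1r addNr.
  rewrite addr0 conjc_real sqnormZ// sqmod_real.
  set s := sp_form _ _ _ _ => hs.
  have e : n1 s = t^-1 * n1 (t%:C * s).
    by rewrite n1Zreal ?ltW// mulKf// gt_eqF.
  rewrite e ler_wpM2l ?invr_ge0 ?(ltW t0)// (le_trans hs)// ler_wpM2r ?lerDl//.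
  by rewrite addr_ge0 ?sqnorm_ge0// mulr_ge0 ?sqr_ge0 ?sqnorm_ge0.
have c1 : ccvg (fun n => inner w0 (restr_below n v)) (inner w0 v).
  by apply: inner_cvgr => //; exact: cut_cvg.
have c2 : ccvg (fun n => sp_form E psi f (restr_below n v)) (sp_form E psi f v).
  apply/cvgrPdist_le => e e0.
  have sf1 : 0 < sqnorm f + 1 by rewrite ltr_pwDr// sqnorm_ge0.
  (* With this t the part M sqnorm f / t of [bound] is at most e / 2 for all n; the other part tends
     to 0 with the norm of the tail of v. *)
  have [t t0 tE] : exists2 t : R, 0 < t & t = 2 * M * (sqnorm f + 1) / e.
    by exists (2 * M * (sqnorm f + 1) / e) => //; rewrite divr_gt0// !mulr_gt0.
  have : 0 < e / (2 * t * M) by rewrite divr_gt0// !mulr_gt0.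
  move=> et; have /cvgrPdist_le/(_ _ et) := cut_cvg Lv; apply: filterS => n.
  rewrite !sub0r !normrN !ger0_norm ?n1_ge0 ?sqnorm_ge0// => hn.
  have -> : sp_form E psi f (restr_below n v) - sp_form E psi f v =
     - sp_form E psi f (gcomb (-1) (restr_below n v) v).
    by rewrite (@sp_form_gcombr a b h)// conjcN conjc1; ring.
  rewrite n1N (le_trans (bound _ t t0 (L2_gcomb _ (Lc n) Lv)))//.
  have h1 : t^-1 * (M * sqnorm f) <= e / 2.
    rewrite mulrC ler_pdivrMr//.
    have -> : e / 2 * t = M * (sqnorm f + 1) by rewrite tE; field; rewrite gt_eqF.
    by rewrite ler_wpM2l ?(ltW Mp)// lerDl.
  have h2 : t * M * sqnorm (gcomb (-1) (restr_below n v) v) <= e / 2.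
    have -> : e / 2 = t * M * (e / (2 * t * M)).
      by field; rewrite !gt_eqF.
    by rewrite ler_wpM2l// mulr_ge0// ltW.
  have -> : t^-1 * (M * (sqnorm f + t ^+ 2 * sqnorm (gcomb (-1) (restr_below n v) v))) =
     t^-1 * (M * sqnorm f) + t * M * sqnorm (gcomb (-1) (restr_below n v) v).
    by field; rewrite gt_eqF.
  by rewrite [leRHS]splitr lerD.
apply: (ccvg_unique c1).
rewrite (_ : (fun n => _) = (fun n => sp_form E psi f (restr_below n v)))//.
by apply/funext => n; rewrite rep//; exact: cut_compact.
Qed.

(** [sp_form_restl] trades the indicator in [window] for the projection E(]a,b[) on f, which turns
    the representation of [w0] into membership in the graph of h dE. *)
Lemma represent_sp_graph : sp_graph E h (Eproj E `]a, b[ f) w0.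
Proof.
have [M hM] := ccontinuous_bounded a b ch.
split; [|exact: represent_L2|].
- apply: (@sp_dom_Eproj _ _ E _ _ M) => //; first exact: ccontinuous_cmf.
  by move=> t /=; rewrite in_itv/= => /andP[h1 h2]; apply: hM; rewrite !ltW.
- move=> v dv; rewrite represent_ext ?sp_form_restl//; try by case: dv.
    exact: psi_bborel.
  by apply: sp_dom_cintegrable => //; exact: ccontinuous_cmf.
Qed.

(** [fcalc] chooses an element of the graph over E(]a,b[)f, and [w0] shows that there is one. Two
    elements have the same inner product with E([-n,n])g, which lies in the domain of h dE because h
    is bounded on [-n,n]; letting n grow compares them on g. *)
Lemma fcalc_inner g : L2 g -> inner (fcalc E h (Eproj E `]a, b[ f)) g = inner w0 g.
Proof.
move=> Lg; set w := fcalc _ _ _.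
have [_ Lw hw] : sp_graph E h (Eproj E `]a, b[ f) w.
  by apply: (@xgetPex _ _ [set w | sp_graph E h (Eproj E `]a, b[ f) w]); exists w0; exact: represent_sp_graph.
have [_ Lw0 hw0] := represent_sp_graph.
pose J n := (`[(- n%:R), n%:R]%classic : set (measurableTypeR R)).
have mJ n : measurable (J n) by exact: measurable_itv.
have dom n : sp_dom E h (Eproj E (J n) g).
  have [M hM] := ccontinuous_bounded (- n%:R) n%:R ch.
  apply: (@sp_dom_Eproj _ _ E _ _ M _ (mJ n) (ccontinuous_cmf ch) Lg) => t.
  by rewrite /J /= in_itv/=; exact: hM.
have key n : inner (Eproj E (J n) w) g = inner (Eproj E (J n) w0) g.
  by rewrite !(Eproj_sym E (mJ n))// hw// hw0.
have lim x : L2 x -> ccvg (fun n => inner (Eproj E (J n) x) g) (inner x g).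
  move=> Lx.
  have -> : inner x g = sp_form E (ind (setT : set (measurableTypeR R))) x g.
    rewrite sp_form_ind//; apply: inner_eq_ael => //; first exact: Eproj_L2.
    exact/eq_ae_sym/Eproj_T.
  rewrite (_ : (fun n => _) = (fun n => sp_form E (ind (J n)) x g)); last first.
    by apply/funext => n; rewrite (sp_form_ind E (mJ n)).
  apply: (@sp_form_dct _ _ E _ _ 1) => //.
  - by move=> n; exact: cmf_ind.
  - exact: cmf_ind.
  - by move=> n t; exact: n1_ind.
  - move=> t; rewrite [X in ccvg _ X](_ : _ = 1); last by rewrite ind_in ?in_setT.
    apply: (ccvg_near_bound (b := fun=> 0)); last exact: cvg_cst.
    near=> n; rewrite ind_in ?subrr ?n10// mem_setE in_itv/= -ler_norml.
    by near: n; exact: nbhs_infty_ger.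
apply: (ccvg_unique (lim w Lw)).
by under eq_fun do rewrite key; exact: lim.
Unshelve. all: by end_near. Qed.

End Represent.

End FunctionalCalculus.

(** * Exponential waves *)

Section ComplexExponential.
Context {R : realType}.
Implicit Types (z w alpha beta : R[i]) (x y s p q : R).

Lemma Re_cexp w : complex.Re (cexp w) = expR (complex.Re w) * cos (complex.Im w).
Proof. by rewrite /cexp cReM /= mul0r subr0. Qed.

Lemma Im_cexp w : complex.Im (cexp w) = expR (complex.Re w) * sin (complex.Im w).
Proof. by rewrite /cexp cImM /= mul0r addr0. Qed.

Local Opaque cexp.

Lemma cexp0 : cexp 0 = 1 :> R[i].
Proof. by apply: complex_ext; rewrite ?Re_cexp ?Im_cexp /= expR0 mul1r ?cos0 ?sin0. Qed.

Lemma cexpD z w : cexp (z + w) = cexp z * cexp w.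
Proof.
apply: complex_ext.
  rewrite (cReM (cexp z)) !Re_cexp !Im_cexp cReD cImD expRD cosD; ring.
rewrite (cImM (cexp z)) !Re_cexp !Im_cexp cReD cImD expRD sinD; ring.
Qed.

Lemma cexpN_mul z : cexp (- z) * cexp z = 1.
Proof. by rewrite -cexpD addNr cexp0. Qed.

Lemma sqmod_cexp z : sqmod (cexp z) = expR (2 * complex.Re z).
Proof.
rewrite /sqmod Re_cexp Im_cexp !exprMn -mulrDr cos2Dsin2 mulr1.
by rewrite mulr2n mulrDl mul1r expRD expr2.
Qed.

Lemma n1_cexp z : n1 (cexp z) <= 2 * expR (complex.Re z).
Proof.
have e0 := expR_ge0 (complex.Re z).
rewrite /n1 Re_cexp Im_cexp !normrM (ger0_norm e0) -mulrDr mulrC ler_wpM2r//.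
have hc : `|cos (complex.Im z)| <= 1 by rewrite ler_norml cos_geN1 cos_le1.
have hs : `|sin (complex.Im z)| <= 1 by rewrite ler_norml sin_geN1 sin_le1.
lra.
Qed.

Lemma Re_affine alpha beta s :
  complex.Re (alpha * s%:C + beta) = complex.Re alpha * s + complex.Re beta.
Proof. by rewrite cReD cReM /= mulr0 subr0. Qed.

Lemma Im_affine alpha beta s :
  complex.Im (alpha * s%:C + beta) = complex.Im alpha * s + complex.Im beta.
Proof. by rewrite cImD cImM /= mulr0 add0r. Qed.

Lemma is_derive_affine (a b x : R) : is_derive x 1 (fun s => a * s + b) a.
Proof.
have -> : (fun s => a * s + b) = (a \*: id + cst b) by [].
by apply: is_derive_eq; rewrite addr0 /GRing.scale /= mulr1.
Qed.

Lemma is_derive_Re_cexp alpha beta x :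
  is_derive x 1 (fun s => complex.Re (cexp (alpha * s%:C + beta)))
    (complex.Re (alpha * cexp (alpha * x%:C + beta))).
Proof.
have h1 := is_derive1_comp (f := @expR R) (g := fun s => complex.Re alpha * s + complex.Re beta)
  (x := x) (is_derive_expR _) (is_derive_affine (complex.Re alpha) (complex.Re beta) x).
have h2 := is_derive1_comp (f := @cos R) (g := fun s => complex.Im alpha * s + complex.Im beta)
  (x := x) (is_derive_cos _) (is_derive_affine (complex.Im alpha) (complex.Im beta) x).
have -> : (fun s => complex.Re (cexp (alpha * s%:C + beta))) =
   (expR \o (fun s => complex.Re alpha * s + complex.Re beta)) *
   (@cos R \o (fun s => complex.Im alpha * s + complex.Im beta)).
  by apply/funext => s; rewrite Re_cexp Re_affine Im_affine.
apply: is_derive_eq.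
rewrite cReM Re_cexp Im_cexp Re_affine Im_affine /GRing.scale /=; ring.
Qed.

Lemma is_derive_Im_cexp alpha beta x :
  is_derive x 1 (fun s => complex.Im (cexp (alpha * s%:C + beta)))
    (complex.Im (alpha * cexp (alpha * x%:C + beta))).
Proof.
have h1 := is_derive1_comp (f := @expR R) (g := fun s => complex.Re alpha * s + complex.Re beta)
  (x := x) (is_derive_expR _) (is_derive_affine (complex.Re alpha) (complex.Re beta) x).
have h2 := is_derive1_comp (f := @sin R) (g := fun s => complex.Im alpha * s + complex.Im beta)
  (x := x) (is_derive_sin _) (is_derive_affine (complex.Im alpha) (complex.Im beta) x).
have -> : (fun s => complex.Im (cexp (alpha * s%:C + beta))) =
   (expR \o (fun s => complex.Re alpha * s + complex.Re beta)) *
   (@sin R \o (fun s => complex.Im alpha * s + complex.Im beta)).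
  by apply/funext => s; rewrite Im_cexp Re_affine Im_affine.
apply: is_derive_eq.
rewrite cImM Re_cexp Im_cexp Re_affine Im_affine /GRing.scale /=; ring.
Qed.

Lemma ccontinuous_cexp alpha beta : ccontinuous (fun s => cexp (alpha * s%:C + beta)).
Proof.
by split => x; apply: differentiable_continuous; apply/derivable1_diffP;
  [case: (is_derive_Re_cexp alpha beta x)|case: (is_derive_Im_cexp alpha beta x)].
Qed.

Lemma ccontinuousZ (c : R[i]) (f : R -> R[i]) : ccontinuous f -> ccontinuous (fun s => c * f s).
Proof.
move=> [a b]; split => x.
- rewrite (_ : (fun s => _) = (fun s => complex.Re c * complex.Re (f s) - complex.Im c * complex.Im (f s))).
    by apply: cvgB; apply: cvgM; [exact: cvg_cst|exact: a|exact: cvg_cst|exact: b].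
  by apply/funext => s; rewrite cReM.
- rewrite (_ : (fun s => _) = (fun s => complex.Re c * complex.Im (f s) + complex.Im c * complex.Re (f s))).
    by apply: cvgD; apply: cvgM; [exact: cvg_cst|exact: b|exact: cvg_cst|exact: a].
  by apply/funext => s; rewrite cImM.
Qed.

Lemma Rintegral_FTC2 (F f : R -> R) p q : p <= q -> continuous f ->
  (forall x, is_derive x 1 F (f x)) -> \int[leb]_(x in `[p, q]) f x = F q - F p.
Proof.
rewrite le_eqVlt => /predU1P[->|pq] cf dF.
  by rewrite set_itv1 Rintegral_set1 subrr.
have cF : continuous F.
  by move=> x; apply: differentiable_continuous; apply/derivable1_diffP; case: (dF x).
rewrite /Rintegral (@continuous_FTC2 _ _ F p q pq)//.
- exact: continuous_subspaceT.
- split; first by move=> x _; case: (dF x).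
    by apply: cvg_at_right_filter; exact: cF.
  by apply: cvg_at_left_filter; exact: cF.
- by move=> x _; rewrite derive1E; have [_ ->] := dF x.
Qed.

Lemma cint_cexp alpha beta p q : p <= q ->
  cint `[p, q] (fun s => alpha * cexp (alpha * s%:C + beta)) =
  cexp (alpha * q%:C + beta) - cexp (alpha * p%:C + beta).
Proof.
move=> pq; have [c1 c2] := ccontinuousZ alpha (ccontinuous_cexp alpha beta).
apply: complex_ext; rewrite ?cReD ?cImD ?cReN ?cImN /=.
- exact: (Rintegral_FTC2 pq c1 (is_derive_Re_cexp alpha beta)).
- exact: (Rintegral_FTC2 pq c2 (is_derive_Im_cexp alpha beta)).
Qed.

Definition wave z (r : R) : R[i] := cexp ('i%C * z * r%:C).

Lemma wave0 z : wave z 0 = 1.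
Proof. by rewrite /wave mulr0 cexp0. Qed.

Lemma Re_iz z (r : R) : complex.Re ('i%C * z * r%:C) = - complex.Im z * r.
Proof. rewrite !cReM !cImM /=; ring. Qed.

Lemma n1_wave z r : 0 <= complex.Im z -> 0 <= r -> n1 (wave z r) <= 2.
Proof.
move=> z0 r0; rewrite (le_trans (n1_cexp _))// Re_iz -[leRHS]mulr1 ler_wpM2l//.
by rewrite -expR0 ler_expR mulNr oppr_le0 mulr_ge0.
Qed.

Lemma cint_wave_incr z y p q : p <= q ->
  cint `[p, q] (fun s => 'i%C * z * wave z (s - y)) = wave z (q - y) - wave z (p - y).
Proof.
move=> pq; have e s : wave z (s - y) = cexp (('i%C * z) * s%:C + - ('i%C * z * y%:C)).
  by rewrite /wave; congr cexp; rewrite realCB; ring.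
by rewrite !e -cint_cexp// !cintE; apply: eq_cinteg => s _; rewrite e.
Qed.

Lemma cint_wave_decr z y p q : p <= q ->
  cint `[p, q] (fun s => - ('i%C * z) * wave z (y - s)) = wave z (y - q) - wave z (y - p).
Proof.
move=> pq; have e s : wave z (y - s) = cexp (- ('i%C * z) * s%:C + 'i%C * z * y%:C).
  by rewrite /wave; congr cexp; rewrite realCB; ring.
by rewrite !e -cint_cexp// !cintE; apply: eq_cinteg => s _; rewrite e.
Qed.

(** The value 1 at 0 agrees with the closed interval in the jump term of [cint_wave_sgn]. *)
Definition sgn (s : R) : R[i] := if 0 <= s then 1 else - 1.

Lemma n1_sgn s : n1 (sgn s) = 1.
Proof. by rewrite /sgn; case: ifP; rewrite ?n1N n1_1. Qed.

Lemma measurable_segment p q : measurable (`[p, q]%classic : set (measurableTypeR R)).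
Proof. exact: measurable_itv. Qed.

Lemma leb_segment_lty p q : (leb (`[p, q]%classic : set (measurableTypeR R)) < +oo)%E.
Proof.
have e : leb (`[p, q]%classic : set (measurableTypeR R)) = _ := lebesgue_measure_itv `[p, q].
by rewrite e /=; case: ifP => _; rewrite -?EFinB ltry.
Qed.

Lemma cintegrable_segment (f : R -> R[i]) (M : R) p q : cmfR `[p, q] f ->
  (forall x, p <= x <= q -> n1 (f x) <= M) -> cintegrable leb `[p, q] f.
Proof.
move=> mf fM; apply: (@cintegrable_bounded _ _ _ leb _ (measurable_segment p q) _ M) => //.
  exact: leb_segment_lty.
Qed.

Lemma cint_split (f : R -> R[i]) p y q : p <= y <= q -> cintegrable leb `[p, q] f ->
  cint `[p, q] f = cint `[p, y] f + cint `[y, q] f.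
Proof.
move=> /andP[py yq] [a b].
have h (k : R -> R) : leb.-integrable `[p, q] (EFin \o k) ->
    \int[leb]_(x in `[p, q]) k x = \int[leb]_(x in `[p, y]) k x + \int[leb]_(x in `[y, q]) k x.
  move=> ik.
  have := @Rintegral_itvB R k (BLeft p) (BRight q) y ik.
  rewrite !bnd_simp => /(_ py yq) h.
  rewrite -[X in _ + X]Rintegral_itv_obnd_cbnd; last first.
    apply: integrableS ik => //.
    by apply: subset_itvr; rewrite bnd_simp.
  by apply/eqP; rewrite addrC -subr_eq; apply/eqP; exact: h.
by apply: complex_ext; rewrite ?cReD ?cImD /=; exact: h.
Qed.

Lemma cmf_wave_abs z y : cmfR setT (fun s => wave z `|s - y|).
Proof.
apply: cmf_cexp; apply: cmfM; first exact: cmf_cst.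
apply: cmf_real; apply: measurableT_comp => //.
by apply: measurable_funB => //; exact: measurable_cst.
Qed.

Lemma cmf_sgn y : cmfR setT (fun s => sgn (s - y)).
Proof.
rewrite (_ : (fun s => _) = (fun s => 2 * ind (`[y, +oo[%classic : set (measurableTypeR R)) s - 1)).
  apply: cmfB; last exact: cmf_cst.
  by apply: cmfM; [exact: cmf_cst|apply: cmf_ind; exact: measurable_itv].
apply/funext => s; rewrite /sgn subr_ge0 /ind indicE mem_setE in_itv/= andbT.
by case: (y <= s); rewrite /=; apply: complex_ext; rewrite /=; lra.
Qed.

(** The integrand is the derivative in s of the wave at |s - y|, which is continuous across s = y;
    the integral is split there. *)
Lemma cint_sgn_wave z x y : 0 <= complex.Im z -> 0 <= x ->
  cint `[0, x] (fun s => 'i%C * z * (sgn (s - y) * wave z `|s - y|)) =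
  wave z `|x - y| - wave z `|0 - y|.
Proof.
move=> z0 x0.
have incr p q : y <= p -> p <= q ->
    cint `[p, q] (fun s => 'i%C * z * (sgn (s - y) * wave z `|s - y|)) =
    wave z `|q - y| - wave z `|p - y|.
  move=> yp pq; rewrite !ger0_norm ?subr_ge0 ?(le_trans yp)// -cint_wave_incr// !cintE.
  apply: eq_cinteg => s; rewrite mem_setE in_itv/= => /andP[ps _].
  have ys := le_trans yp ps.
  by rewrite /sgn subr_ge0 ys mul1r ger0_norm ?subr_ge0.
have decr p q : q <= y -> p <= q ->
    cint `[p, q] (fun s => 'i%C * z * (sgn (s - y) * wave z `|s - y|)) =
    wave z `|q - y| - wave z `|p - y|.
  move=> qy pq; have py := le_trans pq qy.
  rewrite ![`|_ - y|]distrC !ger0_norm ?subr_ge0// -cint_wave_decr// !cintE.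
  (* At s = y the factor [sgn] is 1 instead of -1, so the two integrands agree only off this
     point. *)
  apply: ae_eq_cinteg; first exact: measurable_segment.
  - apply: (cmfS (E := setT)) => //; apply: cmfM; first exact: cmf_cst.
    by apply: cmfM; [exact: cmf_sgn|exact: cmf_wave_abs].
  - apply: (cmfS (E := setT)) => //; apply: cmfM; first exact: cmf_cst.
    apply: cmf_cexp; apply: cmfM; first exact: cmf_cst.
    by apply: cmf_real; apply: measurable_funB => //; exact: measurable_cst.
  - exists [set y]; split; [exact: measurable_set1|exact: lebesgue_measure_set1|].
    move=> s /= /not_implyP[]; rewrite in_itv/= => /andP[_ sq] ns.
    apply: contrapT => sy; apply: ns.
    have {}sy : s < y by rewrite lt_neqAle (le_trans sq qy) andbT; apply/eqP.
    rewrite /sgn subr_ge0 leNgt sy /= distrC ger0_norm ?subr_ge0 ?(ltW sy)//; ring.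
have [yx|xy] := leP y x; last by rewrite decr// ltW.
have [y0|y0] := leP y 0; first by rewrite incr.
have y01 : 0 <= y <= x by rewrite ltW.
rewrite (cint_split y01); last first.
  apply: (cintegrable_segment (M := n1 ('i%C * z) * 2)).
    apply: (cmfS (E := setT)) => //; apply: cmfM; first exact: cmf_cst.
    by apply: cmfM; [exact: cmf_sgn|exact: cmf_wave_abs].
  move=> s _; rewrite (le_trans (n1M _ _))// ler_wpM2l ?n1_ge0// (le_trans (n1M _ _))//.
  by rewrite n1_sgn mul1r n1_wave.
rewrite decr// ?ltW// incr//; ring.
Qed.

(** Away from y the integrand is the derivative of the signed wave, which jumps by 2 at y. The jump
    is the last term; it will produce the source in the differential equation. As 0 < y, it is
    crossed exactly when y <= x. *)
Lemma cint_wave_sgn z x y : 0 <= complex.Im z -> 0 <= x -> 0 < y ->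
  cint `[0, x] (fun s => 'i%C * z * wave z `|s - y|) =
  sgn (x - y) * wave z `|x - y| - sgn (0 - y) * wave z `|0 - y| -
  2 * ind (`[0, x]%classic : set (measurableTypeR R)) y.
Proof.
move=> z0 x0 y0.
have decr q : 0 <= q -> q <= y ->
    cint `[0, q] (fun s => 'i%C * z * wave z `|s - y|) = wave z y - wave z (y - q).
  move=> q0 qy; rewrite -opprB -[X in - (_ - wave z X)](subr0 y) -cint_wave_decr// !cintE -cintegN//; last first.
    - apply: (cintegrable_segment (M := n1 (- ('i%C * z)) * 2)).
        apply: (cmfS (E := setT)) => //; apply: cmfM; first exact: cmf_cst.
        apply: cmf_cexp; apply: cmfM; first exact: cmf_cst.
        by apply: cmf_real; apply: measurable_funB => //; exact: measurable_cst.
      move=> s /andP[_ sq]; rewrite (le_trans (n1M _ _))// ler_wpM2l ?n1_ge0//.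
      by rewrite n1_wave// subr_ge0 (le_trans sq).
  apply: eq_cinteg => s; rewrite mem_setE in_itv/= => /andP[_ sq].
  by rewrite distrC ger0_norm ?subr_ge0 ?(le_trans sq)// mulNr opprK.
have s0 : sgn (0 - y) = - 1 by rewrite /sgn subr_ge0 leNgt y0.
have w0y : wave z `|0 - y| = wave z y by rewrite sub0r normrN gtr0_norm.
have [yx|xy] := leP y x; last first.
  rewrite decr ?(ltW xy)// s0 w0y /sgn subr_ge0 leNgt xy /= ind_out; last first.
    by rewrite mem_setE in_itv/= negb_and -!ltNge xy orbT.
  by rewrite distrC gtr0_norm ?subr_gt0//; ring.
have y01 : 0 <= y <= x by rewrite ltW.
rewrite (cint_split y01); last first.
  apply: (cintegrable_segment (M := n1 ('i%C * z) * 2)).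
    by apply: (cmfS (E := setT)) => //; apply: cmfM; [exact: cmf_cst|exact: cmf_wave_abs].
  by move=> s _; rewrite (le_trans (n1M _ _))// ler_wpM2l ?n1_ge0// n1_wave.
rewrite decr ?(ltW y0)// subrr wave0 s0 w0y /sgn subr_ge0 yx ind_in; last first.
  by rewrite mem_setE in_itv/= y01.
have -> : cint `[y, x] (fun s => 'i%C * z * wave z `|s - y|) = wave z (x - y) - 1.
  rewrite -[X in _ - X](wave0 z) -[X in _ - wave z X](subrr y) -cint_wave_incr// !cintE.
  apply: eq_cinteg => s; rewrite mem_setE in_itv/= => /andP[ys _].
  by rewrite ger0_norm ?subr_ge0.
rewrite ger0_norm ?subr_ge0//; ring.
Qed.

End ComplexExponential.

(** * The explicit solution of the resolvent equation *)

Section ParticularSolution.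
Context {R : realType}.
Variables (z : R[i]) (z0 : z != 0) (Imz : 0 <= complex.Im z).
Variables (a : R -> R[i]) (ia : cintegrable leb setT a).

(** Convolution of the data with e^{iz|x|} / (2iz), the fundamental solution of u'' + z^2 u. In
    [dpart_sol] the factor iz of the derivative reduces the constant to 1/2. *)
Definition part_sol (x : R) : R[i] :=
  (2%:R * 'i%C * z)^-1 * cinteg leb setT (fun y => wave z `|x - y| * a y).
Definition dpart_sol (x : R) : R[i] :=
  2^-1 * cinteg leb setT (fun y => sgn (x - y) * wave z `|x - y| * a y).

Lemma cmf_prod_wave : cmf (T := (measurableTypeR R * measurableTypeR R)%type) setT
  (fun w => wave z `|w.1 - w.2|).
Proof.
apply: cmf_cexp; apply: cmfM; first exact: cmf_cst.
by apply: cmf_real; apply: measurableT_comp => //; apply: measurable_funB.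
Qed.

Lemma cmf_prod_sgn : cmf (T := (measurableTypeR R * measurableTypeR R)%type) setT
  (fun w => sgn (w.1 - w.2)).
Proof.
have m : measurable_fun setT (fun w : measurableTypeR R * measurableTypeR R => 0 <= (w.1 - w.2 : R)).
  by apply: measurable_fun_ler => //; apply: measurable_funB.
split.
- rewrite (_ : (fun w => _) = (fun w : measurableTypeR R * measurableTypeR R =>
      if 0 <= (w.1 - w.2 : R) then (1 : R) else -1)).
    by apply: measurable_fun_ifT.
  by apply/funext => w; rewrite /sgn; case: ifP.
- rewrite (_ : (fun w => _) = (fun w : measurableTypeR R * measurableTypeR R => (0 : R))).
    exact: measurable_cst.
  by apply/funext => w; rewrite /sgn; case: ifP => //= _; rewrite oppr0.
Qed.

Lemma cmf_wave_sec (x : R) : cmfR setT (fun y => wave z `|x - y|).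
Proof. by have := cmf_wave_abs z x; apply: eq_cmf => y _; rewrite distrC. Qed.

Lemma cmf_sgn_sec (x : R) : cmfR setT (fun y => sgn (x - y)).
Proof.
have [p q] := cmf_prod_sgn.
split.
- exact: (measurableT_comp p (pair1_measurable x)).
- exact: (measurableT_comp q (pair1_measurable x)).
Qed.

Lemma cintegrable_wave x : cintegrable leb setT (fun y => wave z `|x - y| * a y).
Proof.
by apply: (cintegrableMl _ (cmf_wave_sec x) (M := 2)) => // y _; exact: n1_wave.
Qed.

Lemma cintegrable_sgn_wave x :
  cintegrable leb setT (fun y => sgn (x - y) * wave z `|x - y| * a y).
Proof.
apply: (cintegrableMl _ (cmfM (cmf_sgn_sec x) (cmf_wave_sec x)) (M := 2)) => // y _.
by rewrite (le_trans (n1M _ _))// n1_sgn mul1r n1_wave.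
Qed.

Let mI x := @measurable_segment R 0 x.

(** The equality is [cint_sgn_wave] under the integral in y, by Fubini; its first conclusion is the
    measurability that comes with Fubini. *)
Lemma part_sol_FTC x : 0 <= x -> cmfR `[0, x] dpart_sol /\
  part_sol x = part_sol 0 + cint `[0, x] dpart_sol.
Proof.
move=> x0.
have h := @cinteg_kernel R _ _ (measurableTypeR R) (measurableTypeR R) leb leb
  (fun w => sgn (w.1 - w.2) * wave z `|w.1 - w.2|) (fun=> 2^-1) a `[0, x]%classic setT 2
  (mI x) measurableT (leb_segment_lty 0 x).
have {h} [h1 h2] : cmfR `[0, x] dpart_sol /\
   cint `[0, x] dpart_sol = cinteg leb setT (fun y => cinteg leb `[0, x]%classic
     (fun s => 2^-1 * (sgn (s - y) * wave z `|s - y|)) * a y).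
  apply: h => //.
  - by apply: (cmfS (E := setT)) => //; apply: cmfM; [exact: cmf_prod_sgn|exact: cmf_prod_wave].
  - by move=> s y _ _ /=; rewrite (le_trans (n1M _ _))// n1_sgn mul1r n1_wave.
  - move=> s _; have -> : (2^-1 : R[i]) = (2^-1)%:C by rewrite realCV realC_nat.
    by rewrite n1_real ger0_norm//; lra.
split=> //; rewrite h2 /part_sol.
set c0 := (2%:R * 'i%C * z)^-1.
rewrite -[LHS](subrK (c0 * cinteg leb setT (fun y => wave z `|0 - y| * a y))) addrC; congr (_ + _).
rewrite -mulrBr -cintegB//; [|exact: cintegrable_wave|exact: cintegrable_wave].
rewrite -cintegZ//; last by apply: cintegrableB => //; exact: cintegrable_wave.
apply: eq_cinteg => y _.
rewrite -mulrBl -cint_sgn_wave// cintE mulrA; congr (_ * _).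
rewrite -cintegZ//; last first.
  apply: (cintegrable_segment (M := n1 ('i%C * z) * 2)).
    apply: (cmfS (E := setT)) => //; apply: cmfM; first exact: cmf_cst.
    by apply: cmfM; [exact: cmf_sgn|exact: cmf_wave_abs].
  move=> s _; rewrite (le_trans (n1M _ _))// ler_wpM2l ?n1_ge0// (le_trans (n1M _ _))//.
  by rewrite n1_sgn mul1r n1_wave.
apply: eq_cinteg => s _; rewrite mulrA; congr (_ * _).
have i0 : 'i%C != 0 :> R[i] by rewrite eq_complex /= eqxx oner_eq0.
by rewrite /c0; field; rewrite z0 i0.
Qed.

(** By Fubini and [cint_wave_sgn]: half of the jump 2 gives the source a, and the smooth part gives
    (iz)^2 = -z^2 times [part_sol]. The formula for the wave requires 0 < y, hence the hypothesis on
    a. *)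
Lemma dpart_sol_FTC x : (forall y, y <= 0 -> a y = 0) -> 0 <= x ->
  cmfR `[0, x] part_sol /\
  dpart_sol x = dpart_sol 0 + cint `[0, x] (fun s => a s - z ^+ 2 * part_sol s).
Proof.
move=> a0 x0; set c0 := (2%:R * 'i%C * z)^-1.
have h := @cinteg_kernel R _ _ (measurableTypeR R) (measurableTypeR R) leb leb
  (fun w => wave z `|w.1 - w.2|) (fun=> c0) a `[0, x]%classic setT (2 + n1 c0)
  (mI x) measurableT (leb_segment_lty 0 x).
have {h} [h1 h2] : cmfR `[0, x] part_sol /\
   cint `[0, x] part_sol = cinteg leb setT (fun y => cinteg leb `[0, x]%classic
     (fun s => c0 * wave z `|s - y|) * a y).
  apply: h => //.
  - by apply: (cmfS (E := setT)) => //; exact: cmf_prod_wave.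
  - by move=> s y _ _ /=; rewrite (le_trans (n1_wave _ _))// lerDl n1_ge0.
  - by move=> s _; rewrite lerDr.
split=> //.
have i0 : 'i%C != 0 :> R[i] by rewrite eq_complex /= eqxx oner_eq0.
have iP : cintegrable leb `[0, x] part_sol.
  apply: (cintegrable_segment (M := n1 c0 * \int[leb]_(y in setT) (2 * n1 (a y)))) => //.
  move=> s _; rewrite (le_trans (n1M _ _))// ler_wpM2l ?n1_ge0// n1_cinteg_le//.
  - by have [] := (cintegrableP leb measurableT _).1 (cintegrable_wave s).
  - by apply: RintegrableZ => //; exact: integrable_n1.
  - by move=> y _; rewrite (le_trans (n1M _ _))// ler_wpM2r ?n1_ge0// n1_wave.
have iaI : cintegrable leb `[0, x] a by apply: cintegrableS ia.
rewrite cintE cintegB//; last exact: cintegrableZ.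
rewrite cintegZ// -[cinteg leb _ part_sol]/(cint `[0, x]%classic part_sol) h2.
have -> : cinteg leb `[0, x]%classic a = cinteg leb setT (fun y => ind (`[0, x]%classic : set (measurableTypeR R)) y * a y).
  exact: cinteg_mkcond.
rewrite /dpart_sol.
rewrite -[LHS](subrK (2^-1 * cinteg leb setT (fun y => sgn (0 - y) * wave z `|0 - y| * a y))) addrC.
congr (_ + _).
have i1 : cintegrable leb setT (fun y => ind (`[0, x]%classic : set (measurableTypeR R)) y * a y).
  exact: cintegrable_mkcond.
have wE y : 0 < y -> cinteg leb `[0, x]%classic (fun s => c0 * wave z `|s - y|) =
  c0 / ('i%C * z) * (sgn (x - y) * wave z `|x - y| - sgn (0 - y) * wave z `|0 - y| -
  2 * ind (`[0, x]%classic : set (measurableTypeR R)) y).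
  move=> y0; rewrite -cint_wave_sgn// cintE -cintegZ//; last first.
    apply: (cintegrable_segment (M := n1 ('i%C * z) * 2)).
      by apply: (cmfS (E := setT)) => //; apply: cmfM; [exact: cmf_cst|exact: cmf_wave_abs].
    by move=> s _; rewrite (le_trans (n1M _ _))// ler_wpM2l ?n1_ge0// n1_wave.
  by apply: eq_cinteg => s _; field; rewrite z0 i0.
have i2 : cintegrable leb setT (fun y => cinteg leb `[0, x]%classic (fun s => c0 * wave z `|s - y|) * a y).
  apply: (@eq_cintegrable R _ (measurableTypeR R) leb _ (fun y => c0 / ('i%C * z) * ((sgn (x - y) * wave z `|x - y| * a y -
    sgn (0 - y) * wave z `|0 - y| * a y) - 2 * (ind (`[0, x]%classic : set (measurableTypeR R)) y * a y)))) => //.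
    move=> y _; have [y0|y0] := ltP 0 y; last by rewrite a0// !mulr0 !subr0 mulr0.
    by rewrite wE//; ring.
  apply: cintegrableZ => //; apply: cintegrableB => //; last exact: cintegrableZ.
  by apply: cintegrableB => //; exact: cintegrable_sgn_wave.
have j1 := cintegrable_sgn_wave x; have j2 := cintegrable_sgn_wave 0.
have i3 := cintegrableB measurableT j1 j2.
have i4 := cintegrableZ measurableT (z ^+ 2) i2.
rewrite -mulrBr -(cintegB measurableT j1 j2) -(cintegZ measurableT 2^-1 i3).
rewrite -(cintegZ measurableT (z ^+ 2) i2) -(cintegB measurableT i1 i4).
apply: eq_cinteg => y _; have [y0|y0] := ltP 0 y; last by rewrite a0// !mulr0 !subrr mulr0.
rewrite wE// /c0; set w1 := wave _ _; set w2 := wave _ _; set s1 := sgn _; set s2 := sgn _.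
set d := ind _ _.
have ii : 'i%C * 'i%C = -1 :> R[i] by exact: sqr_ci.
have -> : (2%:R * 'i%C * z)^-1 / ('i%C * z) = - (2 * z ^+ 2)^-1.
  rewrite -invfM; have -> : 2%:R * 'i%C * z * ('i%C * z) = ('i%C * 'i%C) * (2 * z ^+ 2) :> R[i] by ring.
  by rewrite ii mulN1r invrN.
by field.
Qed.

End ParticularSolution.

(** * Square integrable functions on intervals *)

Section SquareIntegrable.
Context {R : realType}.
Implicit Types (D : set (measurableTypeR R)) (u v : R -> R[i]).

Lemma sqintP D u : square_integrable D u <->
  cmfR D u /\ leb.-integrable D (EFin \o (fun x => sqmod (u x))).
Proof.
split=> [[[a b] c]|[[a b] /integrableP[_ c]]]; split => //.
- apply/integrableP; split; first exact/measurable_EFinP/cmf_sqmod.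
  apply: le_lt_trans c; rewrite le_eqVlt; apply/orP; left; apply/eqP.
  by apply: eq_integral => x _ /=; rewrite ger0_norm// sqmod_ge0.
- apply: le_lt_trans c; rewrite le_eqVlt; apply/orP; left; apply/eqP.
  by apply: eq_integral => x _ /=; rewrite ger0_norm// sqmod_ge0.
Qed.

Lemma sqint_dom D u (g : R -> R) : measurable D -> cmfR D u ->
  leb.-integrable D (EFin \o g) -> (forall x, D x -> sqmod (u x) <= g x) ->
  square_integrable D u.
Proof.
move=> mD mu ig ug; apply/sqintP; split => //.
apply: (le_Rintegrable _ _ ig) => //; first exact: cmf_sqmod.
by move=> x Dx; rewrite ger0_norm ?sqmod_ge0// ug.
Qed.

Lemma sqint_comb D c u v : measurable D -> square_integrable D u ->
  square_integrable D v -> square_integrable D (fun x => c * u x + v x).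
Proof.
move=> mD /sqintP[mu iu] /sqintP[mv iv].
apply: (@sqint_dom _ _ (fun x => 2 * sqmod c * sqmod (u x) + 2 * sqmod (v x))) => //.
- by apply: cmfD => //; apply: cmfM => //; exact: cmf_cst.
- by apply: RintegrableD => //; exact: RintegrableZ.
- by move=> x _; rewrite (le_trans (sqmodD_le _ _))// sqmodM mulrA.
Qed.

Lemma sqint_bounded D u (M : R) : measurable D -> (leb D < +oo)%E -> cmfR D u ->
  (forall x, D x -> n1 (u x) <= M) -> square_integrable D u.
Proof.
move=> mD fD mu uM; apply: (@sqint_dom _ _ (cst (M ^+ 2))) => //.
  by apply: (@measurable_bounded_integrable _ _ _ leb (cst (M ^+ 2))) => //; exact: bounded_cst.
move=> x Dx; rewrite (le_trans (sqmod_n1 _))// ler_sqr ?nnegrE ?n1_ge0 ?uM//.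
by rewrite (le_trans (n1_ge0 _) (uM x Dx)).
Qed.

Lemma sqint_cintegrable D u : measurable D -> (leb D < +oo)%E ->
  square_integrable D u -> cintegrable leb D u.
Proof.
move=> mD fD /sqintP[mu iu].
apply: (cintegrable_dom (mu := leb) _ _ (g := fun x => 1 + 2 * sqmod (u x))) => //.
  apply: RintegrableD => //; last exact: RintegrableZ.
  by apply: (@measurable_bounded_integrable _ _ _ leb (cst 1)) => //; exact: bounded_cst.
move=> x _; rewrite (le_trans _ (_ : 1 + n1 (u x) ^+ 2 <= _))//.
  have := sqr_ge0 (n1 (u x) - 1); rewrite sqrrB expr1n mulr1 => h.
  have := n1_ge0 (u x); rewrite -mulr_natl in h; lra.
by rewrite lerD2l n1_sqmod.
Qed.

Lemma sqintS (D E : set (measurableTypeR R)) u : measurable D -> measurable E ->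
  D `<=` E -> square_integrable E u -> square_integrable D u.
Proof.
move=> mD mE DE /sqintP[mu iu]; apply/sqintP; split; first exact: cmfS mu.
exact: integrableS iu.
Qed.

Lemma leb_oo_lty (p q : R) : (leb (`]p, q[%classic : set (measurableTypeR R)) < +oo)%E.
Proof.
have e : leb (`]p, q[%classic : set (measurableTypeR R)) = _ := lebesgue_measure_itv `]p, q[.
by rewrite e /=; case: ifP => _; rewrite -?EFinB ltry.
Qed.

Lemma integrable_oo_cc (p q : R) (f : R -> R) :
  leb.-integrable (`]p, q[%classic : set (measurableTypeR R)) (EFin \o f) ->
  leb.-integrable (`[p, q]%classic : set (measurableTypeR R)) (EFin \o f).
Proof.
move=> /integrableP[mf fi].
have mf1 : measurable_fun (`]p, q[%classic : set R) f by apply/measurable_EFinP.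
have mf2 : measurable_fun (`[p, q]%classic : set R) f by exact: (@measurable_fun_itv_cc _ p q false true f mf1).
apply/integrableP; split; first exact/measurable_EFinP.
apply: le_lt_trans fi; rewrite le_eqVlt; apply/orP; left; apply/eqP.
have mn : measurable_fun (`[p, q]%classic : set R) (fun x => `|f x|).
  exact: measurableT_comp.
transitivity (\int[leb]_(x in (`[p, q[%classic : set (measurableTypeR R))) `|(EFin \o f) x|)%E.
  apply/esym/integral_itv_bndo_bndc.
  apply/measurable_EFinP; apply: measurable_funS mn => // x /=; rewrite !in_itv/=.
  by move=> /andP[-> /ltW ->].
apply/esym/integral_itv_obnd_cbnd.
apply/measurable_EFinP; apply: measurable_funS mn => // x /=; rewrite !in_itv/=.
by move=> /andP[a b]; rewrite !ltW.
Qed.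

Lemma cintegrable_oo_cc (p q : R) u : cintegrable leb `]p, q[ u -> cintegrable leb `[p, q] u.
Proof. by move=> [a b]; split; exact: integrable_oo_cc. Qed.

End SquareIntegrable.

(** * Sobolev functions on an edge *)

Section H2.
Context {R : realType} (G : metric_graph R).
Implicit Types (k : edge G) (u v : R -> R[i]).

Lemma edge_cl_ge0 k x : edge_cl k x -> 0 <= x.
Proof. by case: k => k /=; rewrite in_itv/= => /andP[]. Qed.

Lemma edge_sqint_cintegrable k u x : edge_cl k x -> square_integrable (edge_dom k) u ->
  cintegrable leb `[0, x] u.
Proof.
move=> kx su; apply: cintegrable_oo_cc; apply: sqint_cintegrable => //.
  exact: leb_oo_lty.
apply: (sqintS (E := edge_dom k)) => //.
case: k kx {su} => k /=; rewrite in_itv/= => /andP[x0 xl] y /=; rewrite !in_itv/= => /andP[-> yx] //=.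
exact: lt_le_trans yx xl.
Qed.

Lemma H2_comb k c u du ddu v dv ddv : H2_on k u du ddu -> H2_on k v dv ddv ->
  H2_on k (fun x => c * u x + v x) (fun x => c * du x + dv x) (fun x => c * ddu x + ddv x).
Proof.
move=> [s1 s2 s3 e1 e2] [t1 t2 t3 f1 f2]; split; try exact: sqint_comb.
- move=> x kx; rewrite e1// f1// !cintE cintegD//; last first.
  + exact: edge_sqint_cintegrable kx t2.
  + by apply: cintegrableZ => //; exact: edge_sqint_cintegrable kx s2.
  rewrite cintegZ//; last exact: edge_sqint_cintegrable kx s2.
  ring.
- move=> x kx; rewrite e2// f2// !cintE cintegD//; last first.
  + exact: edge_sqint_cintegrable kx t3.
  + by apply: cintegrableZ => //; exact: edge_sqint_cintegrable kx s3.
  rewrite cintegZ//; last exact: edge_sqint_cintegrable kx s3.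
  ring.
Qed.

Lemma sqint0 k : square_integrable (edge_dom k) (fun=> 0).
Proof.
apply: (@sqint_dom _ _ _ (cst 0)) => //.
  exact: integrable0.
by move=> x _; rewrite (sqmod_real 0) expr0n.
Qed.

Lemma H2_zero k : H2_on k (fun=> 0) (fun=> 0) (fun=> 0).
Proof.
have z x : 0 = 0 + cint `[0, x] (fun=> 0 : R[i]) by rewrite cintE cinteg0 addr0.
by split; [exact: sqint0|exact: sqint0|exact: sqint0|move=> x _|move=> x _].
Qed.

Lemma H2_sum k (I : Type) (s : seq I) (P : pred I) (c : I -> R[i]) (u du ddu : I -> R -> R[i]) :
  (forall i, P i -> H2_on k (u i) (du i) (ddu i)) ->
  H2_on k (fun x => \sum_(i <- s | P i) c i * u i x)
          (fun x => \sum_(i <- s | P i) c i * du i x)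
          (fun x => \sum_(i <- s | P i) c i * ddu i x).
Proof.
move=> h; elim: s => [|i s ih].
  have e (F : I -> R -> R[i]) : (fun x => \sum_(i <- [::] | P i) c i * F i x) = (fun=> 0).
    by apply/funext => x; rewrite big_nil.
  by rewrite !e; exact: H2_zero.
have [Pi|nPi] := boolP (P i).
  have e (F : I -> R -> R[i]) : (fun x => \sum_(j <- i :: s | P j) c j * F j x) =
      (fun x => c i * F i x + \sum_(j <- s | P j) c j * F j x).
    by apply/funext => x; rewrite big_cons Pi.
  by rewrite !e; apply: H2_comb => //; exact: h.
have e (F : I -> R -> R[i]) : (fun x => \sum_(j <- i :: s | P j) c j * F j x) =
    (fun x => \sum_(j <- s | P j) c j * F j x).
  by apply/funext => x; rewrite big_cons (negbTE nPi).
by rewrite !e.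
Qed.

Definition rate (z : R[i]) (j : slot G) : R[i] := unknown_sign j * 'i%C * z.

(** The [+ 0] gives the exponent the affine shape of the lemmas on [cexp]. *)
Lemma basisE z (j : slot G) x : Defs.basis z j x = cexp (rate z j * x%:C + 0).
Proof. by rewrite addr0. Qed.

Lemma cmf_basis z (j : slot G) : cmfR setT (Defs.basis z j).
Proof.
apply: cmf_cexp; apply: cmfM; first exact: cmf_cst.
by apply: cmf_real; exact: measurable_id.
Qed.

Lemma basis_FTC z (j : slot G) x : 0 <= x ->
  Defs.basis z j x = Defs.basis z j 0 + cint `[0, x] (fun s => rate z j * Defs.basis z j s).
Proof.
move=> x0; rewrite (_ : cint _ _ = cint `[0, x] (fun s => rate z j * cexp (rate z j * s%:C + 0))).
  by rewrite cint_cexp// !addr0 /Defs.basis; ring.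
by rewrite !cintE; apply: eq_cinteg => s _; rewrite basisE.
Qed.

Lemma sqmod_basis_inr z (k : IU G) x :
  sqmod (Defs.basis z (inr k : slot G) x) = expR (- (2 * complex.Im z) * x).
Proof.
rewrite /Defs.basis sqmod_cexp; congr expR.
by rewrite /= mul1r Re_iz; ring.
Qed.

Lemma integrable_expR_halfline (c : R) : 0 < c ->
  leb.-integrable (`]0, +oo[%classic : set (measurableTypeR R)) (EFin \o (fun x => expR (- c * x))).
Proof.
move=> c0.
have cf : continuous (fun x : R => c * expR (- c * x)).
  move=> x; apply: cvgM; first exact: cvg_cst.
  apply: (@continuous_comp _ _ _ (fun x => - c * x) expR).
    by apply: cvgM; [exact: cvg_cst|exact: cvg_id].
  exact: continuous_expR.
have df (x : R) : is_derive x 1 (fun x => - expR (- c * x)) (c * expR (- c * x)).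
  have h1 : is_derive x 1 (fun s => - c * s + 0) (- c) := is_derive_affine (- c) 0 x.
  have h2 := is_derive1_comp (f := @expR R) (g := fun s => - c * s + 0) (x := x) (is_derive_expR _) h1.
  have -> : (fun x => - expR (- c * x)) = - (@expR R \o (fun s => - c * s + 0)).
    by apply/funext => s /=; rewrite fctE /= addr0.
  by apply: is_derive_eq; rewrite addr0; ring.
have dc : continuous (fun x : R => - expR (- c * x)).
  by move=> x; apply: differentiable_continuous; apply/derivable1_diffP; case: (df x).
have := @ge0_continuous_FTC2y R (fun x => c * expR (- c * x)) (fun x => - expR (- c * x)) 0 0.
move=> H.
have {}H : (\int[leb]_(x in `[0%R, +oo[) (c * expR (- c * x))%:E = 0%:E - (- expR (- c * 0))%:E)%E.
  apply: H.
  - by move=> x _; rewrite mulr_ge0 ?expR_ge0 ?(ltW c0).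
  - exact: continuous_subspaceT.
  - rewrite -oppr0; apply: cvgN.
    have -> : (fun x : R => expR (- c * x)) = (fun y => expR (- y)) \o (fun x => c * x).
      by apply/funext => x /=; rewrite mulNr.
    have h : c * x @[x --> +oo] --> +oo.
      apply/cvgryPge => A; near=> s.
      have As : A / c <= s by near: s; apply: nbhs_pinfty_ge; exact: num_real.
      by rewrite mulrC -ler_pdivrMr.
    apply: (@cvg_comp _ _ _ (fun x => c * x) (fun y => expR (- y)) _ _ _ h).
    exact: cvgr_expR.
  - by move=> x _; case: (df x).
  - by apply: cvg_at_right_filter; exact: dc.
  - by move=> x _; rewrite derive1E; have [_ ->] := df x.
have mf : measurable_fun setT (fun x : R => expR (- c * x)).
  apply: continuous_measurable_fun => x.
  apply: (@continuous_comp _ _ _ (fun x => - c * x) expR); last exact: continuous_expR.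
  by apply: cvgM; [exact: cvg_cst|exact: cvg_id].
have ic : leb.-integrable (`[0, +oo[%classic : set (measurableTypeR R)) (EFin \o (fun x => c * expR (- c * x))).
  apply/integrableP; split.
    by apply/measurable_EFinP; apply: measurable_funM; [exact: measurable_cst|exact: measurable_funTS].
  under eq_integral do rewrite /= ger0_norm ?mulr_ge0 ?expR_ge0 ?(ltW c0)//.
  by rewrite H -EFinB ltry.
have sub : (`]0, +oo[%classic : set (measurableTypeR R)) `<=` (`[0, +oo[%classic : set (measurableTypeR R)).
  by move=> x /=; rewrite !in_itv/= !andbT => /ltW.
have m1 : measurable (`]0, +oo[%classic : set (measurableTypeR R)) by exact: measurable_itv.
have m2 : measurable (`[0, +oo[%classic : set (measurableTypeR R)) by exact: measurable_itv.
have i2 := integrableS m2 m1 sub ic.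
have := RintegrableZ m1 c^-1 i2.
apply: eq_integrable => // x _ /=; congr _%:E.
by rewrite mulKf// gt_eqF.
Unshelve. all: by end_near. Qed.

(** On a finite edge boundedness is enough. On an infinite edge the ansatz contains only the
    outgoing exponential, of squared modulus e^{-2 Im(z) x}. *)
Lemma sqint_basis z (j : slot G) : 0 < complex.Im z ->
  square_integrable (edge_dom (slot_edge j)) (Defs.basis z j).
Proof.
move=> z0; have mb : cmfR (edge_dom (slot_edge j)) (Defs.basis z j) by apply: (cmfS (E := setT)) => //; exact: cmf_basis.
case: j mb => [[k b]|k] mb /=.
- have [M hM] := ccontinuous_bounded 0 (len k) (ccontinuous_cexp (rate z (inl (k, b))) 0).
  apply: (@sqint_bounded _ _ _ M) => //.
    exact: leb_oo_lty.
  move=> x /=; rewrite in_itv/= => /andP[x0 xl]; rewrite basisE; apply: hM.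
  by rewrite !ltW.
- apply: (@sqint_dom _ _ _ (fun x => expR (- (2 * complex.Im z) * x))) => //.
  + by apply: integrable_expR_halfline; rewrite mulr_gt0.
  + by move=> x _; rewrite sqmod_basis_inr.
Qed.

Lemma sqint_scale (D : set (measurableTypeR R)) c u : measurable D -> square_integrable D u ->
  square_integrable D (fun x => c * u x).
Proof.
move=> mD su.
have s0 : square_integrable D (fun=> 0).
  apply: (@sqint_dom _ _ _ (cst 0)) => //.
    exact: integrable0.
  by move=> x _; rewrite (sqmod_real 0) expr0n.
have := sqint_comb c mD su s0.
by rewrite (_ : (fun x => _) = (fun x => c * u x))//; apply/funext => x; rewrite addr0.
Qed.

Lemma H2_basis z (j : slot G) : 0 < complex.Im z ->
  H2_on (slot_edge j) (Defs.basis z j) (fun x => rate z j * Defs.basis z j x)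
    (fun x => rate z j * (rate z j * Defs.basis z j x)).
Proof.
move=> z0; have sb := sqint_basis j z0.
split => //; try by do ?apply: sqint_scale.
- by move=> x /edge_cl_ge0 x0; exact: basis_FTC.
- move=> x /edge_cl_ge0 x0; rewrite [in LHS]basis_FTC// mulrDr; congr (_ + _).
  rewrite !cintE -cintegZ//.
  have [M hM] := ccontinuous_bounded 0 x (ccontinuous_cexp (rate z j) 0).
  apply: (cintegrable_segment (M := n1 (rate z j) * M)).
    apply: (cmfS (E := setT)) => //; apply: cmfM; [exact: cmf_cst|exact: cmf_basis].
  by move=> s sx; rewrite (le_trans (n1M _ _))// ler_wpM2l ?n1_ge0// basisE hM.
Qed.

End H2.

Lemma sum_enum_val {V : nmodType} (T : finType) (F : T -> V) :
  \sum_(i < #|T|) F (enum_val i) = \sum_(s : T) F s.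
Proof. by rewrite [RHS](reindex _ (onW_bij _ (@enum_val_bij T))). Qed.

Local Opaque cexp.

(** * The ansatz and its vertex conditions *)

Section Solution.
Context {R : realType} (G : metric_graph R).
Implicit Types (k : edge G) (j e : slot G) (f : gfun G) (c : 'cV[R[i]]_(N G)).

Lemma vcond_lhs_comb (vc : vcond G) (I : finType) (a : I -> R[i]) (U W : I -> slot G -> R[i]) :
  vcond_lhs vc (fun e => \sum_i a i * U i e) (fun e => \sum_i a i * W i e) =
  \sum_i a i * vcond_lhs vc (U i) (W i).
Proof.
case: vc => [e e'|e|v] //=.
- by rewrite -sumrB; apply: eq_bigr => i _; rewrite mulrBr.
- by rewrite exchange_big; apply: eq_bigr => i _; rewrite mulr_sumr.
Qed.

Lemma vcond_lhsD (vc : vcond G) (U W U' W' : slot G -> R[i]) :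
  vcond_lhs vc (fun e => U e + U' e) (fun e => W e + W' e) =
  vcond_lhs vc U W + vcond_lhs vc U' W'.
Proof.
case: vc => [e e'|e|v] //=; last by rewrite big_split.
ring.
Qed.

Lemma vertex_conditions_scale P (U W : slot G -> R[i]) (a : R[i]) :
  vertex_conditions P U W -> vertex_conditions P U (fun e => a * W e).
Proof.
move=> [h1 h2 h3]; split => // v vi.
by rewrite -mulr_sumr h3// mulr0.
Qed.

Definition cof c j : R[i] := c (enum_rank j) 0.

Definition edge_src f (k : IB G) : R -> R[i] :=
  fun y => ind (`]0, len k[%classic : set (measurableTypeR R)) y * f (inl k) y.

(** The particular solution is zero on the infinite edges, where data in [Y_B] vanish. *)
Definition psol z f k : R -> R[i] :=
  match k with inl k' => part_sol z (edge_src f k') | inr _ => fun=> 0 end.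
Definition dpsol z f k : R -> R[i] :=
  match k with inl k' => dpart_sol z (edge_src f k') | inr _ => fun=> 0 end.
Definition ddpsol z f k : R -> R[i] :=
  match k with
  | inl k' => fun s => edge_src f k' s - z ^+ 2 * part_sol z (edge_src f k') s
  | inr _ => fun=> 0 end.

Definition hsol z c k x := \sum_(j | slot_edge j == k) cof c j * Defs.basis z j x.
Definition dhsol z c k x :=
  \sum_(j | slot_edge j == k) cof c j * (rate z j * Defs.basis z j x).
Definition ddhsol z c k x :=
  \sum_(j | slot_edge j == k) cof c j * (rate z j * (rate z j * Defs.basis z j x)).

Definition usol z f c : gfun G := fun k x => psol z f k x + hsol z c k x.

Lemma rate_sqr z j : rate z j * rate z j = - z ^+ 2.
Proof.
rewrite /rate; have s1 : unknown_sign j * unknown_sign j = 1 :> R[i].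
  by case: j => [[k []]|k] /=; rewrite ?mulrNN mulr1.
have ii : 'i%C * 'i%C = -1 :> R[i] := @sqr_ci R.
transitivity ((unknown_sign j * unknown_sign j) * ('i%C * 'i%C) * z ^+ 2); first by ring.
by rewrite s1 ii; ring.
Qed.

Lemma measurable_edge_oo (k : IB G) : measurable (`]0, len k[%classic : set (measurableTypeR R)).
Proof. exact: measurable_itv. Qed.

Lemma cintegrable_edge_src f (k : IB G) : L2 f -> cintegrable leb setT (edge_src f k).
Proof.
move=> Lf; apply: cintegrable_mkcond; first exact: measurable_edge_oo.
apply: sqint_cintegrable; [exact: measurable_edge_oo|exact: leb_oo_lty|exact: (Lf (inl k))].
Qed.

Lemma edge_src_le0 f (k : IB G) y : y <= 0 -> edge_src f k y = 0.
Proof.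
move=> y0; rewrite /edge_src ind_out ?mul0r//.
by rewrite mem_setE in_itv/= negb_and -leNgt y0.
Qed.

Lemma H2_psol z f k : z != 0 -> 0 <= complex.Im z -> L2 f ->
  H2_on k (psol z f k) (dpsol z f k) (ddpsol z f k).
Proof.
move=> z0 Iz Lf; case: k => [k|k]; last exact: H2_zero.
have ia := cintegrable_edge_src k Lf.
have mo := measurable_edge_oo k; have fo := leb_oo_lty 0 (len k).
have l0 : 0 <= len k by exact/ltW/len_gt0.
have sub : (`]0, len k[%classic : set (measurableTypeR R)) `<=` `[0, len k]%classic.
  by move=> x /=; rewrite !in_itv/= => /andP[a b]; rewrite !ltW.
pose B := \int[leb]_(y in setT) (2 * n1 (edge_src f k y)).
have in1 := integrable_n1 measurableT ia.
have iB : leb.-integrable setT (EFin \o (fun y => 2 * n1 (edge_src f k y))).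
  exact: RintegrableZ.
have [mp _] := dpart_sol_FTC z0 Iz ia (@edge_src_le0 f k) l0.
have [md _] := part_sol_FTC z0 Iz ia l0.
have bp x : n1 (part_sol z (edge_src f k) x) <= n1 (2%:R * 'i%C * z)^-1 * B.
  rewrite (le_trans (n1M _ _))// ler_wpM2l ?n1_ge0// n1_cinteg_le//.
    exact: (cintegrable_cmf (cintegrable_wave Iz ia x)).
  by move=> y _; rewrite (le_trans (n1M _ _))// ler_wpM2r ?n1_ge0// n1_wave.
have bd x : n1 (dpart_sol z (edge_src f k) x) <= n1 (2^-1 : R[i]) * B.
  rewrite (le_trans (n1M _ _))// ler_wpM2l ?n1_ge0// n1_cinteg_le//.
    exact: (cintegrable_cmf (cintegrable_sgn_wave Iz ia x)).
  move=> y _; rewrite (le_trans (n1M _ _))// ler_wpM2r ?n1_ge0//.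
  by rewrite (le_trans (n1M _ _))// n1_sgn mul1r n1_wave.
have sp : square_integrable `]0, len k[ (part_sol z (edge_src f k)).
  apply: (sqint_bounded mo fo (M := n1 (2%:R * 'i%C * z)^-1 * B)) => //.
  by apply: cmfS mp => //; exact: measurable_segment.
have sd : square_integrable `]0, len k[ (dpart_sol z (edge_src f k)).
  apply: (sqint_bounded mo fo (M := n1 (2^-1 : R[i]) * B)) => //.
  by apply: cmfS md => //; exact: measurable_segment.
split => //=.
- rewrite (_ : (fun s => _) = (fun s => (- z ^+ 2) * part_sol z (edge_src f k) s + edge_src f k s)); last first.
    by apply/funext => s; rewrite addrC mulNr.
  apply: sqint_comb => //.
  apply: (@sqint_dom _ _ _ (fun x => sqmod (f (inl k) x))) => //.
  + by apply: cmfS (cintegrable_cmf ia).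
  + exact: (integrable_sqmod (inl k) Lf).
  + move=> x kx; rewrite /edge_src ind_in ?mul1r//; exact: mem_set.
- by move=> x; rewrite in_itv/= => /andP[x0 _]; case: (part_sol_FTC z0 Iz ia x0).
- move=> x; rewrite in_itv/= => /andP[x0 _].
  by case: (dpart_sol_FTC z0 Iz ia (@edge_src_le0 f k) x0).
Qed.

Lemma H2_hsol z c k : 0 < complex.Im z -> H2_on k (hsol z c k) (dhsol z c k) (ddhsol z c k).
Proof.
by move=> z0; apply: H2_sum => j /eqP <-; exact: H2_basis.
Qed.

Definition dusol z f c : gfun G := fun k x => dpsol z f k x + dhsol z c k x.
Definition ddusol z f c : gfun G := fun k x => ddpsol z f k x + ddhsol z c k x.

Lemma Im_gt0_neq0 (z : R[i]) : 0 < complex.Im z -> z != 0.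
Proof. by move=> h; apply/eqP => z0; rewrite z0 ltxx in h. Qed.

Lemma H2_usol z f c k : 0 < complex.Im z -> L2 f ->
  H2_on k (usol z f c k) (dusol z f c k) (ddusol z f c k).
Proof.
move=> z0 Lf.
have := H2_comb 1 (H2_psol k (Im_gt0_neq0 z0) (ltW z0) Lf) (H2_hsol c k z0).
have e (u v : R -> R[i]) : (fun x => 1 * u x + v x) = (fun x => u x + v x).
  by apply/funext => x; rewrite mul1r.
by rewrite !e.
Qed.

Lemma L2_usol z f c : 0 < complex.Im z -> L2 f -> L2 (usol z f c).
Proof. by move=> z0 Lf k; case: (H2_usol c k z0 Lf). Qed.

Lemma ddusolE z f c k x : ddusol z f c k x =
  (match k with inl k' => edge_src f k' x | inr _ => 0 end) - z ^+ 2 * usol z f c k x.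
Proof.
have h : ddhsol z c k x = - z ^+ 2 * hsol z c k x.
  rewrite /ddhsol /hsol mulr_sumr; apply: eq_bigr => j _.
  by rewrite mulrA -[in RHS](rate_sqr z j); ring.
rewrite /ddusol /usol h; case: k {h} => k /=; ring.
Qed.

Definition null_on_U f := forall k : IU G, vanishes_on (inr k) f.

Lemma Fentry_inr z f (k : IU G) : L2 f -> null_on_U f -> Fentry z f (inr k) = 0.
Proof.
move=> Lf nf; rewrite /Fentry cintE (_ : cinteg _ _ _ = 0) ?mulr0//.
rewrite -[RHS](cinteg0 leb (edge_dom (inr k : edge G))); apply: ae_eq_cinteg.
- exact: (measurable_edge_dom (inr k : edge G)).
- apply: cmfM; last exact: (L2_cmf (inr k) Lf).
  apply: cmf_cexp; apply: cmfM; first exact: cmf_cst.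
  by apply: cmf_real; exact: measurable_id.
- exact: cmf_cst.
- by apply: ae_imp (nf k) => x h kx; rewrite h// mulr0.
Qed.

Lemma cinteg_edge_src f (k : IB G) (g : R -> R[i]) :
  cinteg leb setT (fun y => g y * edge_src f k y) =
  cint `]0, len k[ (fun y => g y * f (inl k) y).
Proof.
rewrite cintE [RHS]cinteg_mkcond; apply: eq_cinteg => y _.
by rewrite /edge_src; ring.
Qed.

Lemma cmf_weight z (l : slot G) : cmfR setT (weight z l).
Proof.
case: l => [[k []]|k]; apply: cmf_cexp; apply: cmfM; try exact: cmf_cst.
- by apply: cmf_real; exact: measurable_id.
- by apply: cmf_real; apply: measurable_funB; [exact: measurable_cst|exact: measurable_id].
- by apply: cmf_real; exact: measurable_id.
Qed.

Lemma weight_bounded z (k : IB G) (b : bool) :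
  exists M : R, forall y, 0 <= y <= len k -> n1 (weight z (inl (k, b) : slot G) y) <= M.
Proof.
case: b.
  have [M hM] := ccontinuous_bounded 0 (len k) (ccontinuous_cexp ('i%C * z) 0).
  by exists M => y yl; rewrite /= -[X in cexp X]addr0 hM.
have [M hM] := ccontinuous_bounded 0 (len k) (ccontinuous_cexp (- ('i%C * z)) ('i%C * z * (len k)%:C)).
exists M => y yl; rewrite /= (_ : 'i%C * z * (len k - y)%:C = - ('i%C * z) * y%:C + 'i%C * z * (len k)%:C) ?hM//.
by rewrite realCB; ring.
Qed.

Lemma cintegrable_weight z f (k : IB G) (b : bool) : L2 f ->
  cintegrable leb `]0, len k[ (fun y => weight z (inl (k, b) : slot G) y * f (inl k) y).
Proof.
move=> Lf; have [M hM] := weight_bounded z k b.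
apply: (cintegrableMl (measurable_edge_oo k) (M := M)).
- by apply: cmfS (cmf_weight z _) => //; exact: measurableT.
- by move=> y /=; rewrite in_itv/= => /andP[a b0]; apply: hM; rewrite !ltW.
- apply: sqint_cintegrable; [exact: measurable_edge_oo|exact: leb_oo_lty|exact: (Lf (inl k))].
Qed.

Lemma psol_end z f e : L2 f -> null_on_U f ->
  psol z f (slot_edge e) (end_pos e) = Fentry z f e.
Proof.
move=> Lf nf; case: e => [[k b]|k]; last by rewrite Fentry_inr.
rewrite /= /part_sol /Fentry cinteg_edge_src /=; congr (_ * _).
rewrite !cintE; apply: eq_cinteg => y; rewrite mem_setE in_itv/= => /andP[y0 yl].
case: b; first by rewrite sub0r normrN gtr0_norm.
by rewrite gtr0_norm ?subr_gt0.
Qed.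

(** At either end the wave leaves the edge, so its outward derivative is iz times its value: at 0
    the outward sign and the sign of the derivative of |x - y| cancel. Thus the same entry of F
    serves for values and for derivatives divided by iz. *)
Lemma dpsol_end z f e : z != 0 -> L2 f -> null_on_U f ->
  end_sign e * dpsol z f (slot_edge e) (end_pos e) = ('i%C * z) * Fentry z f e.
Proof.
move=> z0 Lf nf; case: e => [[k b]|k]; last by rewrite Fentry_inr// !mulr0.
have i0 : 'i%C != 0 :> R[i] by rewrite eq_complex /= eqxx oner_eq0.
rewrite /= /dpart_sol /Fentry cinteg_edge_src /=.
have -> : 'i%C * z * ((2%:R * 'i%C * z)^-1 * cint `]0, len k[ (fun y => weight z (inl (k, b)) y * f (inl k) y)) =
    2^-1 * cint `]0, len k[ (fun y => weight z (inl (k, b)) y * f (inl k) y).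
  by field; rewrite z0 i0.
have iw b' := cintegrable_weight z k b' Lf.
case: b.
- rewrite mulN1r -mulrN !cintE -cintegN//; last first.
    have := iw true; rewrite /= => /(cintegrableN (measurable_edge_oo k)).
    apply: eq_cintegrable; first exact: measurable_edge_oo.
    move=> y; rewrite mem_setE in_itv/= => /andP[y0 yl].
    by rewrite /sgn subr_ge0 leNgt y0 /= sub0r normrN gtr0_norm// /wave; ring.
  congr (_ * _); apply: eq_cinteg => y; rewrite mem_setE in_itv/= => /andP[y0 yl].
  by rewrite /sgn subr_ge0 leNgt y0 /= sub0r normrN gtr0_norm// /wave; ring.
- rewrite mul1r; congr (_ * _); rewrite !cintE; apply: eq_cinteg => y.
  rewrite mem_setE in_itv/= => /andP[y0 yl].
  by rewrite /sgn subr_ge0 (ltW yl) mul1r gtr0_norm ?subr_gt0.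
Qed.

Lemma hsol_end z c e : hsol z c (slot_edge e) (end_pos e) = \sum_j cof c j * tr_value z j e.
Proof.
rewrite /hsol big_mkcond; apply: eq_bigr => j _.
by rewrite /tr_value eq_sym; case: ifP => _; rewrite ?mulr0.
Qed.

Lemma dhsol_end z c e : end_sign e * dhsol z c (slot_edge e) (end_pos e) =
  ('i%C * z) * \sum_j cof c j * tr_deriv z j e.
Proof.
rewrite /dhsol !mulr_sumr big_mkcond; apply: eq_bigr => j _.
rewrite /tr_deriv /tr_value eq_sym; case: ifP => _; rewrite ?mulr0//.
by rewrite /rate; ring.
Qed.

Section System.
Variables (conds : 'I_(N G) -> vcond G) (hconds : lists_vertex_conditions conds).

(** Traces of the ansatz are combinations of unit traces, with the entries of F as coefficients, and
    of traces of the exponentials, with the unknowns as coefficients. By linearity of [vcond_lhs],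
    condition i is row i of the linear system. *)
Lemma usol_vertex_conditions z f c : z != 0 -> L2 f -> null_on_U f ->
  Dmat conds z *m c = Rmat conds *m Fvec z f ->
  vertex_conditions predT (end_value (usol z f c)) (end_deriv (dusol z f c)).
Proof.
move=> z0 Lf nf sys.
pose U e := \sum_(l : slot G) Fentry z f l * (e == l)%:R + \sum_j cof c j * tr_value z j e.
pose W e := \sum_(l : slot G) Fentry z f l * (e == l)%:R + \sum_j cof c j * tr_deriv z j e.
have dl (e : slot G) : \sum_(l : slot G) Fentry z f l * (e == l)%:R = Fentry z f e.
  rewrite (bigD1 e)//= eqxx mulr1 big1 ?addr0// => l le.
  by rewrite eq_sym (negbTE le) mulr0.
have -> : end_value (usol z f c) = U.
  by apply/funext => e; rewrite /end_value /usol psol_end// hsol_end /U dl.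
have -> : end_deriv (dusol z f c) = (fun e => ('i%C * z) * W e).
  apply/funext => e; rewrite /end_deriv /dusol mulrDr dpsol_end// dhsol_end /W dl.
  by rewrite mulrDr.
apply: vertex_conditions_scale; apply/hconds => i.
rewrite /U /W vcond_lhsD !vcond_lhs_comb.
have := congr1 (fun M : 'cV_(N G) => M i 0) sys; rewrite !mxE.
have -> : \sum_j Dmat conds z i j * c j 0 =
    \sum_j cof c j * vcond_lhs (conds i) (tr_value z j) (tr_deriv z j).
  rewrite -(sum_enum_val (fun j => cof c j * vcond_lhs (conds i) (tr_value z j) (tr_deriv z j))).
  by apply: eq_bigr => j _; rewrite !mxE /cof enum_valK mulrC.
have -> : \sum_j Rmat conds i j * Fvec z f j 0 =
    - \sum_(l : slot G) Fentry z f l * vcond_lhs (conds i) (fun e => (e == l)%:R) (fun e => (e == l)%:R).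
  rewrite -(sum_enum_val (fun l => Fentry z f l * vcond_lhs (conds i) (fun e => (e == l)%:R) (fun e => (e == l)%:R))).
  by rewrite -sumrN; apply: eq_bigr => j _; rewrite !mxE mulNr mulrC.
by move=> ->; rewrite addrN.
Qed.

Lemma usol_Hop z f c : 0 < complex.Im z -> L2 f -> null_on_U f ->
  Dmat conds z *m c = Rmat conds *m Fvec z f ->
  Hop (usol z f c) (fun k x => z ^+ 2 * usol z f c k x - f k x).
Proof.
move=> z0 Lf nf sys; exists (usol z f c), (dusol z f c), (ddusol z f c); split.
- split; first by move=> k _; exact: H2_usol.
  by apply: usol_vertex_conditions => //; exact: Im_gt0_neq0.
- exact: eq_ae_refl.
- case=> k.
  + apply: aeW => x kx; rewrite ddusolE /edge_src ind_in; last exact: mem_set.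
    by ring.
  + by apply: ae_imp (nf k) => x h kx; rewrite ddusolE h//; ring.
Qed.

Variable (E : resolution G).
Hypothesis hE : is_resolution_of E (@Hop R G).

(** The exponentials of the ansatz are linearly independent modulo null sets: two zeros on a finite
    edge, or one zero on an infinite edge, force the coefficients to vanish. *)
Lemma hsol_ae_eq0 z c : 0 < complex.Im z ->
  eq_ae (usol z (@gzero R G) c) (@gzero R G) -> c = 0.
Proof.
move=> z0 u0.
have pz k x : psol z (@gzero R G) k x = 0.
  case: k => k //=; rewrite /part_sol (_ : cinteg _ _ _ = 0) ?mulr0//.
  rewrite -[RHS](cinteg0 leb setT); apply: eq_cinteg => y _.
  by rewrite /edge_src /gzero !mulr0.
(* A null set contains no nonempty open interval, so every such interval contains a zero. *)
have pick k (p q : R) : p < q -> (`]p, q[%classic : set R) `<=` edge_dom k ->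
    exists2 x, p < x < q & hsol z c k x = 0.
  move=> pq sub; apply: contrapT => nx.
  have [A [mA A0 subA]] := u0 k.
  have : (leb (`]p, q[%classic : set (measurableTypeR R)) <= leb A)%E.
    apply: le_measure; rewrite ?inE//.
    move=> x /= xpq; apply: subA => /= h.
    have := h (sub x xpq); rewrite /usol pz add0r /gzero => hx.
    by apply: nx; exists x => //; move: xpq; rewrite in_itv.
  rewrite A0; have e : leb (`]p, q[%classic : set (measurableTypeR R)) = _ := lebesgue_measure_itv `]p, q[.
  by rewrite e /= lte_fin pq -EFinB lee_fin leNgt subr_gt0 pq.
have cj0 j : cof c j = 0.
  case: j => [[k b]|k].
  - have l0 := len_gt0 k.
    have hsE x : hsol z c (inl k) x = cof c (inl (k, true)) * cexp (- ('i%C * z * x%:C)) +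
        cof c (inl (k, false)) * cexp ('i%C * z * x%:C).
      rewrite /hsol (bigD1 (inl (k, true) : slot G))//= (bigD1 (inl (k, false) : slot G))/=; last by rewrite eqxx /=; apply/eqP => -[].
      rewrite big1 ?addr0; last first.
        move=> [[k' []]|k'] /=.
        - by move=> /andP[/andP[/eqP[->] +] _]; rewrite eqxx.
        - by move=> /andP[/andP[/eqP[->] _] +]; rewrite eqxx.
        - by [].
      by rewrite /Defs.basis /=; congr (_ * cexp _ + _ * cexp _); ring.
    have hl : len k / 2 < len k by rewrite ltr_pdivrMr// ltr_pMr// ltr1n.
    have [|x /andP[x0 xl] hx] := @pick (inl k) 0 (len k / 2) (divr_gt0 l0 (ltr0n _ 2)).
      by move=> t /=; rewrite !in_itv/= => /andP[-> /lt_trans -> //].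
    have [|y /andP[ly yl] hy] := @pick (inl k) (len k / 2) (len k) hl.
      move=> t /=; rewrite !in_itv/= => /andP[a ->]; rewrite andbT.
      by rewrite (lt_trans _ a)// divr_gt0.
    have xy : x < y by rewrite (lt_trans xl ly).
    move: hx hy; rewrite !hsE.
    set A := cof c _; set B := cof c _.
    set P := cexp ('i%C * z * x%:C); set Q := cexp ('i%C * z * y%:C).
    set P' := cexp (- _); set Q' := cexp (- _) => hx hy.
    have PP : P' * P = 1 by rewrite /P' cexpN_mul.
    have QQ : Q' * Q = 1 by rewrite /Q' cexpN_mul.
    (* As Im z > 0, the exponentials at x and y have different moduli; this is the nonvanishing of
       the 2 x 2 determinant. *)
    have PQ : P * P - Q * Q != 0.
      apply/eqP => /eqP; rewrite subr_eq0 => /eqP /(congr1 sqmod).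
      rewrite (sqmodM P) (sqmodM Q) /P /Q !sqmod_cexp !Re_iz -!expRD => /expR_inj h.
      have : complex.Im z * x = complex.Im z * y by lra.
      by move=> /(mulfI (negbT (gt_eqF z0))) xy'; rewrite xy' ltxx in xy.
    have hA : A = - (B * (P * P)).
      have := congr1 (fun t => t * P) hx; rewrite mul0r mulrDl -mulrA PP mulr1 -mulrA.
      by move=> /eqP; rewrite addr_eq0 => /eqP.
    have hA' : A = - (B * (Q * Q)).
      have := congr1 (fun t => t * Q) hy; rewrite mul0r mulrDl -mulrA QQ mulr1 -mulrA.
      by move=> /eqP; rewrite addr_eq0 => /eqP.
    have B0 : B = 0.
      have : B * (P * P - Q * Q) = 0.
        by rewrite mulrBr -[B * (P * P)]opprK -hA -[B * (Q * Q)]opprK -hA' subrr.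
      by move=> /eqP; rewrite mulf_eq0 (negbTE PQ) orbF => /eqP.
    by case: b; rewrite -?/A -?/B // hA B0 mul0r oppr0.
  - have [|x _ hx] := @pick (inr k) 0 1 ltr01.
      by move=> t /=; rewrite !in_itv/= andbT => /andP[].
    move: hx; rewrite /hsol (bigD1 (inr k : slot G))//= big1 ?addr0; last first.
      by move=> [[k' b']|k'] //= /andP[/eqP[->] +]; rewrite eqxx.
    move=> /eqP; rewrite mulf_eq0 => /orP[/eqP//|/eqP h].
    have := sqmod_cexp (1 * 'i%C * z * x%:C); rewrite -/(Defs.basis z (inr k : slot G) x) h (sqmod_real 0) expr0n.
    by move=> /esym/eqP; rewrite gt_eqF// expR_gt0.
apply/colP => i; rewrite mxE.
by have := cj0 (enum_val i); rewrite /cof enum_valK.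
Qed.

(* A kernel vector of [Dmat conds z] gives, for zero data, an eigenfunction of [H]
   at [z ^+ 2]. *)
Lemma Dmat_unit z : 0 < complex.Im z -> complex.Im (z ^+ 2) != 0 -> Dmat conds z \in unitmx.
Proof.
move=> z0 z20; rewrite -unitmx_tr -row_free_unit -kermx_eq0; apply/eqP/row_matrixP => i.
rewrite row0; set w := row i _.
have wD : w *m (Dmat conds z)^T = 0.
  by apply/eqP; rewrite -sub_kermx row_sub.
have sys : Dmat conds z *m w^T = 0.
  by rewrite -[LHS]trmxK trmx_mul trmxK wD trmx0.
have L0 := @L2_zero R G.
have F0 : Fvec z (@gzero R G) = 0.
  apply/colP => j; rewrite !mxE /Fentry cintE (_ : cinteg _ _ _ = 0) ?mulr0//.
  rewrite -[RHS](cinteg0 leb (edge_dom (slot_edge (enum_val j)))); apply: eq_cinteg => y _.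
  by rewrite /gzero mulr0.
have n0 : null_on_U (@gzero R G) by move=> k; exact: aeW.
have Lu := L2_usol w^T z0 L0.
have hop : Hop (usol z (@gzero R G) w^T) (fun k x => z ^+ 2 * usol z (@gzero R G) w^T k x).
  have := @usol_Hop z (@gzero R G) w^T z0 L0 n0; rewrite F0 mulmx0 => /(_ sys).
  rewrite (_ : (fun k x => _) = (fun k x => z ^+ 2 * usol z (@gzero R G) w^T k x))//.
  by apply/funext => k; apply/funext => x; rewrite /gzero subr0.
have := hsol_ae_eq0 z0 (sqnorm_eq0 Lu (no_nonreal_eigenvalue hE z20 Lu hop)).
by move=> /(congr1 trmx); rewrite trmxK trmx0.
Qed.

End System.

End Solution.

(** * Complex conjugation *)

Lemma sqint_conj {R : realType} (D : set (measurableTypeR R)) (u : R -> R[i]) :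
  square_integrable D u -> square_integrable D (fun x => conjc (u x)).
Proof.
move=> [mu hu]; split; first exact: (cmfJ mu).
by under eq_integral do rewrite sqmodJ.
Qed.

Lemma conjc_idem {R : realType} (z : R[i]) : conjc (conjc z) = z.
Proof. by apply: complex_ext; rewrite ?cReJ// !cImJ opprK. Qed.

Lemma subcJ {R : realType} (z : R[i]) : z - conjc z = 2%:R * 'i%C * (complex.Im z)%:C.
Proof.
rewrite -realC_nat; apply: complex_ext; rewrite ?cReM ?cImM ?cReD ?cImD ?cReN ?cImN ?cReJ ?cImJ ?cReM ?cImM /=; ring.
Qed.

Section Conjugation.
Context {R : realType} (G : metric_graph R).
Implicit Types (f u v w p : gfun G) (k : edge G).

Lemma H2_conj k (u du ddu : R -> R[i]) : H2_on k u du ddu ->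
  H2_on k (fun x => conjc (u x)) (fun x => conjc (du x)) (fun x => conjc (ddu x)).
Proof.
move=> [su sdu sddu hu hdu]; split; try exact: sqint_conj.
- move=> x kx; rewrite (hu _ kx) conjcD !cintE cintegJ//.
  exact: (edge_sqint_cintegrable kx).
- move=> x kx; rewrite (hdu _ kx) conjcD !cintE cintegJ//.
  exact: (edge_sqint_cintegrable kx).
Qed.

Lemma vertex_conditions_conj P (U W : slot G -> R[i]) : vertex_conditions P U W ->
  vertex_conditions P (fun e => conjc (U e)) (fun e => conjc (W e)).
Proof.
move=> [h1 h2 h3]; split.
- by move=> e e' Pe Pe' ee'; rewrite (h1 e e').
- by move=> e Pe ve; rewrite h2// conjc0.
- by move=> v vi; rewrite -conjc_sum h3// conjc0.
Qed.

Lemma lap_dom_conj P u du ddu : lap_dom P u du ddu ->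
  lap_dom P (gconj u) (gconj du) (gconj ddu).
Proof.
move=> [h1 h2]; split; first by move=> k Pk; apply: H2_conj; exact: h1.
have := vertex_conditions_conj h2.
rewrite (_ : (fun e => conjc (end_deriv du e)) = end_deriv (gconj du))//.
apply/funext => e; rewrite /end_deriv conjcM; congr (_ * _).
by case: e => [[? []]|?]; apply: complex_ext => //=; rewrite ?oppr0.
Qed.

Lemma eq_ae_on_conj k (u v : R -> R[i]) : eq_ae_on k u v ->
  eq_ae_on k (fun x => conjc (u x)) (fun x => conjc (v x)).
Proof. by apply: ae_imp => x h kx; rewrite h. Qed.

Lemma Hop_conj u w : Hop u w -> Hop (gconj u) (gconj w).
Proof.
move=> [v [dv [ddv [h1 h2 h3]]]]; exists (gconj v), (gconj dv), (gconj ddv); split.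
- exact: lap_dom_conj.
- by move=> k; apply: eq_ae_on_conj; exact: h2.
- by move=> k; apply: ae_imp (h3 k) => x h kx; rewrite /gconj h// conjcN.
Qed.

Lemma vanishes_on_conj k u : vanishes_on k u -> vanishes_on k (gconj u).
Proof. by apply: ae_imp => x h kx; rewrite /gconj h// conjc0. Qed.

Lemma Sd_space_conj (mu : R[i]) p : Sd_space mu p -> Sd_space (conjc mu) (gconj p).
Proof.
move=> [Lp [np [v [dv [ddv [h1 h2 h3 h4]]]]]]; split; first exact: L2_conj.
split; first by move=> k; exact: vanishes_on_conj.
exists (gconj v), (gconj dv), (gconj ddv); split.
- exact: lap_dom_conj.
- by move=> k; apply: eq_ae_on_conj; exact: h2.
- by move=> k; apply: ae_imp (h3 k) => x h kx; rewrite /gconj -conjcN h// conjcM.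
- by move=> e be ve; have := h4 e be ve; rewrite /end_value /gconj => ->; rewrite conjc0.
Qed.

Lemma Y_D_conj p : Y_D p -> Y_D (gconj p).
Proof.
move=> [Lp hp]; split; first exact: L2_conj.
move=> eps e0; have [n [mu [phi [h1 h2]]]] := hp eps e0.
exists n, (fun i => conjc (mu i)), (fun i => gconj (phi i)); split.
  by move=> i; exact: Sd_space_conj.
move: h2 => /=; rewrite !Re_inner_sqnorm; apply: le_lt_trans.
rewrite le_eqVlt; apply/orP; left; apply/eqP; apply: eq_bigr => k _.
congr (fine _); apply: eq_integral => x _ /=; congr EFin.
by rewrite /gconj -conjc_sum -conjcN -conjcD sqmodJ.
Qed.

Lemma Y_U_conj (k : IU G) u : Y_U k u -> Y_U k (gconj u).
Proof.
move=> [Lu hu]; split; first exact: L2_conj.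
by move=> j jk; apply: vanishes_on_conj; exact: hu.
Qed.

Lemma L2_sum (I : Type) (s : seq I) (u : I -> gfun G) p : (forall i, L2 (u i)) -> L2 p ->
  L2 (fun k x => \sum_(i <- s) u i k x + p k x).
Proof.
move=> Lu Lp; elim: s => [|i s ih].
  rewrite (_ : (fun k x => _) = p)//.
  by apply/funext => k; apply/funext => x; rewrite big_nil add0r.
rewrite (_ : (fun k x => _) = gcomb 1 (u i) (fun k x => \sum_(i <- s) u i k x + p k x)).
  exact: L2_gcomb.
by apply/funext => k; apply/funext => x; rewrite /gcomb big_cons mul1r addrA.
Qed.

(** The resolvent at the conjugate of z^2 is reached by conjugating the one at z^2, which is then
    applied to the conjugate of f; the kernel formula must therefore hold for that function too. *)
Lemma Y_B_conj f : Y_B f -> Y_B (gconj f).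
Proof.
move=> [Lf hf]; split; first exact: L2_conj.
move=> y p Uy Dp; set q := (fun j x => _ : R[i]).
pose q' : gfun G := fun j x => \sum_(k : IU G) gconj (y k) j x + gconj p j x.
have -> : q = gconj q'.
  apply/funext => j; apply/funext => x; rewrite /q /q' /gconj conjcD conjc_idem conjc_sum.
  by congr (_ + _); apply: eq_bigr => k _; rewrite conjc_idem.
rewrite inner_gconj//; last first.
  apply: L2_sum => [i|]; apply: L2_conj; [by case: (Uy i)|by case: Dp].
rewrite hf ?conjc0//; [by move=> k; exact: Y_U_conj|exact: Y_D_conj].
Qed.

Lemma Y_D0 : Y_D (@gzero R G).
Proof.
split; first exact: L2_zero.
move=> eps e0; exists 0%N, (fun=> 0), (fun=> @gzero R G); split; first by case.
rewrite /= Re_inner_sqnorm (_ : (fun k x => _) = @gzero R G).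
  rewrite /sqnorm big1// => k _; rewrite /Rintegral integral0_eq// => x _.
  by rewrite /gzero (sqmod_real 0) expr0n.
by apply/funext => k; apply/funext => x; rewrite big_ord0 subrr.
Qed.

(** Orthogonality is tested on the sum of the restrictions of f to the infinite edges; the inner
    product is the squared norm of that sum. *)
Lemma Y_B_null_on_U f : Y_B f -> null_on_U f.
Proof.
move=> [Lf hf].
pose y (k : IU G) : gfun G := fun j x => if j == inr k then f j x else 0.
have Uy (k : IU G) : Y_U k (y k).
  split.
    move=> j; rewrite /y; case: eqP => _; first exact: Lf.
    exact: (L2_zero (G := G) j).
  by move=> j /negbTE jk; apply: aeW => x _; rewrite /y jk.
pose q : gfun G := fun j x => \sum_(k : IU G) y k j x + @gzero R G j x.
have qE j x : q j x = if j is inr _ then f j x else 0.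
  rewrite /q /gzero addr0; case: j => [j|j]; first by rewrite big1.
  rewrite (bigD1 j)//= /y eqxx big1 ?addr0// => k kj.
  by rewrite ifF//; apply/eqP => -[] /esym/eqP; rewrite (negbTE kj).
have Lq : L2 q by apply: L2_sum => [k|]; [case: (Uy k)|exact: L2_zero].
have : inner q q = 0.
  rewrite -(hf y (@gzero R G) Uy Y_D0) -/q; apply: eq_bigr => j _.
  rewrite !cintE; apply: eq_cinteg => x _; rewrite !qE.
  by case: j => // j; rewrite conjc0 !mulr0.
rewrite inner_sqnorm => -[] /(sqnorm_eq0 Lq) h k.
by apply: ae_imp (h (inr k)) => x + kx => /(_ kx); rewrite qE.
Qed.

End Conjugation.

(** * The kernel of the resolvent *)

Section Kernel.
Context {R : realType} (G : metric_graph R).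
Implicit Types (f u v w : gfun G).
Variable conds : 'I_(N G) -> vcond G.
Variables (d_d d_c : R[i] -> R[i]) (Mp Mc : R[i] -> 'M[R[i]]_(N G)).

Lemma cintegrable_wave_edge z f (k : IB G) x : 0 <= complex.Im z -> L2 f ->
  cintegrable leb `]0, len k[ (fun y => wave z `|x - y| * f (inl k) y).
Proof.
move=> Iz Lf; have h := cintegrable_wave Iz (cintegrable_edge_src k Lf) x.
have mo := measurable_edge_oo k.
apply: eq_cintegrable (cintegrableS measurableT mo (@subsetT _ _) h) => // y yk.
by rewrite /edge_src ind_in ?mul1r.
Qed.

Definition kint (K : edge G -> R -> IB G -> R -> R[i]) f : gfun G := fun k x =>
  \sum_(k' : IB G) cint `]0, len k'[ (fun y => K k x k' y * f (inl k') y).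

(** The coefficients are combinations of entries of F, each the integral of f against a [weight].
    Distributing the sums over the integrals reproduces the double sum in [KB]; the entries of
    infinite edges vanish with f. *)
Lemma usolE z f k x : 0 <= complex.Im z -> L2 f -> null_on_U f ->
  usol z f ((d_c z)^-1 *: (Mc z *m Rmat conds *m Fvec z f)) k x =
  kint (KB conds d_c Mc z) f k x.
Proof.
move=> Iz Lf nf.
have mo k' := measurable_edge_oo (G := G) k'.
set A := Mc z *m Rmat conds.
have cofE j : cof ((d_c z)^-1 *: (A *m Fvec z f)) j = (d_c z)^-1 *
    \sum_(k' : IB G) \sum_(b : bool) A (enum_rank j) (enum_rank (inl (k', b) : slot G)) *
       Fentry z f (inl (k', b)).
  rewrite /cof !mxE; congr (_ * _).
  transitivity (\sum_(l : slot G) A (enum_rank j) (enum_rank l) * Fentry z f l).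
    rewrite -(sum_enum_val (fun l => A (enum_rank j) (enum_rank l) * Fentry z f l)).
    by apply: eq_bigr => l _; rewrite !mxE enum_valK.
  rewrite big_sumType /= [X in _ + X]big1 ?addr0; last by move=> l _; rewrite Fentry_inr// mulr0.
  by rewrite (pair_bigA _ (fun k' b => A (enum_rank j) (enum_rank (inl (k', b) : slot G)) *
       Fentry z f (inl (k', b)))) /=; apply: eq_bigr => -[].
set c0 := (2%:R * 'i%C * z)^-1.
have KE k' : cint `]0, len k'[ (fun y => KB conds d_c Mc z k x k' y * f (inl k') y) =
    (if k == inl k' then c0 * cint `]0, len k'[ (fun y => wave z `|x - y| * f (inl k') y) else 0) +
    \sum_(j : slot G | slot_edge j == k) \sum_(b : bool)
      (d_c z)^-1 * Defs.basis z j x * A (enum_rank j) (enum_rank (inl (k', b) : slot G)) *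
      Fentry z f (inl (k', b)).
  pose F1 y := (if k == inl k' then c0 else 0) * (wave z `|x - y| * f (inl k') y).
  pose F2 j b y := (c0 * (d_c z)^-1 * Defs.basis z j x * A (enum_rank j) (enum_rank (inl (k', b) : slot G))) *
     (weight z (inl (k', b) : slot G) y * f (inl k') y).
  have i1 : cintegrable leb `]0, len k'[ F1.
    by apply: (cintegrableZ (mo k')); exact: cintegrable_wave_edge.
  have i2 j b : cintegrable leb `]0, len k'[ (F2 j b).
    by apply: (cintegrableZ (mo k')); exact: cintegrable_weight.
  have -> : cint `]0, len k'[ (fun y => KB conds d_c Mc z k x k' y * f (inl k') y) =
    cint `]0, len k'[ (fun y => F1 y + \sum_(j : slot G | slot_edge j == k) \sum_(b : bool) F2 j b y).
    congr (cint _); apply/funext => y; rewrite /KB -/c0 -/A mulrDr mulrDl; congr (_ + _).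
      by rewrite /F1 /wave; case: ifP => _; ring.
    rewrite !mulr_sumr mulr_suml; apply: eq_bigr => j _.
    by rewrite !mulr_sumr mulr_suml; apply: eq_bigr => b _; rewrite /F2; ring.
  rewrite cintE cintegD//; last first.
    by apply: (cintegrable_sum (mo k')) => j _; apply: (cintegrable_sum (mo k')) => b _.
  congr (_ + _).
    rewrite /F1 cintegZ//; last exact: cintegrable_wave_edge.
    by case: ifP => _; rewrite ?mul0r.
  rewrite cinteg_sum//; last by move=> j _; apply: (cintegrable_sum (mo k')) => b _.
  apply: eq_bigr => j _; rewrite cinteg_sum//; apply: eq_bigr => b _.
  rewrite /F2 cintegZ//; last exact: cintegrable_weight.
  by rewrite /Fentry cintE /= -/c0; ring.
rewrite /kint (eq_bigr _ (fun k' _ => KE k')) big_split /= /usol; congr (_ + _).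
  case: k {KE} => k.
    rewrite (bigD1 k)//= eqxx big1 ?addr0; last first.
      by move=> k' /negbTE k'k; rewrite ifF//; apply/eqP => -[] /esym/eqP; rewrite k'k.
    by rewrite /psol /part_sol cinteg_edge_src.
  by rewrite big1.
rewrite /hsol exchange_big /=; apply: eq_bigr => j _.
rewrite cofE !mulr_sumr mulr_suml; apply: eq_bigr => k' _.
by rewrite !mulr_sumr mulr_suml; apply: eq_bigr => b _; ring.
Qed.

Hypothesis hconds : lists_vertex_conditions conds.
Hypothesis hA1 : assumption_A1 conds d_d d_c Mp Mc.
Hypothesis hA3 : assumption_A3 conds Mp.
Variable (E : resolution G).
Hypothesis hE : is_resolution_of E (@Hop R G).

(** On [Y_B], (A3) removes [Mp] from the adjugate and leaves d_d times [Mc]. Dividing by det D = d_d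
    d_c cancels d_d, the factor that vanishes on S_d, and the ansatz then solves the system. *)
Lemma kint_Hop z f : 0 < complex.Im z -> complex.Im (z ^+ 2) != 0 -> Y_B f ->
  L2 (kint (KB conds d_c Mc z) f) /\
  Hop (kint (KB conds d_c Mc z) f) (fun k x => z ^+ 2 * kint (KB conds d_c Mc z) f k x - f k x).
Proof.
move=> z0 z20 Yf; have Lf : L2 f by case: Yf.
have nf := Y_B_null_on_U Yf.
have Du := Dmat_unit hconds hE z0 z20.
have ur : upper_or_real z by exact: ltW.
have un : upper_or_real_nz z by split; [exact: ltW|exact: Im_gt0_neq0].
have dE := A1_factor hA1 ur.
have d0 : \det (Dmat conds z) != 0 by move: Du; rewrite unitmxE unitfE.
(* Both factors are nonzero because D(z) is invertible at this z. *)
have /andP[dd0 dc0] : (d_d z != 0) && (d_c z != 0) by rewrite -negb_or -mulf_eq0 -dE.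
set c := (d_c z)^-1 *: (Mc z *m Rmat conds *m Fvec z f).
have sys : Dmat conds z *m c = Rmat conds *m Fvec z f.
  rewrite /c -scalemxAr.
  have -> : Mc z *m Rmat conds *m Fvec z f = (d_d z)^-1 *: (\adj (Dmat conds z) *m (Rmat conds *m Fvec z f)).
    rewrite (A1_adj hA1 un) mulmxDl !mulmxA hA3// add0r -!scalemxAl scalerA mulVf// scale1r//.
  rewrite -scalemxAr scalerA (mulmxA (Dmat conds z)) mul_mx_adj mul_scalar_mx scalerA dE.
  by rewrite -invfM [d_d z * _]mulrC mulVf ?scale1r// mulf_neq0.
have e : usol z f c = kint (KB conds d_c Mc z) f.
  by apply/funext => k; apply/funext => x; rewrite usolE// ltW.
rewrite -e; split; first exact: L2_usol.
exact: usol_Hop.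
Qed.

Definition ImKB z k x k' y : R[i] := (complex.Im (KB conds d_c Mc z k x k' y))%:C.

Lemma cintegrable_KB z f k x (k' : IB G) : 0 <= complex.Im z -> L2 f ->
  cintegrable leb `]0, len k'[ (fun y => KB conds d_c Mc z k x k' y * f (inl k') y).
Proof.
move=> Iz Lf; have mo := measurable_edge_oo (G := G) k'.
have e : (fun y => KB conds d_c Mc z k x k' y * f (inl k') y) =
  (fun y => (2%:R * 'i%C * z)^-1 * ((if k == inl k' then 1 else 0) * (wave z `|x - y| * f (inl k') y) +
     \sum_(j : slot G | slot_edge j == k) \sum_(b : bool)
      ((d_c z)^-1 * Defs.basis z j x * (Mc z *m Rmat conds) (enum_rank j) (enum_rank (inl (k', b) : slot G))) *
      (weight z (inl (k', b) : slot G) y * f (inl k') y))).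
  apply/funext => y; rewrite /KB -[LHS]mulrA; congr (_ * _); rewrite mulrDl; congr (_ + _).
    by case: ifP => _; rewrite ?mul0r ?mul1r.
  rewrite mulr_sumr mulr_suml; apply: eq_bigr => j _.
  by rewrite mulr_sumr mulr_suml; apply: eq_bigr => b _; ring.
rewrite e; apply: (cintegrableZ mo); apply: (cintegrableD mo).
  by apply: (cintegrableZ mo); exact: cintegrable_wave_edge.
apply: (cintegrable_sum mo) => j _; apply: (cintegrable_sum mo) => b _.
by apply: (cintegrableZ mo); exact: cintegrable_weight.
Qed.

(** Conjugating the result for the conjugate of f amounts to conjugating the kernel alone, so the
    difference has kernel K - conjc K = 2i Im K. *)
Lemma kint_conjB z f k x : 0 <= complex.Im z -> L2 f ->
  kint (KB conds d_c Mc z) f k x - conjc (kint (KB conds d_c Mc z) (gconj f) k x) =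
  2%:R * 'i%C * kint (ImKB z) f k x.
Proof.
move=> Iz Lf; rewrite /kint conjc_sum -sumrB mulr_sumr; apply: eq_bigr => k' _.
have mo := measurable_edge_oo (G := G) k'.
have i1 := cintegrable_KB k x k' Iz Lf.
have i2 := cintegrable_KB k x k' Iz (L2_conj Lf).
rewrite !cintE -(cintegJ mo i2) -(cintegB mo i1 (cintegrableJ mo i2)).
have e y : KB conds d_c Mc z k x k' y * f (inl k') y -
    conjc (KB conds d_c Mc z k x k' y * gconj f (inl k') y) =
    2%:R * 'i%C * (ImKB z k x k' y * f (inl k') y).
  by rewrite conjcM /gconj conjc_idem -mulrBl subcJ /ImKB; ring.
have i3 := cintegrableB mo i1 (cintegrableJ mo i2).
rewrite (eq_cinteg leb (fun y _ => e y)) cintegZ//.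
have ii : (2%:R * 'i%C) != 0 :> R[i].
  by rewrite mulf_neq0 ?pnatr_eq0// eq_complex /= eqxx oner_eq0.
have := cintegrableZ mo (2%:R * 'i%C)^-1 i3.
apply: eq_cintegrable => // y _; rewrite e.
by rewrite [LHS]mulrA mulVf// mul1r.
Qed.

Lemma poisson_resolvent (l eps t : R) : 0 < eps ->
  (poisson eps (l - t))%:C = (- (2%:R * 'i%C * pi%:C)^-1) *
    (- ((conjc (l +i* eps) - t%:C)^-1) + (l +i* eps - t%:C)^-1) :> R[i].
Proof.
move=> e0.
have d0 : (l - t) ^+ 2 + eps ^+ 2 != 0.
  by rewrite gt_eqF// ltr_wpDl ?sqr_ge0// exprn_gt0.
set w : R[i] := l +i* eps - t%:C.
have wE : w = (l - t) +i* eps by apply: complex_ext => /=; rewrite ?subr0.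
have wJ : conjc (l +i* eps) - t%:C = conjc w.
  by apply: complex_ext => /=; rewrite ?subr0 ?oppr0 ?addr0//.
have w0 : w != 0 by rewrite wE eq_complex /= negb_and (gt_eqF e0) orbT.
have cw0 : conjc w != 0 by rewrite wE eq_complex /= negb_and oppr_eq0 (gt_eqF e0) orbT.
have ii : (2%:R * 'i%C) != 0 :> R[i].
  by rewrite mulf_neq0 ?pnatr_eq0// eq_complex /= eqxx oner_eq0.
have pp : (pi : R)%:C != 0 :> R[i] by rewrite eq_complex /= eqxx andbT gt_eqF// pi_gt0.
rewrite wJ.
have -> : - (conjc w)^-1 + w^-1 = - ((w - conjc w) / (w * conjc w)).
  by field; rewrite w0 cw0.
rewrite subcJ mulcJ mulrNN wE /=.
have sE : sqmod ((l - t) +i* eps : R[i]) = (l - t) ^+ 2 + eps ^+ 2 by [].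
have pE : poisson eps (l - t) = eps / ((l - t) ^+ 2 + eps ^+ 2) / pi.
  rewrite /poisson; have -> : 1 + ((l - t) / eps) ^+ 2 = ((l - t) ^+ 2 + eps ^+ 2) / eps ^+ 2.
    by field; rewrite gt_eqF.
  by congr (_ / _); field; rewrite (gt_eqF e0) andbT.
have i0 : 'i%C != 0 :> R[i] by rewrite eq_complex /= eqxx oner_eq0.
have D0 : ((l - t) ^+ 2 + eps ^+ 2)%:C != 0 :> R[i] by rewrite eq_complex /= eqxx andbT.
rewrite sE pE !realCM !realCV; move: D0 i0 pp; move: (_%:C) (_%:C) ('i%C) (_%:C) => D p ci e D0 i0 pp.
by field; rewrite D0 i0 pp.
Qed.

(** Difference of the resolvents at l + i eps and at l - i eps: on the spectral side it is a
    multiple of the Poisson kernel, on the kernel side a multiple of Im K_B. The identity is exact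
    for each eps. *)
Lemma Im_resolvent_sp_form z (l eps : R) f g : 0 < complex.Im z -> z ^+ 2 = l +i* eps ->
  0 < eps -> Y_B f -> L2 g ->
  L2 (kint (ImKB z) f) /\
  sp_form E (fun t => (poisson eps (l - t))%:C) f g =
  - ((pi : R)^-1)%:C * inner (kint (ImKB z) f) g.
Proof.
move=> z0 zE e0 Yf Lg; have Lf : L2 f by case: Yf.
have z20 : complex.Im (z ^+ 2) != 0 by rewrite zE /= gt_eqF.
have [LU HU] := kint_Hop z0 z20 Yf.
have [LV' HV'] := kint_Hop z0 z20 (Y_B_conj Yf).
set U := kint _ f in LU HU; set V' := kint _ _ in LV' HV'.
have LV := L2_conj LV'.
(* H commutes with conjugation, so the conjugate of V' solves the resolvent equation at the
   conjugate spectral parameter with data f. *)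
have HV : Hop (gconj V') (fun k x => conjc (z ^+ 2) * gconj V' k x - f k x).
  have := Hop_conj HV'; congr Hop; apply/funext => k; apply/funext => x.
  by rewrite /gconj conjcD conjcM conjcN conjc_idem.
have ii : (2%:R * 'i%C) != 0 :> R[i].
  by rewrite mulf_neq0 ?pnatr_eq0// eq_complex /= eqxx oner_eq0.
have TE : kint (ImKB z) f = gcomb ((2%:R * 'i%C)^-1) (gcomb (-1) (gconj V') U) (@gzero R G).
  apply/funext => k; apply/funext => x; rewrite /gcomb /gzero addr0 mulN1r addrC.
  by rewrite /gconj (kint_conjB k x (ltW z0) Lf) mulrA mulVf// mul1r.
split; first by rewrite TE; apply: L2_gcomb; [exact: L2_gcomb|exact: L2_zero].
have z20J : complex.Im (conjc (z ^+ 2)) != 0 by rewrite cImJ oppr_eq0.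
rewrite TE innerZl//; last exact: L2_gcomb.
rewrite innerDl// (resolvent_sp_form hE z20 LU Lf Lg HU) (resolvent_sp_form hE z20J LV Lf Lg HV).
have b1 := bborel_resolvent z20; have b2 := bborel_resolvent z20J.
rewrite -(sp_formZ _ (-1))// -sp_formD//; last exact: bborelZ.
rewrite mulrA -sp_formZ//; last by apply: bborelD => //; exact: bborelZ.
apply: eq_sp_form => t; rewrite poisson_resolvent// zE mulN1r; congr (_ * _).
by rewrite mulNr realCV [in LHS]invfM [in LHS]mulrC.
Qed.

End Kernel.

(** * Lipschitz bounds for the kernel *)

Section BoundedLipschitz.
Context {R : realType} {T : Type}.
Variables (P : set T) (S : set R[i]).
Implicit Types (F : T -> R[i] -> R[i]).

(* Bounded and Lipschitz in [z], uniformly in the parameter [p]. *)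
Definition blip F := exists2 M : R, 0 <= M & forall p, P p ->
  (forall z, S z -> n1 (F p z) <= M) /\
  (forall z w, S z -> S w -> n1 (F p z - F p w) <= M * n1 (z - w)).

Lemma eq_blip F F' : (forall p z, P p -> S z -> F p z = F' p z) -> blip F -> blip F'.
Proof.
move=> e [M M0 h]; exists M => // p Pp; have [h1 h2] := h p Pp; split.
- by move=> z Sz; rewrite -e// h1.
- by move=> z w Sz Sw; rewrite -!e// h2.
Qed.

Lemma blip_cst (c : T -> R[i]) (C : R) : (forall p, P p -> n1 (c p) <= C) -> blip (fun p _ => c p).
Proof.
move=> h; exists (Num.max C 0); first by rewrite le_max lexx orbT.
move=> p Pp; split; first by move=> z _; rewrite le_max h.
by move=> z w _ _; rewrite subrr n10 mulr_ge0 ?n1_ge0// le_max lexx orbT.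
Qed.

Lemma blip_const (c : R[i]) : blip (fun _ _ => c).
Proof. by apply: (@blip_cst (fun=> c) (n1 c)). Qed.

Lemma blip_id (C : R) : (forall z, S z -> n1 z <= C) -> blip (fun _ z => z).
Proof.
move=> h; exists (Num.max C 1); first by rewrite le_max ler01 orbT.
move=> p _; split; first by move=> z Sz; rewrite le_max h.
by move=> z w _ _; rewrite ler_peMl ?n1_ge0// le_max lexx orbT.
Qed.

Lemma blipD F G : blip F -> blip G -> blip (fun p z => F p z + G p z).
Proof.
move=> [M M0 hM] [N N0 hN]; exists (M + N); first exact: addr_ge0.
move=> p Pp; have [a1 a2] := hM p Pp; have [b1 b2] := hN p Pp; split.
  by move=> z Sz; rewrite (le_trans (n1D _ _))// lerD// ?a1 ?b1.
move=> z w Sz Sw; rewrite opprD addrACA mulrDl (le_trans (n1D _ _))// lerD//; [exact: a2|exact: b2].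
Qed.

Lemma blipM F G : blip F -> blip G -> blip (fun p z => F p z * G p z).
Proof.
move=> [M M0 hM] [N N0 hN]; exists (2 * (M * N)); first by rewrite !mulr_ge0.
have MN0 : 0 <= M * N by exact: mulr_ge0.
move=> p Pp; have [a1 a2] := hM p Pp; have [b1 b2] := hN p Pp; split.
  move=> z Sz; rewrite (le_trans (n1M _ _))// (@le_trans _ _ (M * N))//; last lra.
  by rewrite ler_pM ?n1_ge0 ?a1 ?b1.
move=> z w Sz Sw.
have -> : F p z * G p z - F p w * G p w = F p z * (G p z - G p w) + (F p z - F p w) * G p w by ring.
rewrite (le_trans (n1D _ _))// (_ : 2 * (M * N) * n1 (z - w) = M * (N * n1 (z - w)) + (M * n1 (z - w)) * N); last by ring.
rewrite lerD//; apply: le_trans (n1M _ _) _; apply: ler_pM; rewrite ?n1_ge0//.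
- exact: a1.
- exact: b2.
- exact: a2.
- exact: b1.
Qed.

Lemma blip_sum (I : Type) (s : seq I) (Q : pred I) (F : I -> T -> R[i] -> R[i]) :
  (forall i, Q i -> blip (F i)) -> blip (fun p z => \sum_(i <- s | Q i) F i p z).
Proof.
move=> h; elim: s => [|i s ih].
  by apply: eq_blip (blip_const 0) => p z _ _; rewrite big_nil.
have [Qi|Qi] := boolP (Q i).
- by apply: eq_blip (blipD (h i Qi) ih) => p z _ _; rewrite big_cons Qi.
- by apply: eq_blip ih => p z _ _; rewrite big_cons (negbTE Qi).
Qed.

Lemma blip_prod (I : Type) (s : seq I) (F : I -> T -> R[i] -> R[i]) :
  (forall i, blip (F i)) -> blip (fun p z => \prod_(i <- s) F i p z).
Proof.
move=> h; elim: s => [|i s ih].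
  by apply: eq_blip (blip_const 1) => p z _ _; rewrite big_nil.
by apply: eq_blip (blipM (h i) ih) => p z _ _; rewrite big_cons.
Qed.

Lemma blipX F n : blip F -> blip (fun p z => F p z ^+ n).
Proof.
move=> h; elim: n => [|n ih]; first exact: blip_const.
by apply: eq_blip (blipM h ih) => p z _ _; rewrite exprS.
Qed.

Lemma n1_gt0_neq0 (u : R[i]) (d : R) : 0 < d -> d <= n1 u -> u != 0.
Proof. by move=> d0 du; apply/eqP => u0; move: du; rewrite u0 n10 leNgt d0. Qed.

Lemma blipV F (d : R) : 0 < d -> (forall p z, P p -> S z -> d <= n1 (F p z)) ->
  blip F -> blip (fun p z => (F p z)^-1).
Proof.
move=> d0 hd [M M0 hM].
have iv p z : P p -> S z -> n1 (F p z)^-1 <= 2 / d.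
  move=> Pp Sz; rewrite (le_trans (n1V _))// ler_pM2l// lef_pV2 ?posrE ?hd//.
  by rewrite (lt_le_trans d0)// hd.
have e0 : 0 <= 2 / d by rewrite divr_ge0// ltW.
have ee0 : 0 <= 2 / d * (2 / d) * M by rewrite mulr_ge0// mulr_ge0.
exists (2 / d + 2 / d * (2 / d) * M); first exact: addr_ge0.
move=> p Pp; have [a1 a2] := hM p Pp; split.
  by move=> z Sz; rewrite (le_trans (iv _ _ Pp Sz))// lerDl.
move=> z w Sz Sw.
have z0 := n1_gt0_neq0 d0 (hd p z Pp Sz); have w0 := n1_gt0_neq0 d0 (hd p w Pp Sw).
have -> : (F p z)^-1 - (F p w)^-1 = (F p z)^-1 * (F p w)^-1 * - (F p z - F p w).
  by field; rewrite z0 w0.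
rewrite (le_trans (n1M _ _))// n1N.
rewrite (@le_trans _ _ (2 / d * (2 / d) * (M * n1 (z - w))))//.
  apply: ler_pM; rewrite ?n1_ge0//; last exact: a2.
  by apply: le_trans (n1M _ _) _; apply: ler_pM; rewrite ?n1_ge0//; exact: iv.
by rewrite [leLHS]mulrA ler_wpM2r ?n1_ge0// lerDr.
Qed.

(** The difference is the integral over [0, 1] of the derivative of [cexp] along the segment from w
    to u, on which the real part stays at most M. *)
Lemma n1_cexpB (u w : R[i]) (M : R) : n1 u <= M -> n1 w <= M ->
  n1 (cexp u - cexp w) <= 2 * expR M * n1 (u - w).
Proof.
move=> uM wM.
have := cint_cexp (u - w) w (@ler01 R).
rewrite mulr1 mulr0 add0r subrK => <-.
have cm : cmfR `[0, 1] (fun s : R => (u - w) * cexp ((u - w) * s%:C + w)).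
  apply: cmfM; [exact: cmf_cst|apply: cmf_cexp; apply: cmfD; [|exact: cmf_cst]].
  by apply: cmfM; [exact: cmf_cst|apply: cmf_real; exact: measurable_id].
have mI := measurable_segment (0 : R) 1.
have l1 : leb (`[0, 1]%classic : set (measurableTypeR R)) = 1%E.
  by rewrite leb_segment// subr0.
have e : \int[leb]_(x in `[0, 1]) (2 * expR M * n1 (u - w)) = 2 * expR M * n1 (u - w).
  by rewrite Rintegral_cst// [X in fine X]l1 /= mulr1.
rewrite cintE -[leRHS]e; apply: n1_cinteg_le => //.
  apply: (proj1 (@cintegrable_segment _ (fun=> (2 * expR M * n1 (u - w))%:C) _ 0 1 _ (fun _ _ => lexx _))).
  exact: cmf_cst.
move=> x /=; rewrite in_itv/= => /andP[x0 x1].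
rewrite (le_trans (n1M _ _))// mulrC ler_wpM2r ?n1_ge0//.
rewrite (le_trans (n1_cexp _))// ler_pM2l// ler_expR Re_affine cReD cReN.
have ha := le_trans (ler_norm _) (le_trans (n1_Re u) uM).
have hb := le_trans (ler_norm _) (le_trans (n1_Re w) wM).
have h1 : x * complex.Re u <= x * M by rewrite ler_wpM2l.
have h2 : (1 - x) * complex.Re w <= (1 - x) * M by rewrite ler_wpM2l// subr_ge0.
have -> : (complex.Re u - complex.Re w) * x + complex.Re w = x * complex.Re u + (1 - x) * complex.Re w by ring.
have -> : M = x * M + (1 - x) * M by ring.
exact: lerD.
Qed.

Lemma blip_cexp F : blip F -> blip (fun p z => cexp (F p z)).
Proof.
move=> [M M0 hM]; exists (2 * expR M * (1 + M)).
  by rewrite !mulr_ge0 ?expR_ge0// addr_ge0.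
have e0 : 0 <= 2 * expR M by rewrite mulr_ge0 ?expR_ge0.
move=> p Pp; have [a1 a2] := hM p Pp; split.
  move=> z Sz; rewrite (le_trans (n1_cexp _))// (@le_trans _ _ (2 * expR M))//.
    by rewrite ler_pM2l// ler_expR (le_trans (ler_norm _))// (le_trans (n1_Re _))// a1.
  by rewrite ler_peMr// lerDl.
move=> z w Sz Sw; rewrite (le_trans (n1_cexpB (a1 z Sz) (a1 w Sw)))//.
rewrite -[leRHS]mulrA ler_wpM2l// (le_trans (a2 z w Sz Sw))// ler_wpM2r ?n1_ge0//.
by rewrite lerDr.
Qed.

End BoundedLipschitz.

(** The root is s + iy with s^2 = (l + |l + i eps|) / 2 and y = eps / (2 s). The last bound comes
    from s - sqrt l = y^2 / (s + sqrt l). All constants depend on a alone, so that z is within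
    O(eps) of sqrt l uniformly for l >= a. *)
Lemma sqrt_perturb {R : realType} (a l eps : R) : 0 < a -> a <= l -> 0 < eps ->
  exists z : R[i], [/\ z ^+ 2 = l +i* eps, 0 < complex.Im z,
    complex.Im z <= eps / (2 * Num.sqrt a),
    Num.sqrt l <= complex.Re z & complex.Re z <= Num.sqrt l + complex.Im z ^+ 2 / Num.sqrt a].
Proof.
move=> a0 al e0; have l0 : 0 < l := lt_le_trans a0 al.
have sa0 : 0 < Num.sqrt a by rewrite sqrtr_gt0.
have sl0 : 0 < Num.sqrt l by rewrite sqrtr_gt0.
have sal : Num.sqrt a <= Num.sqrt l by rewrite ler_sqrt// ltW.
pose t := Num.sqrt (l ^+ 2 + eps ^+ 2).
have t2 : t ^+ 2 = l ^+ 2 + eps ^+ 2 by rewrite sqr_sqrtr// addr_ge0// sqr_ge0.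
have lt : l < t.
  rewrite -(@ltr_pXn2r _ 2)// ?nnegrE ?sqrtr_ge0 ?(ltW l0)// t2 ltrDl exprn_gt0//.
pose s := Num.sqrt ((l + t) / 2); pose y := eps / (2 * s).
have lt0 : 0 < (l + t) / 2 by rewrite divr_gt0// addr_gt0// (lt_trans l0).
have s0 : 0 < s by rewrite sqrtr_gt0.
have s2 : s ^+ 2 = (l + t) / 2 by rewrite sqr_sqrtr// ltW.
have sls : Num.sqrt l <= s by rewrite ler_sqrt ?(ltW lt0)//; lra.
have y0 : 0 < y by rewrite divr_gt0// mulr_gt0.
have y2 : s ^+ 2 - y ^+ 2 = l.
  have : 4 * (s ^+ 2) * (s ^+ 2 - y ^+ 2) = 4 * (s ^+ 2) * l.
    have -> : 4 * (s ^+ 2) * (s ^+ 2 - y ^+ 2) = 4 * (s ^+ 2) ^+ 2 - eps ^+ 2.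
      by rewrite /y; field; rewrite gt_eqF.
    rewrite s2; have -> : eps ^+ 2 = t ^+ 2 - l ^+ 2 by rewrite t2; ring.
    by field.
  by apply: mulfI; rewrite mulf_neq0// gt_eqF// exprn_gt0.
exists (s +i* y); split => //=.
- apply: complex_ext => /=; rewrite ?cReM ?cImM /=; first by rewrite -y2; ring.
  by rewrite /y; field; rewrite gt_eqF.
- rewrite /y ler_pM2l// lef_pV2 ?posrE ?mulr_gt0// ler_pM2l//.
  exact: le_trans sal sls.
- have e : s - Num.sqrt l = y ^+ 2 / (s + Num.sqrt l).
    have -> : y ^+ 2 = s ^+ 2 - Num.sqrt l ^+ 2 by rewrite sqr_sqrtr ?(ltW l0)// -[in RHS]y2; ring.
    by field; rewrite gt_eqF// addr_gt0.
  rewrite -lerBlDl e ler_wpM2l ?sqr_ge0// lef_pV2 ?posrE ?addr_gt0//.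
  by rewrite (le_trans sal)// lerDr ltW.
Qed.

Lemma norm_Re_Im_le {R : realType} (x : R[i]) (e : R) : `|x| < e%:C ->
  `|complex.Re x| < e /\ `|complex.Im x| < e.
Proof.
rewrite normc_def ltcR => h; split; apply: le_lt_trans h; rewrite -sqrtr_sqr ler_wsqrtr//.
  by rewrite lerDl sqr_ge0.
by rewrite lerDr sqr_ge0.
Qed.

Lemma entire_ccontinuous {R : realType} (h : R[i] -> R[i]) : entire h ->
  ccontinuous (fun l : R => h l%:C).
Proof.
move=> hh.
have key (t e : R) : 0 < e -> \forall s \near t, `|h t%:C - h s%:C| < e%:C.
  move=> e0.
  have hc : {for (t%:C : R[i]^o), continuous (h : R[i]^o -> R[i]^o)}.
    apply: differentiable_continuous; apply/derivable1_diffP; exact: hh.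
  have e0C : 0 < e%:C :> R[i] by rewrite ltcR.
  have /cvgrPdist_lt /(_ _ e0C) := hc.
  move=> /nbhs_ballP [d /= d0 hd].
  (* Positivity in [R[i]] forces the imaginary part to vanish, so the radius d is a real number. *)
  have : 0 < d by [].
  rewrite ltcE /= => /andP[/eqP Id Rd].
  near=> s; apply: hd; rewrite -ball_normE /= -realCB.
  have -> : d = (complex.Re d)%:C by apply: complex_ext => //=; rewrite -Id.
  rewrite normc_def /= expr0n /= addr0 sqrtr_sqr ltcR.
  by near: s; exact: (@cvgr_dist_lt _ _ _ _ _ id t cvg_id).
split=> t; apply/cvgrPdist_lt => e e0; near=> s.
- rewrite -cReN -cReD; apply: (norm_Re_Im_le _).1; near: s; exact: key.
- rewrite -cImN -cImD; apply: (norm_Re_Im_le _).2; near: s; exact: key.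
Unshelve. all: by end_near. Qed.

(** * Exponential polynomials on rectangles above the real axis *)

Section Bounds.
Context {R : realType} (G : metric_graph R).

Definition strip (s0 s1 y1 : R) : set R[i] :=
  [set z | [/\ s0 <= complex.Re z <= s1 & 0 <= complex.Im z <= y1]].

Lemma strip_bounded s0 s1 y1 z : 0 < s0 -> strip s0 s1 y1 z -> n1 z <= s1 + y1.
Proof.
move=> h0 [/andP[a b] /andP[c d]]; rewrite /n1 !ger0_norm//; first exact: lerD.
by rewrite (le_trans (ltW h0)).
Qed.

Lemma blip_exp_polynomial {T : Type} (P : set T) (S D : set R[i]) (C : R) (p : R[i] -> R[i]) :
  exp_polynomial G D p -> S `<=` D -> (forall z, S z -> n1 z <= C) ->
  blip P S (fun _ z => p z).
Proof.
move=> [rp [rm [Q [rp0 rm0 h]]]] SD SC.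
have hid := blip_id P SC.
apply: (eq_blip (F := fun _ z => \sum_(m <- mpoly.msupp Q) mpoly.mcoeff m Q *
   \prod_i (let: (j, b) := (enum_val i : IB G * bool) in
        if b then cexp ('i%C * (ratr (rp j) * len j)%:C * z)
        else cexp (- 'i%C * (ratr (rm j) * len j)%:C * z)) ^+ mpoly.fun_of_multinom m i)).
  move=> _ z _ Sz; rewrite h ?mpoly.mevalE; last exact: SD.
  apply: eq_bigr => m _; congr (_ * _); apply: eq_bigr => i _; congr (_ ^+ _).
  by case: (enum_val i : IB G * bool) => j [] /=; rewrite mulrAC.
apply: blip_sum => m _; apply: blipM; first exact: blip_const.
apply: blip_prod => i; apply: blipX.
case: (enum_val i : IB G * bool) => j [] /=; apply: blip_cexp; apply: blipM => //; exact: blip_const.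
Qed.

Lemma cmf_exp_polynomial (D : set R[i]) (p : R[i] -> R[i]) {d} {T : measurableType d}
  (A : set T) (s : T -> R) : exp_polynomial G D p -> (forall t, A t -> D (s t)%:C) ->
  measurable_fun A s -> cmf A (fun t => p (s t)%:C).
Proof.
move=> [rp [rm [Q [rp0 rm0 h]]]] SD ms.
apply: (eq_cmf (f := fun t => \sum_(m <- mpoly.msupp Q) mpoly.mcoeff m Q *
   \prod_i (let: (j, b) := (enum_val i : IB G * bool) in
        if b then cexp ('i%C * (s t)%:C * (ratr (rp j) * len j)%:C)
        else cexp (- 'i%C * (s t)%:C * (ratr (rm j) * len j)%:C)) ^+ mpoly.fun_of_multinom m i)).
  by move=> t; rewrite inE => At; rewrite h ?mpoly.mevalE//; exact: SD.
apply: cmf_sum => m _; apply: cmfM; first exact: cmf_cst.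
pose F i t := (let: (j, b) := (enum_val i : IB G * bool) in
        if b then cexp ('i%C * (s t)%:C * (ratr (rp j) * len j)%:C)
        else cexp (- 'i%C * (s t)%:C * (ratr (rm j) * len j)%:C)) ^+ mpoly.fun_of_multinom m i.
have mF i : cmf A (F i).
  rewrite /F; elim: (mpoly.fun_of_multinom m i) => [|n ih].
    by apply: (eq_cmf (f := fun=> 1)); [move=> t _; rewrite expr0|exact: cmf_cst].
  apply: (eq_cmf (f := fun t => (let: (j, b) := (enum_val i : IB G * bool) in
        if b then cexp ('i%C * (s t)%:C * (ratr (rp j) * len j)%:C)
        else cexp (- 'i%C * (s t)%:C * (ratr (rm j) * len j)%:C)) *
    (let: (j, b) := (enum_val i : IB G * bool) in
        if b then cexp ('i%C * (s t)%:C * (ratr (rp j) * len j)%:C)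
        else cexp (- 'i%C * (s t)%:C * (ratr (rm j) * len j)%:C)) ^+ n)).
    by move=> t _; rewrite exprS.
  apply: cmfM => //.
  case: (enum_val i : IB G * bool) => j [] /=; apply: cmf_cexp; apply: cmfM; try exact: cmf_cst;
    by apply: cmfM; [exact: cmf_cst|exact: cmf_real].
apply: (eq_cmf (f := fun t => \prod_(i <- index_enum _) F i t)) => [//|].
elim: (index_enum _) => [|i l ih].
  by apply: (eq_cmf (f := fun=> 1)); [move=> t _; rewrite big_nil|exact: cmf_cst].
by apply: (eq_cmf (f := fun t => F i t * \prod_(i <- l) F i t));
  [move=> t _; rewrite big_cons|exact: cmfM].
Qed.

End Bounds.

(** * The kernel near the positive real axis *)

Section KernelBounds.
Context {R : realType} (G : metric_graph R).
Variable conds : 'I_(N G) -> vcond G.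
Variables (d_d d_c : R[i] -> R[i]) (Mp Mc : R[i] -> 'M[R[i]]_(N G)).

Lemma cmf_KB {d} {T : measurableType d} (A : set T) (s : T -> R[i]) (x y : T -> R) k (k' : IB G) :
  cmf A s -> cmf A (fun t => d_c (s t)) -> (forall i j, cmf A (fun t => Mc (s t) i j)) ->
  measurable_fun A x -> measurable_fun A y ->
  cmf A (fun t => KB conds d_c Mc (s t) k (x t) k' (y t)).
Proof.
move=> ms md mM mx my; rewrite /KB.
have mi : cmf A (fun t => 'i%C * s t) by apply: cmfM => //; exact: cmf_cst.
have mX : cmf A (fun t => (x t)%:C) by exact: cmf_real.
have mY : cmf A (fun t => (y t)%:C) by exact: cmf_real.
apply: cmfM; first by apply: cmfV; apply: cmfM => //; exact: cmf_cst.
apply: cmfD.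
  case: (k == inl k'); last exact: cmf_cst.
  apply: cmf_cexp; apply: cmfM => //; apply: cmf_real.
  by apply: measurableT_comp => //; exact: measurable_funB.
apply: cmfM; first exact: cmfV.
apply: cmf_sum => j _; apply: cmf_sum => b _; apply: cmfM; first apply: cmfM.
- rewrite /Defs.basis; apply: cmf_cexp; apply: cmfM => //; apply: cmfM => //; exact: cmf_cst.
- apply: (eq_cmf (f := fun t => \sum_l Mc (s t) (enum_rank j) l * Rmat conds l (enum_rank (inl (k', b) : slot G)))).
    by move=> t _; rewrite !mxE.
  by apply: cmf_sum => l _; apply: cmfM => //; exact: cmf_cst.
- case: b => /=; apply: cmf_cexp; apply: cmfM => //; apply: cmf_real.
  by apply: measurable_funB => //; exact: measurable_cst.
Qed.

Hypothesis hA1 : assumption_A1 conds d_d d_c Mp Mc.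

(** On the compact segment [s0, s1] the function d_c has no zero, so its norm has a positive minimum
    m; a Lipschitz bound on the rectangle of height 1 transports m / 2 to a thinner rectangle. *)
Lemma dc_lower (s0 s1 : R) : 0 < s0 -> s0 <= s1 -> exists y1 : R, exists2 delta : R,
  0 < y1 <= 1 /\ 0 < delta & forall z, strip s0 s1 y1 z -> delta <= n1 (d_c z).
Proof.
move=> s00 s01.
have [M M0 hM] := blip_exp_polynomial [set: unit] (A1_exp hA1).2 (@subsetT _ (strip s0 s1 1))
  (fun z => @strip_bounded _ s0 s1 1 z s00).
have [_ lip] := hM tt I.
have [c1 c2] := entire_ccontinuous (A1_entire hA1).2.
have cn : continuous (fun s : R => n1 (d_c s%:C)).
  by move=> t; apply: cvgD; apply: cvg_norm; [exact: c1|exact: c2].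
have [c _ hc] := EVT_min s01 (continuous_subspaceT cn).
set m := n1 _ in hc.
have m0 : 0 < m.
  by rewrite lt_def n1_ge0 andbT; apply/eqP => /n1_eq0 h; have := A1_dc_neq0 hA1 c; rewrite h eqxx.
have M1 : 0 < M + 1 by rewrite ltr_wpDl.
(* Within this height the Lipschitz constant M lets d_c change by at most m / 2; [M + 1] avoids
   division by zero. *)
exists (Num.min 1 (m / (2 * (M + 1)))), (m / 2).
  by rewrite ge_min lexx lt_min ltr01 /= !divr_gt0// mulr_gt0.
move=> z [zr /andP[z0]]; rewrite le_min => /andP[z1 z2].
have S1 : strip s0 s1 1 z by split => //; rewrite z0.
have S2 : strip s0 s1 1 (complex.Re z)%:C by split => //=; rewrite lexx ler01.
have e : n1 ((complex.Re z)%:C - z) = complex.Im z.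
  by rewrite /n1 cReD cImD cReN cImN /= subrr normr0 !add0r normrN ger0_norm.
have h1 := lip _ _ S2 S1; rewrite e in h1.
have h2 : m <= n1 (d_c (complex.Re z)%:C) by apply: hc; rewrite in_itv.
have h3 : n1 (d_c (complex.Re z)%:C) <= n1 (d_c (complex.Re z)%:C - d_c z) + n1 (d_c z).
  by rewrite -{1}[d_c (complex.Re z)%:C](subrK (d_c z)) n1D.
have h4 : M * complex.Im z <= m / 2.
  rewrite (@le_trans _ _ ((M + 1) * complex.Im z))//.
    by rewrite ler_wpM2r// lerDl.
  by move: z2; rewrite ler_pdivlMr ?mulr_gt0// => h; lra.
lra.
Qed.

(** Apart from two inverses, the kernel is made of exponentials of bounded arguments and of
    exponential polynomials. The inverses are controlled by Re z >= s0 and by the lower bound delta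
    on d_c. *)
Lemma blip_KB (s0 s1 y1 delta X : R) k (k' : IB G) : 0 < s0 -> 0 < delta ->
  (forall z, strip s0 s1 y1 z -> delta <= n1 (d_c z)) ->
  blip [set p : R * R | 0 <= p.1 <= X /\ 0 <= p.2 <= len k'] (strip s0 s1 y1)
    (fun p z => KB conds d_c Mc z k p.1 k' p.2).
Proof.
move=> s00 d0 hd; set P := [set p | _]; set S := strip _ _ _.
have SC z : S z -> n1 z <= s1 + y1 by exact: strip_bounded.
have Sn : S `<=` upper_or_real_nz.
  move=> z [/andP[a b] /andP[c d]]; split => //; apply/eqP => z0.
  by move: a; rewrite z0 /= leNgt s00.
have hid := blip_id P SC.
have hdc := blip_exp_polynomial P (A1_exp hA1).2 (@subsetT _ S) SC.
have hMc i j := blip_exp_polynomial P (A1_exp_mx hA1 i j).2 Sn SC.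
have hX : blip P S (fun p _ => p.1%:C).
  apply: (@blip_cst _ _ _ _ _ X) => p [/andP[a b] _].
  by rewrite n1_real ger0_norm.
have hY : blip P S (fun p _ => p.2%:C).
  apply: (@blip_cst _ _ _ _ _ (len k')) => p [_ /andP[a b]].
  by rewrite n1_real ger0_norm.
have hXY : blip P S (fun p _ => `|p.1 - p.2|%:C).
  apply: (@blip_cst _ _ _ _ _ (X + len k')) => p [/andP[a b] /andP[c d]].
  by rewrite n1_real normr_id (le_trans (ler_normB _ _))// !ger0_norm// lerD.
have hlY : blip P S (fun p _ => (len k' - p.2)%:C).
  apply: (eq_blip (F := fun p _ => (len k')%:C + (-1) * p.2%:C)).
    by move=> p z _ _; rewrite realCB mulN1r.
  by apply: blipD; [exact: blip_const|apply: blipM => //; exact: blip_const].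
have hi : blip P S (fun _ z => 'i%C * z) by apply: blipM => //; exact: blip_const.
rewrite /KB; apply: blipM.
  apply: (@blipV _ _ _ _ _ s0) => //; last by apply: blipM => //; exact: blip_const.
  move=> _ z _ [/andP[a _] /andP[b _]].
  have -> : 2%:R * 'i%C * z = (- 2 * complex.Im z) +i* (2 * complex.Re z).
    by rewrite -realC_nat; apply: complex_ext; rewrite ?cReM ?cImM ?cReM ?cImM /=; ring.
  rewrite /n1 /= (@le_trans _ _ (`|2 * complex.Re z|))//; last by rewrite lerDr.
  by rewrite ger0_norm; lra.
apply: blipD.
  case: (k == inl k'); last exact: blip_const.
  by apply: blip_cexp; exact: blipM.
apply: blipM; first by apply: (blipV d0) => // _ z _; exact: hd.
apply: blip_sum => j _; apply: blip_sum => b _; apply: blipM; first apply: blipM.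
- rewrite /Defs.basis; apply: blip_cexp; apply: blipM => //; apply: blipM => //; exact: blip_const.
- apply: (eq_blip (F := fun _ z => \sum_l Mc z (enum_rank j) l * Rmat conds l (enum_rank (inl (k', b) : slot G)))).
    by move=> _ z _ _; rewrite !mxE.
  by apply: blip_sum => l _; apply: blipM => //; exact: blip_const.
- by case: b => /=; apply: blip_cexp; exact: blipM.
Qed.

Lemma KB_uniform_bounds (s0 s1 X : R) : 0 < s0 -> s0 <= s1 ->
  exists y1 : R, exists2 L : R, 0 < y1 <= 1 /\ 0 <= L &
  forall k (k' : IB G) x y, 0 <= x <= X -> 0 <= y <= len k' ->
    (forall z, strip s0 s1 y1 z -> n1 (KB conds d_c Mc z k x k' y) <= L) /\
    (forall z w, strip s0 s1 y1 z -> strip s0 s1 y1 w ->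
       n1 (KB conds d_c Mc z k x k' y - KB conds d_c Mc w k x k' y) <= L * n1 (z - w)).
Proof.
move=> s00 s01; have [y1 [del [y10 del0] hdel]] := dc_lower s00 s01.
have hb (q : edge G * IB G) := @blip_KB s0 s1 y1 del X q.1 q.2 s00 del0 hdel.
have hb' (q : edge G * IB G) : exists M : R, 0 <= M /\ forall x y, 0 <= x <= X -> 0 <= y <= len q.2 ->
    (forall z, strip s0 s1 y1 z -> n1 (KB conds d_c Mc z q.1 x q.2 y) <= M) /\
    (forall z w, strip s0 s1 y1 z -> strip s0 s1 y1 w ->
       n1 (KB conds d_c Mc z q.1 x q.2 y - KB conds d_c Mc w q.1 x q.2 y) <= M * n1 (z - w)).
  have [M M0 h] := hb q; exists M; split => // x y hx hy.
  by have := h (x, y) (conj hx hy).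
have [M hM] := choice hb'.
have M0 q : 0 <= M q by case: (hM q).
exists y1, (\sum_q M q); first by split => //; exact: sumr_ge0.
have le q : M q <= \sum_q M q by rewrite (bigD1 q)//= lerDl sumr_ge0.
move=> k k' x y hx hy; have [_ /(_ x y hx hy)[h1 h2]] := hM (k, k'); split.
  by move=> z Sz; rewrite (le_trans (h1 z Sz)).
by move=> z w Sz Sw; rewrite (le_trans (h2 z w Sz Sw))// ler_wpM2r ?n1_ge0.
Qed.

End KernelBounds.

(** * The spectral density *)

Lemma cmf_set0 {R : realType} {d} {T : measurableType d} (f : T -> R[i]) : cmf set0 f.
Proof. by split; exact: measurable_fun_set0. Qed.

Section Kint.
Context {R : realType} (G : metric_graph R).
Implicit Types (f v : gfun G).

Definition l1B f : R := \sum_(k : IB G) \int[leb]_(y in `]0, len k[) n1 (f (inl k) y).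

Lemma cintegrable_inl f (k : IB G) : L2 f -> cintegrable leb `]0, len k[ (f (inl k)).
Proof.
by move=> Lf; apply: sqint_cintegrable; [exact: measurable_edge_oo|exact: leb_oo_lty|exact: (Lf (inl k))].
Qed.

Lemma l1B_ge0 f : 0 <= l1B f.
Proof. by apply: sumr_ge0 => k _; apply: Rintegral_ge0 => y _; exact: n1_ge0. Qed.

Lemma n1_kint (K : edge G -> R -> IB G -> R -> R[i]) f (L : R) k x : L2 f ->
  (forall k', cmfR `]0, len k'[ (K k x k')) ->
  (forall k' y, 0 <= y <= len k' -> n1 (K k x k' y) <= L) ->
  n1 (kint K f k x) <= L * l1B f.
Proof.
move=> Lf mK KL; rewrite (le_trans (n1_sum _ _ _))// /l1B mulr_sumr ler_sum// => k' _.
have mo := measurable_edge_oo (G := G) k'.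
have i1 := integrable_n1 mo (cintegrable_inl k' Lf).
rewrite -RintegralZl// cintE; apply: n1_cinteg_le => //.
- by apply: cmfM => //; exact: (L2_cmf (inl k') Lf).
- exact: RintegrableZ.
- move=> y /=; rewrite in_itv/= => /andP[y0 yl].
  by rewrite (le_trans (n1M _ _))// ler_wpM2r ?n1_ge0// KL// !ltW.
Qed.

Lemma kintB (K K' : edge G -> R -> IB G -> R -> R[i]) f (L : R) k x : L2 f ->
  (forall k', cmfR `]0, len k'[ (K k x k')) -> (forall k', cmfR `]0, len k'[ (K' k x k')) ->
  (forall k' y, 0 <= y <= len k' -> n1 (K k x k' y) <= L) ->
  (forall k' y, 0 <= y <= len k' -> n1 (K' k x k' y) <= L) ->
  kint K f k x - kint K' f k x = kint (fun k x k' y => K k x k' y - K' k x k' y) f k x.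
Proof.
move=> Lf mK mK' KL KL'; rewrite /kint -sumrB; apply: eq_bigr => k' _.
have mo := measurable_edge_oo (G := G) k'.
have i (K0 : edge G -> R -> IB G -> R -> R[i]) : cmfR `]0, len k'[ (K0 k x k') ->
    (forall y, 0 <= y <= len k' -> n1 (K0 k x k' y) <= L) ->
    cintegrable leb `]0, len k'[ (fun y => K0 k x k' y * f (inl k') y).
  move=> m0 b0; apply: (cintegrableMl mo (M := L)) => //; last exact: cintegrable_inl.
  by move=> y /=; rewrite in_itv/= => /andP[y0 yl]; rewrite b0// !ltW.
rewrite !cintE -(cintegB mo (i K _ _) (i K' _ _))//; [|exact: KL|exact: KL'].
by apply: eq_cinteg => y _; rewrite mulrBl.
Qed.

(** The part of the edge kept by [restr_below]; it has finite measure, as Fubini requires. *)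
Definition edge_below (n : nat) (k : edge G) : set (measurableTypeR R) :=
  edge_dom k `&` `]-oo, n%:R]%classic.

Lemma measurable_edge_below n k : measurable (edge_below n k).
Proof. by apply: measurableI; [exact: measurable_edge_dom|exact: measurable_below]. Qed.

Lemma edge_below_bnd n k x : edge_below n k x -> 0 <= x <= n%:R.
Proof.
move=> [kx]; rewrite /= in_itv/= => ->; rewrite andbT.
by case: k kx => k /=; rewrite in_itv/= => /andP[/ltW].
Qed.

Lemma edge_below_lty n k : (leb (edge_below n k) < +oo)%E.
Proof.
apply: le_lt_trans (leb_segment_lty 0 n%:R); apply: le_measure; rewrite ?inE.
- exact: measurable_edge_below.
- exact: measurable_segment.
- by move=> x /edge_below_bnd; rewrite /= in_itv.
Qed.

Lemma sqint_edge_below n k v : L2 v -> square_integrable (edge_below n k) (v k).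
Proof.
move=> Lv; apply: (sqintS (E := edge_dom k)) => //; last by move=> x [].
exact: measurable_edge_below.
Qed.

Lemma cintegrable_edge_below n k v : L2 v ->
  cintegrable leb (edge_below n k) (fun x => conjc (v k x)).
Proof.
move=> Lv; apply: sqint_cintegrable; first exact: measurable_edge_below.
  exact: edge_below_lty.
by apply: sqint_conj; exact: sqint_edge_below.
Qed.

Definition pairing_below n (w v : gfun G) : R[i] :=
  \sum_(k : edge G) cinteg leb (edge_below n k) (fun x => w k x * conjc (v k x)).

Lemma inner_below n (w v : gfun G) : (forall k, cmfR (edge_dom k) (w k)) -> L2 v ->
  eq_ae v (restr_below n v) -> inner w v = pairing_below n w v.
Proof.
move=> mw Lv ev; apply: eq_bigr => k _; rewrite cintE /edge_below cinteg_setIr.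
have mv := L2_cmf k Lv.
apply: ae_eq_cinteg => //.
- by apply: cmfM => //; exact: cmfJ.
- apply: cmfM; first by apply: cmf_ind; exact: measurable_below.
  by apply: cmfM => //; exact: cmfJ.
- apply: ae_imp (ev k) => x h kx; rewrite {1}h// /restr_below conjcM.
  have -> : conjc (ind (`]-oo, n%:R]%classic : set (measurableTypeR R)) x : R[i]) =
      ind (`]-oo, n%:R]%classic : set (measurableTypeR R)) x.
    by rewrite /ind; apply: complex_ext; rewrite ?cReJ ?cImJ //= oppr0.
  by ring.
Qed.

Lemma compact_support_cut v : compact_support v -> exists n, eq_ae v (restr_below n v).
Proof.
(* [restr_below] truncates the finite edges as well; adding the sum of their lengths puts the cut
   beyond all of them. *)
move=> [M hM]; pose X := `|M| + \sum_(k : IB G) len k.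
have len0 (k : IB G) : 0 <= len k by exact/ltW/len_gt0.
have S0 : 0 <= \sum_(k : IB G) len k by exact: sumr_ge0.
have X0 : 0 <= X by exact: addr_ge0.
exists (Num.truncn X).+1 => k; have Xn : X < (Num.truncn X).+1%:R by exact: truncnS_gt.
have inn x : x < (Num.truncn X).+1%:R -> restr_below (Num.truncn X).+1 v k x = v k x.
  by move=> xn; rewrite /restr_below ind_in ?mul1r// mem_setE in_itv/= ltW.
case: k inn => k inn.
- apply: aeW => x /=; rewrite in_itv/= => /andP[_ xl]; rewrite inn//.
  rewrite (lt_trans xl)// (le_lt_trans _ Xn)// /X (bigD1 k)//=.
  have : 0 <= \sum_(i | i != k) len i by exact: sumr_ge0.
  by have := normr_ge0 M; lra.
- apply: ae_imp (hM k) => x h kx.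
  have [xn|xn] := ltP x (Num.truncn X).+1%:R; first by rewrite inn.
  rewrite /restr_below h ?mulr0// (le_lt_trans _ (lt_le_trans Xn xn))// (le_trans (ler_norm _))//.
  by rewrite lerDl.
Qed.

End Kint.

Lemma cint_oo_cc {R : realType} (p q : R) (u : R -> R[i]) : cintegrable leb `]p, q[ u ->
  cint `]p, q[ u = cint `[p, q] u.
Proof.
have e (w : R -> R) : leb.-integrable (`]p, q[%classic : set (measurableTypeR R)) (EFin \o w) ->
    \int[leb]_(x in `]p, q[) w x = \int[leb]_(x in `[p, q]) w x.
  move=> iw; rewrite Rintegral_itv_bndo_bndc// Rintegral_itv_obnd_cbnd//.
  apply: integrableS (integrable_oo_cc iw) => //.
  by move=> x /=; rewrite !in_itv/= => /andP[/ltW -> ->].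
by move=> [i1 i2]; rewrite /cint !e.
Qed.

Section Density.
Context {R : realType} (G : metric_graph R).
Variable conds : 'I_(N G) -> vcond G.
Hypothesis hconds : lists_vertex_conditions conds.
Variables (d_d d_c : R[i] -> R[i]) (Mp Mc : R[i] -> 'M[R[i]]_(N G)).
Hypothesis hA1 : assumption_A1 conds d_d d_c Mp Mc.
Hypothesis hA3 : assumption_A3 conds Mp.
Variable (E : resolution G).
Hypothesis hE : is_resolution_of E (@Hop R G).
Variables (f : gfun G) (Yf : Y_B f) (a b : R) (a0 : 0 < a) (ab : a < b).

Let Lf : L2 f. Proof. by case: Yf. Qed.
Let K z := ImKB conds d_c Mc z.
Definition im_kint (l : R) : gfun G := kint (K (Num.sqrt l)%:C) f.

Let s0 := Num.sqrt a.
(** The extra term covers the bound Re z <= sqrt l + (Im z)^2 / sqrt a of [sqrt_perturb] when Im z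
    <= 1, so that one rectangle contains both z and sqrt l. *)
Let s1 := Num.sqrt b + (Num.sqrt a)^-1.

Let s00 : 0 < s0. Proof. by rewrite sqrtr_gt0. Qed.

Let sqrt_ab l : a <= l <= b -> s0 <= Num.sqrt l <= Num.sqrt b.
Proof.
move=> /andP[al lb]; have l0 := lt_le_trans a0 al.
by rewrite !ler_sqrt ?al ?lb// ltW// (lt_le_trans l0).
Qed.

Let s01 : s0 <= s1.
Proof.
have /andP[h _] := @sqrt_ab b ltac:(by rewrite lexx (ltW ab)).
by rewrite (le_trans h)// lerDl invr_ge0 ltW.
Qed.

Let sqrt_strip (y1 l : R) : 0 < y1 -> a <= l <= b -> strip s0 s1 y1 (Num.sqrt l)%:C.
Proof.
move=> y10 /sqrt_ab /andP[h1 h2]; split => /=; last by rewrite lexx ltW.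
by rewrite h1 (le_trans h2)// lerDl invr_ge0 ltW.
Qed.

Let ImB z w k x (k' : IB G) y : n1 (K z k x k' y - K w k x k' y) <=
  n1 (KB conds d_c Mc z k x k' y - KB conds d_c Mc w k x k' y).
Proof.
by rewrite /K /ImKB -realCB n1_real -cImN -cImD n1_Im.
Qed.

Let ImB0 z k x (k' : IB G) y : n1 (K z k x k' y) <= n1 (KB conds d_c Mc z k x k' y).
Proof. by rewrite /K /ImKB n1_real n1_Im. Qed.

Let cmf_K z k x (k' : IB G) D : cmfR D (K z k x k').
Proof.
apply: (cmfS (E := setT)) => //; apply: cmf_real; apply: (cmf_KB conds k k' (T := measurableTypeR R) (s := fun=> z) _ _ _ _ _).2.
- exact: cmf_cst.
- exact: cmf_cst.
- by move=> i j; exact: cmf_cst.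
- exact: measurable_cst.
- exact: measurable_id.
Qed.

(** Taking imaginary parts does not increase [n1], and integrating a kernel against f multiplies its
    bound by the L1 norm of f on the bounded part. *)
Lemma kint_bounds (X : R) : exists y1 : R, exists2 L : R, 0 < y1 <= 1 /\ 0 <= L &
  forall k x, 0 <= x <= X ->
    (forall z, strip s0 s1 y1 z -> n1 (kint (K z) f k x) <= L) /\
    (forall z w, strip s0 s1 y1 z -> strip s0 s1 y1 w ->
       n1 (kint (K z) f k x - kint (K w) f k x) <= L * n1 (z - w)).
Proof.
have [y1 [L [y10 L0] h]] := KB_uniform_bounds hA1 X s00 s01.
exists y1, (L * l1B f); first by rewrite mulr_ge0 ?l1B_ge0.
move=> k x hx; split.
  move=> z Sz; apply: n1_kint => // k' y hy.
  by rewrite (le_trans (ImB0 _ _ _ _ _))//; apply: (h k k' x y hx hy).1.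
move=> z w Sz Sw; have bK u : strip s0 s1 y1 u -> forall k' y, 0 <= y <= len k' -> n1 (K u k x k' y) <= L.
  by move=> Su k' y hy; rewrite (le_trans (ImB0 _ _ _ _ _))//; apply: (h k k' x y hx hy).1.
have mK := cmf_K.
rewrite (kintB (L := L))//; [|exact: bK|exact: bK].
rewrite mulrAC; apply: n1_kint => //.
  by move=> k'; apply: cmfB.
by move=> k' y hy; rewrite (le_trans (ImB _ _ _ _ _ _))//; apply: (h k k' x y hx hy).2.
Qed.

(** The space T is arbitrary so that one statement gives joint measurability in l and x, in either
    order, as well as measurability in each variable separately. *)
Lemma cmf_im_kint {d} {T : measurableType d} (A : set T) (l x : T -> R) (n : nat) k :
  measurable A -> measurable_fun A l -> measurable_fun A x ->
  (forall t, A t -> a <= l t <= b /\ 0 <= x t <= n%:R) ->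
  cmf A (fun t => im_kint (l t) k (x t)).
Proof.
move=> mA ml mx hA; have [A0|/set0P [t0 At0]] := eqVneq A set0.
  by rewrite A0; exact: cmf_set0.
have [y1 [L [/andP[y10 _] L0] h]] := KB_uniform_bounds hA1 n%:R s00 s01.
rewrite /im_kint /kint; apply: cmf_sum => k' _.
have mo := measurable_edge_oo (G := G) k'.
have mAB : measurable (A `*` (`]0, len k'[%classic : set (measurableTypeR R))) by exact: measurableX.
pose D : set (T * measurableTypeR R) := A `*` (`]0, len k'[%classic : set (measurableTypeR R)).
have m1 (u : T -> R) : measurable_fun A u -> measurable_fun D (fun p => u p.1).
  move=> mu; apply: (measurable_comp (F := A)) => //.
  - by move=> _ [p [Ap _] <-].
  - exact: measurable_funTS.
have ms : measurable_fun D (fun p => Num.sqrt (l p.1)).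
  by apply: measurableT_comp; [apply: continuous_measurable_fun; exact: sqrt_continuous|exact: m1].
have mk : cmf D (fun p => K (Num.sqrt (l p.1))%:C k (x p.1) k' p.2).
  apply: cmf_real; apply: (cmf_KB conds k k' (s := fun p => (Num.sqrt (l p.1))%:C) _ _ _ _ _).2.
  - exact: cmf_real.
  - apply: (cmf_comp (T' := measurableTypeR R) (f := fun s => d_c s%:C)) => //.
    by apply: ccontinuous_cmf; apply: entire_ccontinuous; exact: (A1_entire hA1).2.
  - move=> i j; apply: (cmf_exp_polynomial (A1_exp_mx hA1 i j).2) => //.
    move=> p [Ap _] /=; have [/sqrt_ab/andP[h1 _] _] := hA _ Ap.
    split => //=; rewrite eq_complex /= eqxx andbT gt_eqF//.
    exact: lt_le_trans s00 h1.
  - exact: m1.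
  - exact: measurable_funTS.
have fin : (@dirac _ T t0 R A < +oo)%E by rewrite diracE ltry.
have bnd t y : A t -> (`]0, len k'[%classic : set (measurableTypeR R)) y ->
    n1 (K (Num.sqrt (l t))%:C k (x t) k' y) <= L + 1.
  move=> At; rewrite /= in_itv/= => /andP[y0 yl]; have [ht hx] := hA _ At.
  have [|h1 _] := h k k' _ y hx; first by rewrite !ltW.
  by rewrite (le_trans (ImB0 _ _ _ _ _))// (le_trans (h1 _ (sqrt_strip y10 ht)))// lerDl.
(* Only measurability is needed, so any finite measure on [T] will do. *)
have [|mm _] := @cinteg_kernel R _ _ T (measurableTypeR R) (@dirac _ T t0 R) leb
  (fun p => K (Num.sqrt (l p.1))%:C k (x p.1) k' p.2) (fun=> 1) (f (inl k')) A `]0, len k'[%classic (L + 1)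
  mA mo fin mk (cmf_cst _ _) (cintegrable_inl k' Lf) bnd.
  by move=> t _; rewrite n1_1 lerDr.
by apply: eq_cmf mm => t _; rewrite mul1r.
Qed.

(** * The density of (E(.)f, v) and the right-hand side as an inner product *)

Section Window.
Variables (h : R -> R[i]) (ch : ccontinuous h).

Definition im_kint_window : gfun G := fun k x =>
  - (pi^-1)%:C * cint `]a, b[ (fun l => h l * im_kint l k x).

Let mab : measurable (`]a, b[%classic : set (measurableTypeR R)).
Proof. exact: measurable_itv. Qed.

Let itv_ab l : (`]a, b[%classic : set R) l -> a <= l <= b.
Proof. by rewrite /= in_itv/= => /andP[al lb]; rewrite !ltW. Qed.

Let h_bounded : exists2 H : R, 0 <= H & forall l, a <= l <= b -> n1 (h l) <= H.
Proof.
have [H hH] := ccontinuous_bounded a b ch; exists (Num.max H 0).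
  by rewrite le_max lexx orbT.
by move=> l lab; rewrite le_max hH.
Qed.

Let cmf_h D : cmfR D h.
Proof. by apply: (cmfS (E := setT)) => //; exact: ccontinuous_cmf. Qed.

Let cintegrable_h : cintegrable leb `]a, b[ h.
Proof.
have [H H0 hH] := h_bounded.
by apply: (cintegrable_bounded mab (M := H)) => //; [exact: leb_oo_lty|move=> l /itv_ab /hH].
Qed.

(** For real z the kernel need not decay along the infinite edges, so the bound is stated on
    truncated edges. Square integrability of the whole function will come from [represent_L2]. *)
Lemma window_cmf_bounded n k : cmfR (edge_below n k) (im_kint_window k) /\
  exists M : R, forall x, edge_below n k x -> n1 (im_kint_window k x) <= M.
Proof.
have [y1 [L [/andP[y10 _] L0] hL]] := kint_bounds n%:R.
have [H H0 hH] := h_bounded.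
have mB := measurable_edge_below n k.
have mK : cmf (T := (measurableTypeR R * measurableTypeR R)%type) (edge_below n k `*` `]a, b[%classic)
    (fun p => im_kint p.2 k p.1).
  apply: (@cmf_im_kint _ _ _ (fun p => p.2) (fun p => p.1) n k).
  - exact: measurableX.
  - by apply: measurable_funTS; exact: measurable_snd.
  - by apply: measurable_funTS; exact: measurable_fst.
  - by move=> p [/edge_below_bnd hx /itv_ab hl].
have bK x l : edge_below n k x -> (`]a, b[%classic : set R) l -> n1 (im_kint l k x) <= L + 1.
  move=> /edge_below_bnd hx /itv_ab hl; have [h1 _] := hL k x hx.
  by rewrite (le_trans (h1 _ (sqrt_strip y10 hl)))// lerDl.
have [|mw _] := @cinteg_kernel R _ _ (measurableTypeR R) (measurableTypeR R) leb leb
  (fun p => im_kint p.2 k p.1) (fun=> 1) h (edge_below n k) `]a, b[%classic (L + 1)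
  mB mab (edge_below_lty n k) mK (cmf_cst _ _) cintegrable_h bK.
  by move=> x _; rewrite n1_1 lerDr.
have e x : 1 * cinteg leb `]a, b[ (fun l => im_kint l k x * h l) =
    cint `]a, b[ (fun l => h l * im_kint l k x).
  by rewrite mul1r cintE; apply: eq_cinteg => l _; rewrite mulrC.
split.
  apply: cmfM; first exact: cmf_cst.
  by apply: eq_cmf mw => x _; rewrite e.
exists (n1 (- (pi^-1)%:C : R[i]) * \int[leb]_(l in `]a, b[) ((L + 1) * n1 (h l))) => x Bx.
have in1 := integrable_n1 mab cintegrable_h.
rewrite (le_trans (n1M _ _))// ler_wpM2l ?n1_ge0// cintE n1_cinteg_le//.
- apply: cmfM => //; apply: (@cmf_im_kint _ (measurableTypeR R) _ id (fun=> x) n k) => //.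
  by move=> l /itv_ab hl; split => //; exact: edge_below_bnd Bx.
- exact: RintegrableZ.
- move=> l hl; rewrite (le_trans (n1M _ _))// mulrC ler_wpM2r ?n1_ge0//.
  exact: bK.
Qed.

Lemma window_restr_L2 n : L2 (restr_below n im_kint_window).
Proof.
move=> k; have [mw [M hM]] := window_cmf_bounded n k.
have mB := measurable_edge_below n k; have mk := measurable_edge_dom (G := G) k.
have e x : edge_dom k x -> ind (edge_below n k) x * im_kint_window k x = restr_below n im_kint_window k x.
  move=> kx; rewrite /restr_below; congr (_ * _); rewrite /ind !indicE /edge_below in_setI.
  by rewrite (mem_set kx).
have M0 : 0 <= Num.max M 0 by rewrite le_max lexx orbT.
apply: (sqint_dom (g := fun x => (Num.max M 0) ^+ 2 * \1_(edge_below n k) x)) => //.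
- apply: (eq_cmf (f := fun x => ind (edge_below n k) x * im_kint_window k x)).
    by move=> x; rewrite inE; exact: e.
  by apply: (cmfS (E := setT)) => //; exact: cmf_mkcond.
- apply: RintegrableZ => //; apply: (integrableS measurableT) => //.
  apply: integrable_indic_lty => //; exact: edge_below_lty.
- move=> x kx; rewrite -e// sqmodM /ind sqmod_real indicE.
  have [Bx|Bx] := boolP (x \in edge_below n k); last by rewrite expr0n mul0r mulr0.
  rewrite expr1n mul1r mulr1 (le_trans (sqmod_n1 _))// lerXn2r ?nnegrE ?n1_ge0//.
  by rewrite le_max hM//; exact: set_mem.
Qed.

Lemma window_cmf k : cmfR (edge_dom k) (im_kint_window k).
Proof.
apply: (cmf_cvg (f := fun n => restr_below n im_kint_window k)).
  by move=> n; exact: (L2_cmf k (window_restr_L2 n)).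
move=> x _; apply: (ccvg_near_bound (b := fun=> 0)); last exact: cvg_cst.
near=> n; rewrite /restr_below ind_in ?mul1r ?subrr ?n10//.
rewrite mem_setE in_itv/=.
near: n; exact: nbhs_infty_ger.
Unshelve. all: by end_near. Qed.

Variables (n : nat) (v : gfun G) (Lv : L2 v) (vn : eq_ae v (restr_below n v)).

Let B (k : edge G) := edge_below n k.
Let mB k : measurable (B k). Proof. exact: measurable_edge_below. Qed.
Let iv k : cintegrable leb (B k) (fun x => conjc (v k x)).
Proof. exact: cintegrable_edge_below. Qed.

Lemma pairing_bound (w : gfun G) (L : R) : (forall k, cmfR (B k) (w k)) ->
  (forall k x, B k x -> n1 (w k x) <= L) ->
  n1 (pairing_below n w v) <= L * \sum_k \int[leb]_(x in B k) n1 (conjc (v k x)).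
Proof.
move=> mw wL; rewrite (le_trans (n1_sum _ _ _))// mulr_sumr ler_sum// => k _.
have in1 := integrable_n1 (mB k) (iv k).
rewrite -RintegralZl//; apply: n1_cinteg_le => //.
- by apply: cmfM => //; exact: (cintegrable_cmf (iv k)).
- exact: RintegrableZ.
- by move=> x Bx; rewrite (le_trans (n1M _ _))// ler_wpM2r ?n1_ge0// wL.
Qed.

Lemma pairing_belowB (w w' : gfun G) (L : R) :
  (forall k, cmfR (B k) (w k)) -> (forall k, cmfR (B k) (w' k)) ->
  (forall k x, B k x -> n1 (w k x) <= L) -> (forall k x, B k x -> n1 (w' k x) <= L) ->
  pairing_below n w v - pairing_below n w' v = pairing_below n (fun k x => w k x - w' k x) v.
Proof.
move=> mw mw' wL wL'; rewrite /pairing_below -sumrB; apply: eq_bigr => k _.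
rewrite -(cintegB (mB k)).
- by apply: eq_cinteg => x _; rewrite mulrBl.
- by apply: (cintegrableMl (mB k) (M := L)) => // x Bx; exact: wL.
- by apply: (cintegrableMl (mB k) (M := L)) => // x Bx; exact: wL'.
Qed.

(** Used with [al] = 1, for the measurability of [density], and with [al] = h, for the final
    exchange of integrals. *)
Lemma pairing_fubini (A : set (measurableTypeR R)) (al : R -> R[i]) (H : R) :
  measurable A -> (forall l, A l -> a <= l <= b) -> cmfR A al ->
  (forall l, A l -> n1 (al l) <= H) ->
  cintegrable leb A (fun l => al l * pairing_below n (im_kint l) v) /\
  cinteg leb A (fun l => al l * pairing_below n (im_kint l) v) =
  pairing_below n (fun k x => cinteg leb A (fun l => al l * im_kint l k x)) v.
Proof.
move=> mA Aab ma aH.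
have [y1 [L [/andP[y10 _] L0] hL]] := kint_bounds n%:R.
have fA : (leb A < +oo)%E.
  by apply: le_lt_trans (leb_segment_lty a b); apply: le_measure; rewrite ?inE//.
have bK k l x : A l -> B k x -> n1 (im_kint l k x) <= L.
  move=> Al /edge_below_bnd hx; have [h1 _] := hL k x hx.
  exact: h1 (sqrt_strip y10 (Aab _ Al)).
pose P k l := cinteg leb (B k) (fun x => im_kint l k x * conjc (v k x)).
have key k : cmfR A (fun l => al l * P k l) /\ cinteg leb A (fun l => al l * P k l) =
    cinteg leb (B k) (fun x => cinteg leb A (fun l => al l * im_kint l k x) * conjc (v k x)).
  apply: (@cinteg_kernel R _ _ (measurableTypeR R) (measurableTypeR R) leb leb
    (fun p => im_kint p.1 k p.2) al (fun x => conjc (v k x)) A (B k) (Num.max L H)) => //.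
  - apply: (@cmf_im_kint _ _ _ (fun p => p.1) (fun p => p.2) n k).
    + exact: (measurableX mA (mB k)).
    + by apply: measurable_funTS; exact: measurable_fst.
    + by apply: measurable_funTS; exact: measurable_snd.
    + by move=> p [Al /edge_below_bnd hx]; split => //; exact: Aab.
  - by move=> l x Al Bx; rewrite le_max bK.
  - by move=> l Al; rewrite le_max aH// orbT.
have iP k : cintegrable leb A (fun l => al l * P k l).
  have in1 := integrable_n1 (mB k) (iv k).
  apply: (cintegrable_bounded mA (M := H * \int[leb]_(x in B k) (L * n1 (conjc (v k x))))) => //.
    exact: (key k).1.
  move=> l Al; rewrite (le_trans (n1M _ _))// ler_pM ?n1_ge0 ?aH//.
  apply: n1_cinteg_le => //.
  + apply: cmfM; last exact: (cintegrable_cmf (iv k)).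
    apply: (@cmf_im_kint _ (measurableTypeR R) _ (fun=> l) id n k) => //.
    by move=> x /edge_below_bnd hx; split => //; exact: Aab.
  + exact: RintegrableZ.
  + by move=> x Bx; rewrite (le_trans (n1M _ _))// ler_wpM2r ?n1_ge0// bK.
have e l : al l * pairing_below n (im_kint l) v = \sum_k al l * P k l.
  by rewrite /pairing_below mulr_sumr.
split.
  have := cintegrable_sum mA (index_enum (edge G)) (P := xpredT) (fun k _ => iP k).
  by apply: eq_cintegrable => // l _; rewrite e.
rewrite (eq_cinteg leb (fun l _ => e l)) cinteg_sum//.
by apply: eq_bigr => k _; exact: (key k).2.
Qed.

(** The density of (E(.)f, v) with respect to Lebesgue measure, as [sp_form_hind_density]
    confirms. *)
Definition density (l : R) : R[i] := - (pi^-1)%:C * pairing_below n (im_kint l) v.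

Lemma density_cmf : cmfR `[a, b] density.
Proof.
have ab' l : (`[a, b]%classic : set (measurableTypeR R)) l -> a <= l <= b by rewrite /= in_itv.
have b1 l : (`[a, b]%classic : set (measurableTypeR R)) l -> n1 (1 : R[i]) <= 1 by rewrite n1_1.
have [mp _] := pairing_fubini (measurable_segment a b) ab' (cmf_cst _ 1) b1.
apply: cmfM; first exact: cmf_cst.
by apply: eq_cmf (cintegrable_cmf mp) => l _; rewrite mul1r.
Qed.

Let eq_inner_below (w : gfun G) : (forall k, cmfR (edge_dom k) (w k)) ->
  inner w v = pairing_below n w v.
Proof. by move=> mw; exact: inner_below. Qed.

(** The hypotheses of [stone]. The form of the Poisson kernel is exactly the pairing with the kernel
    at a root z of l + i eps; the density is the same expression at sqrt l, and the kernel is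
    Lipschitz between the two points. *)
Lemma density_bounds : exists C : R, exists n0 : nat,
  (forall l, a <= l <= b -> n1 (density l) <= C) /\
  (forall m l, (n0 <= m)%N -> a <= l <= b ->
     n1 (sp_form E (fun t => (poisson m.+1%:R^-1 (l - t))%:C) f v - density l) <= C / m.+1%:R).
Proof.
have [y1 [L [/andP[y10 y11] L0] hL]] := kint_bounds n%:R.
set c := - (pi^-1)%:C : R[i]; set V := \sum_k \int[leb]_(x in B k) n1 (conjc (v k x)).
have V0 : 0 <= V by apply: sumr_ge0 => k _; apply: Rintegral_ge0 => x _; exact: n1_ge0.
(* For Im z <= 1, [sqrt_perturb] gives |Re z - sqrt l| <= Im z / s0 and Im z <= eps / (2 s0); their
   combination bounds the distance from z to sqrt l by D eps. *)
pose D := (s0^-1 + 1) / (2 * s0).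
have D0 : 0 <= D by rewrite divr_ge0 ?addr_ge0 ?invr_ge0 ?mulr_ge0// ltW.
have mW l k : a <= l <= b -> cmfR (B k) (im_kint l k).
  move=> hl; apply: (@cmf_im_kint _ (measurableTypeR R) _ (fun=> l) id n k) => //.
  by move=> x /edge_below_bnd hx.
have bd l : a <= l <= b -> n1 (density l) <= n1 c * (L * V).
  move=> hl; rewrite (le_trans (n1M _ _))// ler_wpM2l ?n1_ge0// pairing_bound//.
    by move=> k; exact: mW.
  move=> k x /edge_below_bnd hx; have [h1 _] := hL k x hx.
  exact: h1 (sqrt_strip y10 hl).
(* The summands 1 and D serve the two estimates. From this index on, eps <= 2 s0 y1, hence Im z <=
   y1 and z stays in the rectangle where the kernel bounds hold. *)
exists (n1 c * (L * V) * (1 + D)), (Num.truncn (2 * s0 * y1)^-1); split.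
  by move=> l hl; rewrite (le_trans (bd l hl))// ler_peMr ?lerDl// !mulr_ge0 ?n1_ge0.
move=> m l nm hl; set eps := m.+1%:R^-1.
have e0 : 0 < eps by rewrite invr_gt0.
have /andP[al lb] := hl.
have [z [zE z0 zy zl zu]] := sqrt_perturb a0 al e0.
have sy0 : 0 < 2 * s0 * y1 by rewrite !mulr_gt0.
have eps_le : eps <= 2 * s0 * y1.
  rewrite /eps -[leRHS]invrK lef_pV2 ?posrE ?invr_gt0//.
  by rewrite (le_trans (ltW (truncnS_gt _)))// ler_nat.
have zy1 : complex.Im z <= y1.
  rewrite (le_trans zy)// ler_pdivrMr ?mulr_gt0//; by rewrite mulrC.
have Sz : strip s0 s1 y1 z.
  have /andP[h1 h2] := sqrt_ab hl.
  split; last by rewrite (ltW z0) zy1.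
  rewrite (le_trans h1 zl) /= (le_trans zu)// lerD//.
  rewrite ler_pdivrMr// mulVf ?gt_eqF// expr_le1 ?(ltW z0)//.
  exact: le_trans zy1 y11.
have Sl := sqrt_strip y10 hl.
have zl1 : n1 (z - (Num.sqrt l)%:C) <= D * eps.
  rewrite /n1 cReD cImD cReN cImN /= oppr0 addr0 !ger0_norm ?subr_ge0 ?(ltW z0)//.
  have h1 : complex.Im z ^+ 2 / s0 <= complex.Im z / s0.
    rewrite ler_wpM2r ?invr_ge0 ?(ltW s00)// expr2 ler_piMl ?(ltW z0)//.
    exact: le_trans zy1 y11.
  have h2 : complex.Im z / s0 + complex.Im z <= D * eps.
    rewrite (_ : D * eps = (eps / (2 * s0)) * (s0^-1 + 1)); last by rewrite /D mulrC mulrA mulrAC.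
    rewrite -[X in _ + X]mulr1 -mulrDr ler_wpM2r// addr_ge0// invr_ge0 ltW//.
  lra.
have [LT ->] := Im_resolvent_sp_form hconds hA1 hA3 hE z0 zE e0 Yf Lv.
rewrite eq_inner_below; last by move=> k; exact: L2_cmf.
rewrite /density -/c -mulrBr.
have mT k : cmfR (B k) (kint (K z) f k).
  by apply: (cmfS (E := edge_dom k)) (L2_cmf k LT) => // x [].
rewrite (pairing_belowB (L := L)) => //; last first.
- by move=> k x /edge_below_bnd hx; have [h1 _] := hL k x hx; exact: h1.
- by move=> k x /edge_below_bnd hx; have [h1 _] := hL k x hx; exact: h1.
- by move=> k; exact: mW.
rewrite (le_trans (n1M _ _))// (@le_trans _ _ (n1 c * (L * (D * eps) * V)))//.
  rewrite ler_wpM2l ?n1_ge0// pairing_bound//.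
    by move=> k; apply: cmfB => //; exact: mW.
  move=> k x /edge_below_bnd hx; have [_ h2] := hL k x hx.
  by rewrite (le_trans (h2 _ _ Sz Sl))// ler_wpM2l.
rewrite (_ : n1 c * (L * (D * eps) * V) = n1 c * (L * V) * D * eps); last by ring.
by rewrite -/eps ler_wpM2r ?(ltW e0)// ler_wpM2l ?lerDr// !mulr_ge0// n1_ge0.
Qed.

Lemma sp_form_hind_density c d : a <= c -> c < d -> d <= b ->
  sp_form E (fun t => (hind c d t)%:C) f v = cint `[c, d] density.
Proof.
have [C [n0 [h1 h2]]] := density_bounds.
by apply: (stone (E := E) (C := C) (n0 := n0) Lf Lv density_cmf).
Qed.

Let cintegrable_density : cintegrable leb `[a, b] density.
Proof.
have [C [n0 [h1 _]]] := density_bounds.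
exact: (cintegrable_segment density_cmf h1).
Qed.

Let cintegrable_density_in (D : set (measurableTypeR R)) : measurable D ->
  D `<=` `[a, b]%classic -> cintegrable leb D density.
Proof. by move=> mD Dab; apply: cintegrableS Dab cintegrable_density. Qed.

(** The difference of the spectral form and the integral against [density] vanishes on each
    [hind c d] by Stone's formula, so [functional_open_eq0] gives the case of a continuous h. *)
Lemma sp_form_window_density :
  sp_form E (window a b h) f v = cint `]a, b[ (fun l => h l * density l).
Proof.
have mI := measurable_segment a b.
pose L phi := sp_form E phi f v - cinteg leb `[a, b] (fun l => phi l * density l).
have ip phi : bborel phi -> cintegrable leb `[a, b] (fun l => phi l * density l).
  move=> [mp [M hM]]; apply: (cintegrableMl mI (M := M)) => //.
  exact: (cmfS (E := setT)).
have Ll : linear_on_bborel L.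
  apply: linear_onB; first exact: sp_form_linear.
  move=> c phi psi bp bq.
  have e l : (c * phi l + psi l) * density l = c * (phi l * density l) + psi l * density l by ring.
  rewrite (eq_cinteg leb (fun l _ => e l)) (cintegD mI (cintegrableZ mI c (ip _ bp)) (ip _ bq)).
  by rewrite (cintegZ mI c (ip _ bp)).
have Lc : dct_continuous L.
  apply: dct_continuousB; first exact: sp_form_dctc.
  move=> F phi M mF mp FM Fp.
  have [C [n0 [h1 _]]] := density_bounds.
  have in1 := integrable_n1 mI cintegrable_density.
  apply: (cinteg_dct mI (g := fun l => M * n1 (density l))).
  - by move=> m; apply: cmfM; [exact: (cmfS (E := setT))|exact: density_cmf].
  - by apply: cmfM; [exact: (cmfS (E := setT))|exact: density_cmf].
  - exact: RintegrableZ.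
  - by move=> m l _; rewrite (le_trans (n1M _ _))// ler_wpM2r ?n1_ge0.
  - by move=> l _; apply: ccvgM => //; exact: ccvg_cst.
have L0 c d : a < c -> c < d -> d < b -> L (fun t => (hind c d t)%:C) = 0.
  move=> ac cd db; rewrite /L sp_form_hind_density ?(ltW ac) ?(ltW db)//.
  have mo : measurable (`]c, d[%classic : set (measurableTypeR R)) by exact: measurable_itv.
  have mc := measurable_segment c d.
  have so : (`]c, d[%classic : set (measurableTypeR R)) `<=` `[a, b]%classic.
    by move=> t; rewrite /= !in_itv/= => /andP[x y]; rewrite (ltW (lt_trans ac x)) (ltW (lt_trans y db)).
  have sc : (`[c, d]%classic : set (measurableTypeR R)) `<=` `[a, b]%classic.
    by move=> t; rewrite /= !in_itv/= => /andP[x y]; rewrite (ltW (lt_le_trans ac x)) (ltW (le_lt_trans y db)).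
  have e t : (hind c d t)%:C * density t =
      2^-1 * (ind (`]c, d[ : set (measurableTypeR R)) t * density t + ind (`[c, d] : set (measurableTypeR R)) t * density t).
    by rewrite hindE//; ring.
  have i1 := ip _ (bborel_ind mo); have i2 := ip _ (bborel_ind mc).
  rewrite (eq_cinteg leb (fun t _ => e t)) (cintegZ mI _ (cintegrableD mI i1 i2)) (cintegD mI i1 i2).
  rewrite -!cinteg_setIr (setIidr so) (setIidr sc) -!cintE.
  (* The density is an ordinary function, so the open and closed cells have the same integral and
     the two halves of [hind] add up. *)
  rewrite cint_oo_cc; last exact: cintegrable_density_in.
  by apply/eqP; rewrite subr_eq0; apply/eqP; field.
have /eqP := functional_open_eq0 ab Ll Lc ch L0.
rewrite /L subr_eq0 => /eqP ->.
have so : (`]a, b[%classic : set (measurableTypeR R)) `<=` `[a, b]%classic.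
  by move=> t; rewrite /= !in_itv/= => /andP[x y]; rewrite !ltW.
have e t : ind (`]a, b[%classic : set (measurableTypeR R)) t * h t * density t =
  ind (`]a, b[%classic : set (measurableTypeR R)) t * (h t * density t) by rewrite mulrA.
by rewrite (eq_cinteg leb (fun t _ => e t)) -cinteg_setIr (setIidr so) -cintE.
Qed.

(** Exchanging the integrals in l and x turns the integral of h against the density of (E(.)f, v)
    into an inner product with v, in which v no longer enters the first factor. *)
Lemma sp_form_window_inner : sp_form E (window a b h) f v = inner im_kint_window v.
Proof.
have [H H0 hH] := h_bounded.
have hb l : (`]a, b[%classic : set (measurableTypeR R)) l -> n1 (h l) <= H by move=> /itv_ab /hH.
have [iP fub] := pairing_fubini mab (fun l hl => itv_ab hl) (cmf_h _) hb.
rewrite sp_form_window_density eq_inner_below; last exact: window_cmf.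
rewrite cintE; have e l : h l * density l = - (pi^-1)%:C * (h l * pairing_below n (im_kint l) v).
  by rewrite /density; ring.
rewrite (eq_cinteg leb (fun l _ => e l)) cintegZ// fub.
rewrite /pairing_below mulr_sumr; apply: eq_bigr => k _.
have c0 : - (pi^-1)%:C != 0 :> R[i].
  by rewrite oppr_eq0 eq_complex /= eqxx andbT gt_eqF// invr_gt0 pi_gt0.
have [mw [M hM]] := window_cmf_bounded n k.
have iw := cintegrableMl (mB k) mw hM (iv k).
rewrite -[RHS]mul1r -(mulfV c0) -mulrA -(cintegZ (mB k) _ iw); congr (_ * _).
apply: eq_cinteg => x _.
by rewrite /im_kint_window cintE mulrA mulrA mulVf// mul1r.
Qed.

End Window.
End Density.

Theorem theorem2p11 (R : realType) (G : metric_graph R)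
    (conds : 'I_(N G) -> vcond G) (hconds : lists_vertex_conditions conds)
    (d_d d_c : R[i] -> R[i]) (Mp Mc : R[i] -> 'M[R[i]]_(N G))
    (hA1 : assumption_A1 conds d_d d_c Mp Mc)
    (hA3 : assumption_A3 conds Mp)
    (E : resolution G) (hE : is_resolution_of E (@Hop R G))
    (f g : gfun G) (hf : Y_B f) (hg : L2 g)
    (hfc : compact_support f) (hgc : compact_support g)
    (a b : R) (ha : 0 < a) (hab : a < b)
    (h : R[i] -> R[i]) (hh : entire h) :
  inner (fcalc E (fun l => h l%:C) (Eproj E `]a, b[ f)) g =
  - (pi^-1)%:C * \sum_(k : edge G) cint (edge_dom k) (fun x =>
      cint `]a, b[ (fun l => h l%:C *
        \sum_(k' : IB G) cint `]0, len k'[ (fun x' =>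
          (complex.Im (KB conds d_c Mc (Num.sqrt l)%:C k x k' x'))%:C
          * f (inl k') x'))
      * conjc (g k x)).
Proof.
have Lf : L2 f by case: hf.
have ch := entire_ccontinuous hh.
pose w0 := im_kint_window conds d_c Mc f a b (fun l => h l%:C).
have Lcut n : L2 (restr_below n w0).
  exact: (window_restr_L2 hA1 hf ha hab ch).
have rep v : L2 v -> compact_support v -> inner w0 v = sp_form E (window a b (fun l => h l%:C)) f v.
  move=> Lv /compact_support_cut[n vn]; apply/esym.
  exact: (sp_form_window_inner hconds hA1 hA3 hE hf ha hab ch Lv vn).
rewrite (fcalc_inner hab ch Lf Lcut rep hg).
have Lw := represent_L2 ch Lf Lcut rep.
have c0 : - (pi^-1)%:C != 0 :> R[i].
  by rewrite oppr_eq0 eq_complex /= eqxx andbT gt_eqF// invr_gt0 pi_gt0.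
rewrite /inner mulr_sumr; apply: eq_bigr => k _.
have mk := measurable_edge_dom (G := G) k.
(* Integrability is known for the product with [w0], which contains the factor -1/pi; so this factor
   is divided out under the integral. *)
rewrite -[LHS]mul1r -(mulfV c0) -mulrA !cintE.
rewrite -(cintegZ mk _ (cintegrable_inner k Lw hg)); congr (_ * _).
apply: eq_cinteg => x _.
by rewrite /w0 /im_kint_window mulrA mulrA mulVf// mul1r.
Qed.
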